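(* Let $1<p<\infty$. Suppose that $\psi\in L_p(\mathbb R)$ is a wavelet for $L_p(\mathbb R)$ with unconditionality constant $C$. Then $\psi$ is a continuous wavelet for $L_p(\mathbb R)$ with unconditionality constant $C$; that is, $(D_aT_b\psi,\,D^*_{-a}T^*_{-b}\psi^* )_{(a,b)\in\mathbb R^2}$ is a continuous Schauder frame of $L_p(\mathbb R)$ (over $\mathbb R^2$ with Lebesgue measure) whose unconditionality constant is $C$.
   Context: Pettis integral: for a $\sigma$-finite measure space $(M,\Sigma,\mu)$ and a separable Banach space $X$, a function $F:M\to X$ is Pettis integrable if for every $E\in\Sigma$ there is $x_E\in X$ with $f(x_E)=\int_E f(F)\,d\mu$ (Lebesgue integral) for all $f\in X^*$; then $\int_E F\,d\mu:=x_E$. Continuous Schauder frame: a measurable map $t\mapsto (x_t,f_t)\in X\times X^*$ on $M$, where $X$ is a separable Banach space, is a continuous Schauder frame of $X$ if for every $x\in X$ the function $t\mapsto f_t(x)x_t$ is Pettis integrable and $x=\int_M f_t(x)x_t\,d\mu(t)$. Unconditionality constant: the unconditionality constant of a continuous Schauder frame $(x_t,f_t)_{t\in M}$ of $X$ is the least constant $B_u$ such that $\int_M |f_t(x)f(x_t)|\,d\mu(t)\le B_u\|x\|\|f\|$ for all $x\in X$ and $f\in X^*$. An unconditional Schauder basis, paired with its biorthogonal functionals, is a continuous Schauder frame over its countable index set with counting measure, and its unconditionality constant is understood in this sense. Dilation and translation: for $a,b\in\mathbb R$ define the isometries $D_a,T_b:L_p(\mathbb R)\to L_p(\mathbb R)$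 by $D_a(f)(t)=2^{a/p}f(2^at)$ and $T_b(f)(t)=f(t-b)$; $D_a^*,T_b^*$ denote the adjoints on $L_p(\mathbb R)^*=L_{p'}(\mathbb R)$, $1/p+1/p'=1$. Wavelet: $\psi\in L_p(\mathbb R)$ with $\|\psi\|=1$ is a wavelet for $L_p(\mathbb R)$ if $(D_nT_k\psi)_{k,n\in\mathbb Z}$ is an unconditional Schauder basis of $L_p(\mathbb R)$; its unconditionality constant is that of this basis. Then $\psi^*\in L_{p'}(\mathbb R)$ denotes the biorthogonal functional to $\psi=D_0T_0\psi$ in this basis; the biorthogonal functional to $D_nT_k\psi$ is $D^*_{-n}T^*_{-k}\psi^*$. Continuous wavelet: $\psi$ is a continuous wavelet for $L_p(\mathbb R)$ if $(D_aT_b\psi,D^*_{-a}T^*_{-b}\psi^* )_{a,b\in\mathbb R}$ is a continuous Schauder frame of $L_p(\mathbb R)$; its unconditionality constant is that of this continuous Schauder frame.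
   Formalization: The conclusion that the continuous wavelet has unconditionality constant equal to C is replaced by: its least unconditionality constant exists and is at most C; equality with the least constant fails in general, already for p = 2. *)

(* Defs.v *)
From HB Require Import structures.
From mathcomp Require Import all_boot all_order all_algebra generic_quotient.
From mathcomp Require Import all_classical all_reals all_analysis.
From mathcomp Require Import measurable_realfun.

Set Implicit Arguments.
Unset Strict Implicit.
Unset Printing Implicit Defensive.

Import Order.TTheory GRing.Theory Num.Def Num.Theory.
Import numFieldNormedType.Exports.

Local Open Scope classical_set_scope.
Local Open Scope ring_scope.

Section dual_space.
Context (R : realType) (X : normedModType R).

Definition bounded_functional : {pred X -> R^o} :=
  fun f => `[< linear f /\ continuous f >].

(* X^* with the operator norm (dual_norm below) *)
Record dual := Dual {
  dual_fun :> X -> R^o ;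
  dual_funP : dual_fun \in bounded_functional }.

HB.instance Definition _ := [isSub for dual_fun].
HB.instance Definition _ := [Choice of dual by <:].

Let submod_bounded_functional : submod_closed bounded_functional.
Proof.
split.
  apply/asboolP; split; last by move=> x; exact: cvg_cst.
  by move=> a x y; rewrite /= scaler0 addr0.
move=> a f g /asboolP[lf cf] /asboolP[lg cg]; apply/asboolP; split.
  move=> b x y.
  by rewrite /= !fctE lf lg !scalerDr !scalerA [b * a]mulrC addrACA.
by move=> x; apply: cvgD; [apply: cvgZr; exact: cf|exact: cg].
Qed.

HB.instance Definition _ :=
  GRing.isSubmodClosed.Build R (X -> R^o) bounded_functional
    submod_bounded_functional.
HB.instance Definition _ := [SubChoice_isSubLmodule of dual by <:].

Implicit Types f g : dual.

Lemma dualE f g : f = g <-> f =1 g.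
Proof. by split=> [->//|fg]; exact/val_inj/funext. Qed.

Lemma dual_linear f : linear f.
Proof. by have /asboolP[] := dual_funP f. Qed.

Lemma dual_continuous f : continuous f.
Proof. by have /asboolP[] := dual_funP f. Qed.

HB.instance Definition _ f :=
  GRing.isLinear.Build R X R^o *:%R f (dual_linear f).

Definition dual_norm f : R := sup [set `|f x| | x in [set x | `|x| <= 1]].

Lemma dual_has_sup f : has_sup [set `|f x| | x in [set x | `|x| <= 1]].
Proof.
split; first by exists 0, 0; rewrite /= ?normr0// linear0 normr0.
have /linear_boundedP/pinfty_ex_gt0 [M M0 fM] :=
  continuous_linear_bounded (0 : X) (@dual_continuous f 0).
exists M => _ [x /= x1 <-].
by rewrite (le_trans (fM x))// ler_piMr// ltW.
Qed.

Lemma dual_norm_ub f x : `|x| <= 1 -> `|f x| <= dual_norm f.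
Proof. by move=> x1; apply: sup_upper_bound; [exact: dual_has_sup|exists x]. Qed.

Lemma dual_norm_lub f (M : R) :
  (forall x, `|x| <= 1 -> `|f x| <= M) -> dual_norm f <= M.
Proof.
move=> fM; apply: ge_sup; first exact: (dual_has_sup f).1.
by move=> _ [x x1 <-]; exact: fM.
Qed.

Lemma dual_norm_ge0 f : 0 <= dual_norm f.
Proof.
have := @dual_norm_ub f 0; rewrite normr0 linear0 normr0; apply; exact: ler01.
Qed.

Let dual_normD f g : dual_norm (f + g) <= dual_norm f + dual_norm g.
Proof.
apply: dual_norm_lub => x x1; rewrite (le_trans (ler_normD _ _))//.
by rewrite lerD// dual_norm_ub.
Qed.

Let dual_normZle (a : R) f : dual_norm (a *: f) <= `|a| * dual_norm f.
Proof.
apply: dual_norm_lub => x x1.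
by rewrite [leLHS](_ : _ = `|a| * `|f x|) ?normrM// ler_wpM2l// dual_norm_ub.
Qed.

Let dual_normZ (a : R) f : dual_norm (a *: f) = `|a| * dual_norm f.
Proof.
have [->|a0] := eqVneq a 0.
  rewrite scale0r normr0 mul0r; apply/le_anti; rewrite dual_norm_ge0 andbT.
  by apply: dual_norm_lub => x _; rewrite [leLHS](_ : _ = `|0 : R|) ?normr0.
apply/le_anti; rewrite dual_normZle/=.
rewrite -ler_pdivlMl ?normr_gt0// -normfV.
by rewrite -[leLHS](congr1 dual_norm (scalerK a0 f)) dual_normZle.
Qed.

Lemma dual_norm_le f x : `|f x| <= dual_norm f * `|x|.
Proof.
have [->|x0] := eqVneq x 0; first by rewrite linear0 !normr0 mulr0.
rewrite -ler_pdivrMr ?normr_gt0//.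
have := @dual_norm_ub f (`|x|^-1 *: x).
rewrite linearZ/= normrZ normfV normr_id mulVf ?normr_eq0// => /(_ (lexx _)).
by rewrite [X in X <= _ -> _]normrM normfV normr_id mulrC.
Qed.

Let dual_norm0_eq0 f : dual_norm f = 0 -> f = 0.
Proof.
move=> f0; apply/dualE => x; apply/eqP; rewrite -normr_le0.
by rewrite (le_trans (dual_norm_le f x))// f0 mul0r.
Qed.

HB.instance Definition _ := @Lmodule_isNormed.Build R dual
  dual_norm dual_normD dual_normZ dual_norm0_eq0.

End dual_space.

Section adjoint.
Context (R : realType) (X Y : normedModType R).
Variables (A : {linear X -> Y}) (cA : continuous A).

Let adjoint_subproof (f : dual Y) : (f \o A : X -> R^o) \in @bounded_functional R X.
Proof.
apply/asboolP; split; first by move=> a x y /=; rewrite !linearP.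
by move=> x; apply: continuous_comp; [exact: cA|exact: dual_continuous].
Qed.

Definition adjoint (f : dual Y) : dual X := Dual (adjoint_subproof f).

End adjoint.

(* These notions are used below for X separable Banach only; the definitions
   themselves make sense in any normed space. *)
Section frames.
Local Open Scope ereal_scope.
Context d (M : measurableType d) (R : realType).
Variable mu : {sigma_finite_measure set M -> \bar R}.
Variable X : normedModType R.

Definition is_pettis_integral (E : set M) (F : M -> X) (x : X) : Prop :=
  forall f : dual X, mu.-integrable E (fun t => (f (F t))%:E) /\
    \int[mu]_(t in E) (f (F t))%:E = (f x)%:E.

Definition pettis_integrable (F : M -> X) : Prop :=
  forall E, measurable E -> exists x, is_pettis_integral E F x.

(* Borel sigma-algebra of the norm topology of X * X^* *)
Definition borel_measurable (h : M -> X * dual X) : Prop :=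
  measurable_fun setT (h : M -> g_sigma_algebraType (@open (X * dual X)%type)).

Definition continuous_schauder_frame (x : M -> X) (f : M -> dual X) : Prop :=
  [/\ borel_measurable (fun t => (x t, f t)),
      forall y : X, pettis_integrable (fun t => f t y *: x t) &
      forall y : X, is_pettis_integral setT (fun t => f t y *: x t) y].

Definition unconditional_with (x : M -> X) (f : M -> dual X) (B : R) : Prop :=
  forall (y : X) (g : dual X),
    \int[mu]_t (`|f t y * g (x t)|)%:E <= (B * `|y| * `|g|)%:E.

Definition is_unconditionality_constant
    (x : M -> X) (f : M -> dual X) (B : R) : Prop :=
  unconditional_with x f B /\
  forall B', unconditional_with x f B' -> (B <= B')%R.

End frames.

Section bases.
Context (R : realType) (X : normedModType R).

Definition schauder_basis (e : nat -> X) : Prop :=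
  forall x : X, exists! a : nat -> R,
    series (fun j => a j *: e j) @ \oo --> x.

(* e is a Schauder basis in some enumeration s of I, and every expansion
   converges unconditionally, i.e., for every enumeration r of I. *)
Definition unconditional_schauder_basis (I : Type) (e : I -> X) : Prop :=
  exists2 s : nat -> I, bijective s & schauder_basis (e \o s) /\
    forall (a : I -> R) (x : X),
      series (fun j => a (s j) *: e (s j)) @ \oo --> x ->
      forall r : nat -> I, bijective r ->
        series (fun j => a (r j) *: e (r j)) @ \oo --> x.

Definition biorthogonal (I : eqType) (e : I -> X) (f : I -> dual X) : Prop :=
  forall i j, f i (e j) = (i == j)%:R.

End bases.

(* Z x Z with the discrete sigma-algebra *)
Definition ZxZ : Type := (int * int)%type.

HB.instance Definition _ := Countable.on ZxZ.
HB.instance Definition _ := isPointed.Build ZxZ (0, 0).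
HB.instance Definition _ := @isMeasurable.Build default_measure_display
  ZxZ discrete_measurable discrete_measurable0
  discrete_measurableC discrete_measurableU.

Definition counting_ZxZ (R : realType) : set ZxZ -> \bar R := counting.

HB.instance Definition _ (R : realType) :=
  Measure.copy (counting_ZxZ R) (@counting ZxZ R).

Lemma sigma_finite_counting_ZxZ (R : realType) :
  sigma_finite [set: ZxZ] (counting_ZxZ R).
Proof.
exists (fun n => [set x : ZxZ | (pickle x < n)%N]).
  apply/seteqP; split=> // x _; exists (pickle x).+1 => //=.
move=> n; split=> //.
rewrite /counting_ZxZ /counting asboolT ?ltry//.
apply: (@finite_preimage _ _ `I_n (@pickle ZxZ)) => //.
by move=> x y _ _; exact: (pcan_inj pickleK).
Qed.

HB.instance Definition _ (R : realType) :=
  @Measure_isSigmaFinite.Build _ _ _ (counting_ZxZ R)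
    (sigma_finite_counting_ZxZ R).

Section lebesgue_measure_R2.
Context (R : realType).
Local Notation RB := (measurableTypeR R).

Definition lebesgue_measure2 : set (RB * RB)%type -> \bar R :=
  (@lebesgue_measure R \x @lebesgue_measure R)%E.

HB.instance Definition _ := Measure.copy lebesgue_measure2
  ((@lebesgue_measure R \x @lebesgue_measure R)%E
    : {measure set (RB * RB)%type -> \bar R}).

Lemma sigma_finite_lebesgue_measure2 :
  sigma_finite [set: RB * RB] lebesgue_measure2.
Proof.
have /sigma_finiteP[F [TF ndF Foo]] := sigma_finiteT (@lebesgue_measure R).
exists (fun n => F n `*` F n).
  rewrite -setXTT TF predeqE => -[x y]; split => /=.
    move=> [[n _ Fnx] [k _ Fky]]; exists (maxn n k) => //; split.
    - by move: x Fnx; exact/subsetPset/ndF/leq_maxl.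
    - by move: y Fky; exact/subsetPset/ndF/leq_maxr.
  by move=> [n _ []/= ? ?]; split; exists n.
move=> k; have [mF Fk] := Foo k; split; first exact: measurableX.
rewrite [ltLHS](product_measure1E (@lebesgue_measure R) (@lebesgue_measure R))//.
by rewrite lte_mul_pinfty// ge0_fin_numE.
Qed.

HB.instance Definition _ :=
  Measure_isSigmaFinite.Build _ _ _ lebesgue_measure2
    sigma_finite_lebesgue_measure2.

End lebesgue_measure_R2.

(* L_p as a normed space: the library's LfunType mu p1 is the space of
   p-integrable measurable functions, not yet quotiented by a.e. equality. *)
Section Lp_space.
Context d (T : measurableType d) (R : realType).
Variables (mu : {measure set T -> \bar R}) (p : R) (p1 : (1 <= p%:E)%E).
Local Notation Lf := (LfunType mu p1).

Definition Lp_eq_op (f g : Lf) : bool := `[< f = g %[ae mu] >].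

Let Lp_eq_op_refl : reflexive Lp_eq_op.
Proof. by move=> f; apply/asboolP; exact: ae_eq_refl. Qed.

Let Lp_eq_op_sym : symmetric Lp_eq_op.
Proof. by move=> f g; apply/idP/idP => /asboolP h; apply/asboolP/ae_eq_sym. Qed.

Let Lp_eq_op_trans : transitive Lp_eq_op.
Proof.
by move=> f g h /asboolP gf /asboolP fh; apply/asboolP/(ae_eq_trans gf fh).
Qed.

Canonical Lp_eq_op_canonical :=
  EquivRel Lp_eq_op Lp_eq_op_refl Lp_eq_op_sym Lp_eq_op_trans.

Local Open Scope quotient_scope.

Definition Lp : Type := {eq_quot Lp_eq_op}.
HB.instance Definition _ := Choice.on Lp.
HB.instance Definition _ := EqQuotient.on Lp.

Definition Lp_fun (x : Lp) : Lf := repr x.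
Definition toLp (f : Lf) : Lp := \pi f.

Lemma Lp_funK : cancel Lp_fun toLp.
Proof. exact: reprK. Qed.

Lemma toLpP (f g : Lf) : toLp f = toLp g <-> f = g %[ae mu].
Proof.
by rewrite /toLp; split => [/eqmodP/asboolP//|fg]; apply/eqmodP/asboolP.
Qed.

Lemma toLpK (f : Lf) : Lp_fun (toLp f) = f %[ae mu].
Proof. by apply/toLpP; rewrite Lp_funK. Qed.

Let ae_D (f f' g g' : Lf) : f = f' %[ae mu] -> g = g' %[ae mu] ->
  (f + g : Lf) = (f' + g' : Lf) %[ae mu].
Proof.
move=> ff' gg'; apply: filterS2 ff' gg' => t /= ft gt _.
by rewrite /GRing.add/= ft// gt.
Qed.

Let ae_Z (a : R) (f f' : Lf) : f = f' %[ae mu] ->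
  (a *: f : Lf) = (a *: f' : Lf) %[ae mu].
Proof. by move=> ff'; apply: filterS ff' => t /= ft _; rewrite /GRing.scale/= ft. Qed.

Definition Lp_zero : Lp := toLp 0.
Definition Lp_add (x y : Lp) : Lp := toLp (Lp_fun x + Lp_fun y).
Definition Lp_opp (x : Lp) : Lp := toLp (- Lp_fun x).
Definition Lp_scale (a : R) (x : Lp) : Lp := toLp (a *: Lp_fun x).

Let Lp_addE (f g : Lf) : Lp_add (toLp f) (toLp g) = toLp (f + g).
Proof. by apply/toLpP/ae_D; exact: toLpK. Qed.

Let Lp_scaleE (a : R) (f : Lf) : Lp_scale a (toLp f) = toLp (a *: f).
Proof. by apply/toLpP/ae_Z; exact: toLpK. Qed.

Let Lp_oppE (f : Lf) : Lp_opp (toLp f) = toLp (- f).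
Proof.
by rewrite /Lp_opp -!(scaleN1r (V := Lf)); apply/toLpP/ae_Z; exact: toLpK.
Qed.

Let Lp_addA : associative Lp_add.
Proof.
move=> x y z; rewrite -(Lp_funK x) -(Lp_funK y) -(Lp_funK z).
by rewrite !Lp_addE addrA.
Qed.

Let Lp_addC : commutative Lp_add.
Proof. by move=> x y; rewrite /Lp_add addrC. Qed.

Let Lp_add0 : left_id Lp_zero Lp_add.
Proof. by move=> x; rewrite -(Lp_funK x) Lp_addE add0r. Qed.

Let Lp_addN : left_inverse Lp_zero Lp_opp Lp_add.
Proof. by move=> x; rewrite -(Lp_funK x) Lp_oppE Lp_addE addNr. Qed.

HB.instance Definition _ :=
  GRing.isZmodule.Build Lp Lp_addA Lp_addC Lp_add0 Lp_addN.

Let Lp_scaleA (a b : R) (x : Lp) :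
  Lp_scale a (Lp_scale b x) = Lp_scale (a * b) x.
Proof. by rewrite -(Lp_funK x) !Lp_scaleE scalerA. Qed.

Let Lp_scale1 : left_id 1 Lp_scale.
Proof. by move=> x; rewrite -(Lp_funK x) Lp_scaleE scale1r. Qed.

Let Lp_scaleDr : right_distributive Lp_scale +%R.
Proof.
move=> a x y; rewrite /+%R/= -(Lp_funK x) -(Lp_funK y).
by rewrite Lp_addE !Lp_scaleE Lp_addE scalerDr.
Qed.

Let Lp_scaleDl (x : Lp) : {morph Lp_scale^~ x : a b / a + b}.
Proof.
by move=> a b; rewrite /+%R/= -(Lp_funK x) !Lp_scaleE Lp_addE scalerDl.
Qed.

HB.instance Definition _ := GRing.Zmodule_isLmodule.Build R Lp
  Lp_scaleA Lp_scale1 Lp_scaleDr Lp_scaleDl.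

Let toLp_linear : linear toLp.
Proof. by move=> a f g; rewrite /+%R/= /*:%R/= Lp_scaleE Lp_addE. Qed.

HB.instance Definition _ := GRing.isLinear.Build R Lf Lp *:%R toLp toLp_linear.

Definition Lp_norm (x : Lp) : R := fine ('N[mu]_p%:E[EFin \o Lp_fun x])%E.

Lemma Lnorm_ae (f g : Lf) : f = g %[ae mu] ->
  ('N[mu]_p%:E[EFin \o f] = 'N[mu]_p%:E[EFin \o g])%E.
Proof.
have mLf (h : Lf) :
    measurable_fun setT ((fun t => `|(h t)%:E| `^ p)%E : T -> \bar R).
  apply: (measurableT_comp (measurable_poweR _)).
  by apply: measurableT_comp => //; exact/measurable_EFinP.
move=> fg; rewrite unlock /Lnorm; congr (_ `^ _)%E.
apply: ge0_ae_eq_integral => //; [exact: mLf|exact: mLf| | |].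
- by move=> x _; rewrite poweR_ge0.
- by move=> x _; rewrite poweR_ge0.
by apply: filterS fg => t /= + _ => ->.
Qed.

Lemma Lp_normE (f : Lf) :
  (Lp_norm (toLp f))%:E = ('N[mu]_p%:E[EFin \o f])%E.
Proof.
by rewrite /Lp_norm finite_norm_fine; apply: Lnorm_ae; exact: toLpK.
Qed.

Let Lp_normD x y : Lp_norm (x + y) <= Lp_norm x + Lp_norm y.
Proof.
have := ler_LnormD (Lp_fun x) (Lp_fun y).
rewrite -lee_fin EFinD !finite_norm_fine.
by rewrite -(Lp_funK x) -(Lp_funK y) -raddfD -lee_fin EFinD !Lp_normE !Lp_funK.
Qed.

Let Lp_normZ (a : R) x : Lp_norm (a *: x) = `|a| * Lp_norm x.
Proof.
apply: EFin_inj; rewrite -(Lp_funK x) -linearZ EFinM !Lp_normE.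
exact: LnormZ.
Qed.

Let Lp_norm0_eq0 x : Lp_norm x = 0 -> x = 0.
Proof.
rewrite -(Lp_funK x) => x0; rewrite -[RHS](raddf0 toLp); apply/toLpP.
apply: fine_Lnormr_eq0; rewrite -[RHS]x0.
by apply: EFin_inj; rewrite Lp_normE finite_norm_fine.
Qed.

HB.instance Definition _ := @Lmodule_isNormed.Build R Lp
  Lp_norm Lp_normD Lp_normZ Lp_norm0_eq0.

End Lp_space.

Section affine_change_of_variable.
Context (R : realType).
Local Notation leb := (@lebesgue_measure R).
Implicit Types (c b : R).

Let affine c b : measurableTypeR R -> measurableTypeR R := fun t => c * t - b.

Let measurable_affine c b : measurable_fun setT (affine c b).
Proof. by apply: measurable_funB => //; exact: measurable_funM. Qed.

Lemma lebesgue_measure_affine c b (A : set (measurableTypeR R)) : 0 < c ->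
  measurable A ->
  (leb ((fun t : R => (c * t - b)%R) @^-1` A) = c^-1%:E * leb A)%E.
Proof.
move=> c0 mA; rewrite -[LHS]/(pushforward leb (affine c b) A).
have c0' : 0 <= c by exact: ltW.
have -> : (leb A = c%:E * pushforward leb (affine c b) A)%E.
  pose m0 : {measure set _ -> \bar R} :=
    mscale (NngNum c0') (pushforward leb (affine c b)).
  pose m := m0 (measurable_affine c b).
  rewrite -[RHS]/(m A).
  apply: (@lebesgue_measure_unique _ m) => // _ [[x y] _ <-].
  rewrite -[RHS]/(c%:E * leb (affine c b @^-1` `]x, y]))%E.
   rewrite (_ : affine c b @^-1` _ = `](x + b) / c, (y + b) / c]%classic); last first.
    apply/seteqP; split=> t /=; rewrite !in_itv/= /affine.
      by rewrite ltr_pdivrMr// ler_pdivlMr// [t * c]mulrC ltrBrDr lerBlDr.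
    by rewrite ltr_pdivrMr// ler_pdivlMr// [t * c]mulrC ltrBrDr lerBlDr.
  rewrite !lebesgue_measure_itv/= !lte_fin ltr_pM2r ?invr_gt0// ltrD2r.
  case: ifPn => _; last by rewrite mule0.
  rewrite -!EFinB -EFinM; congr (_%:E).
  by rewrite -mulrBl opprD addrACA subrr addr0 mulrCA mulfV ?mulr1 ?gt_eqF.
by rewrite muleA -EFinM mulVf ?gt_eqF// mul1e.
Qed.

Lemma ge0_integral_affine c b (F : R -> \bar R) : 0 < c ->
  measurable_fun setT F -> (forall t, (0 <= F t)%E) ->
  (\int[leb]_t F (c * t - b)%R = c^-1%:E * \int[leb]_t F t)%E.
Proof.
move=> c0 mF F0.
have c0' : 0 <= c^-1 by rewrite invr_ge0 ltW.
rewrite -(@ge0_integral_mscale _ _ _ leb _ _ (NngNum c0'))//.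
transitivity (\int[pushforward leb (affine c b)]_t F t)%E.
  by rewrite ge0_integral_pushforward.
apply: eq_measure_integral => A mA _.
exact: lebesgue_measure_affine.
Qed.

Lemma ae_eq_affine c b (f g : R -> R) : 0 < c ->
  f = g %[ae leb] ->
  (fun t => f (c * t - b)) = (fun t => g (c * t - b)) %[ae leb].
Proof.
move=> c0 [N [mN N0 fgN]]; exists ((fun t : R => c * t - b) @^-1` N); split.
- by rewrite -[X in measurable X]setTI; exact: measurable_affine.
- by rewrite lebesgue_measure_affine// N0 mule0.
- by move=> t /= fgt; apply: fgN => /= fgt'; apply: fgt => _; exact: fgt'.
Qed.

End affine_change_of_variable.

Section dilation_translation.
Context (R : realType) (p : R) (p1 : (1 <= p%:E)%E).
Local Notation leb := (@lebesgue_measure R).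
Local Notation Lf := (LfunType leb p1).

Let p_gt0 : 0 < p.
Proof. by rewrite -lte_fin (lt_le_trans _ p1)// lte_fin. Qed.

Let dil (a : R) (f : R -> R) : R -> R :=
  fun t => 2 `^ (a / p) * f (2 `^ a * t).
Let tr (b : R) (f : R -> R) : R -> R := fun t => f (t - b).

Let measurable_dil a (f : Lf) : measurable_fun setT (dil a f).
Proof.
rewrite /dil; apply: measurable_funM => //.
by apply: (measurableT_comp (f := f)) => //; exact: measurable_funM.
Qed.

Let measurable_tr b (f : Lf) : measurable_fun setT (tr b f).
Proof. by apply: (measurableT_comp (f := f)) => //; exact: measurable_funB. Qed.

Let mpow (f : Lf) : measurable_fun setT (fun t => `|(f t)%:E| `^ p)%E.
Proof.
apply: (measurableT_comp (measurable_poweR _)).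
by apply: measurableT_comp => //; exact/measurable_EFinP.
Qed.

Let Lnorm_dil a (f : Lf) :
  ('N[leb]_p%:E[EFin \o dil a f] = 'N[leb]_p%:E[EFin \o f])%E.
Proof.
have a0 : (0:R) < 2 `^ a by rewrite powR_gt0.
rewrite unlock /Lnorm; congr (_ `^ _)%E.
transitivity (\int[leb]_t ((2 `^ a)%:E * `|(f (2 `^ a * t - 0)%R)%:E| `^ p))%E.
  apply: eq_integral => t _ /=.
  rewrite /dil subr0 normrM ger0_norm ?powR_ge0// powRM// ?powR_ge0//.
  by rewrite -powRrM divfK ?gt_eqF.
have mf : measurable_fun setT
    ((fun t => `|(f (2 `^ a * t - 0)%R)%:E| `^ p)%E : R -> \bar R).
  apply: (measurableT_comp (mpow f)).
  by apply: measurable_funB => //; exact: measurable_funM.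
rewrite ge0_integralZl_EFin ?powR_ge0//; last by move=> t _; exact: poweR_ge0.
rewrite (@ge0_integral_affine _ _ _ (fun t => `|(f t)%:E| `^ p)%E)//.
- by rewrite muleA -EFinM mulfV ?gt_eqF// mul1e.
- exact: mpow.
- by move=> t; rewrite poweR_ge0.
Qed.

Let Lnorm_tr b (f : Lf) :
  ('N[leb]_p%:E[EFin \o tr b f] = 'N[leb]_p%:E[EFin \o f])%E.
Proof.
rewrite unlock /Lnorm; congr (_ `^ _)%E.
transitivity (\int[leb]_t (`|(f (1 * t - b)%R)%:E| `^ p))%E.
  by apply: eq_integral => t _ /=; rewrite mul1r.
rewrite (@ge0_integral_affine _ _ _ (fun t => `|(f t)%:E| `^ p)%E)//.
- by rewrite invr1 mul1e.
- exact: mpow.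
- by move=> t; rewrite poweR_ge0.
Qed.

Lemma dilation_fun_Lfun a (f : Lf) :
  (fun t => 2 `^ (a / p) * f (2 `^ a * t)) \in Lfun leb p%:E.
Proof.
apply/andP; split; rewrite inE/=; first exact: measurable_dil.
by rewrite /finite_norm (Lnorm_dil a f); exact: Lfunction_finite.
Qed.

Lemma translation_fun_Lfun b (f : Lf) :
  (fun t => f (t - b)) \in Lfun leb p%:E.
Proof.
apply/andP; split; rewrite inE/=; first exact: measurable_tr.
by rewrite /finite_norm (Lnorm_tr b f); exact: Lfunction_finite.
Qed.

Definition dilation_fun (a : R) (f : Lf) : Lf :=
  Lfun_Sub p1 (dilation_fun_Lfun a f).

Definition translation_fun (b : R) (f : Lf) : Lf :=
  Lfun_Sub p1 (translation_fun_Lfun b f).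

Definition dilation (a : R) (x : Lp leb p1) : Lp leb p1 :=
  toLp (dilation_fun a (Lp_fun x)).

Definition translation (b : R) (x : Lp leb p1) : Lp leb p1 :=
  toLp (translation_fun b (Lp_fun x)).

Lemma dilation_toLp a (f : Lf) : dilation a (toLp f) = toLp (dilation_fun a f).
Proof.
apply/toLpP.
have := @ae_eq_affine _ (2 `^ a) 0 _ _ (powR_gt0 a (ltr0n _ 2)) (toLpK f).
by apply: (@filterS _ _ (ae_filter_ringOfSetsType leb)) => t /= + _ => /(_ I); rewrite !subr0 => ->.
Qed.

Lemma translation_toLp b (f : Lf) :
  translation b (toLp f) = toLp (translation_fun b f).
Proof.
apply/toLpP.
have := @ae_eq_affine _ 1 b _ _ ltr01 (toLpK f).
by apply: (@filterS _ _ (ae_filter_ringOfSetsType leb)) => t /= + _ => /(_ I); rewrite !mul1r => ->.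
Qed.

Lemma dilation_linear a : linear (dilation a).
Proof.
move=> k x y; rewrite -(Lp_funK x) -(Lp_funK y) -linearP !dilation_toLp -linearP.
congr toLp; apply/LfuneqP => t /=.
by rewrite /GRing.add/= /GRing.scale/= /GRing.add/= mulrDr mulrCA.
Qed.

Lemma translation_linear b : linear (translation b).
Proof.
move=> k x y; rewrite -(Lp_funK x) -(Lp_funK y) -linearP.
rewrite !translation_toLp -linearP.
by congr toLp; apply/LfuneqP.
Qed.

HB.instance Definition _ a :=
  GRing.isLinear.Build R _ _ *:%R (dilation a) (dilation_linear a).
HB.instance Definition _ b :=
  GRing.isLinear.Build R _ _ *:%R (translation b) (translation_linear b).

Lemma norm_dilation a x : `|dilation a x| = `|x|.
Proof.
rewrite -(Lp_funK x) dilation_toLp; apply: EFin_inj.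
by rewrite [LHS]Lp_normE [RHS]Lp_normE; exact: Lnorm_dil.
Qed.

Lemma norm_translation b x : `|translation b x| = `|x|.
Proof.
rewrite -(Lp_funK x) translation_toLp; apply: EFin_inj.
by rewrite [LHS]Lp_normE [RHS]Lp_normE; exact: Lnorm_tr.
Qed.

Let isometry_continuous (A : {linear Lp leb p1 -> Lp leb p1}) :
  (forall x, `|A x| = `|x|) -> continuous A.
Proof.
move=> Ai; apply: bounded_linear_continuous; apply/linear_boundedP.
by exists 1; split => // r r1 x; rewrite Ai ler_peMl// ltW.
Qed.

Lemma dilation_continuous a : continuous (dilation a).
Proof. exact: isometry_continuous (norm_dilation a). Qed.

Lemma translation_continuous b : continuous (translation b).
Proof. exact: isometry_continuous (norm_translation b). Qed.

End dilation_translation.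

Section wavelets.
Context (R : realType) (p : R) (p1 : (1 <= p%:E)%E).
Local Notation leb := (@lebesgue_measure R).
Local Notation X := (Lp leb p1).

Definition wavelet_vector (psi : X) (ab : R * R) : X :=
  dilation ab.1 (translation ab.2 psi).

(* D^*_{-a} T^*_{-b} psi^*, an element of the dual of L_p (which is L_p') *)
Definition wavelet_functional (psis : dual X) (ab : R * R) : dual X :=
  adjoint (@dilation_continuous R p p1 (- ab.1))
    (adjoint (@translation_continuous R p p1 (- ab.2)) psis).

Definition ZxZ_to_R2 (nk : ZxZ) : R * R := (nk.1%:~R, nk.2%:~R).

Definition discrete_vector (psi : X) (nk : ZxZ) : X :=
  wavelet_vector psi (ZxZ_to_R2 nk).

Definition discrete_functional (psis : dual X) (nk : ZxZ) : dual X :=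
  wavelet_functional psis (ZxZ_to_R2 nk).

Definition wavelet (psi : X) : Prop :=
  `|psi| = 1 /\ unconditional_schauder_basis (discrete_vector psi).

(* D^*_{-n} T^*_{-k} psi^* is the biorthogonal functional of D_n T_k psi, for
   all n and k; n = k = 0 says that psi^* is the one of psi.  As the
   D_n T_k psi have dense span when they form a basis, this determines psi^*.
   Requiring it for n = k = 0 only would be weaker: the system biorthogonal to
   an affine Riesz basis need not be affine. *)
Definition biorthogonal_generator (psi : X) (psis : dual X) : Prop :=
  biorthogonal (discrete_vector psi) (discrete_functional psis).

Definition wavelet_unconditionality_constant
    (psi : X) (psis : dual X) (C : R) : Prop :=
  is_unconditionality_constant (counting_ZxZ R)
    (discrete_vector psi) (discrete_functional psis) C.

Definition continuous_wavelet (psi : X) (psis : dual X) : Prop :=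
  continuous_schauder_frame (@lebesgue_measure2 R)
    (wavelet_vector psi) (wavelet_functional psis).

Definition continuous_wavelet_unconditionality_constant
    (psi : X) (psis : dual X) (C : R) : Prop :=
  is_unconditionality_constant (@lebesgue_measure2 R)
    (wavelet_vector psi) (wavelet_functional psis) C.

End wavelets.
Lemma EFin_ge1 (R : realType) (p : R) : 1 < p -> (1 <= p%:E)%E.
Proof. by rewrite lee_fin => /ltW. Qed.

(* Main.v *)
(* Write F(a, b) = f_(a,b)(y) g(x_(a,b)).  Composing with the isometry D_s T_c
   turns the sums of F and |F| over the lattice {(n + s, k + 2^n c)} into sums
   over Z x Z for other vectors of the same norm, so that the discrete
   hypotheses give sum F = g(y) and sum |F| <= C |y| |g| for every s and c.
   Put c = 2^N u and average over s in [0, 1[ and u in an interval of length 1.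
   For n >= -N the number 2^(n+N) is a positive integer, and the average of the
   sum over these n is exactly the integral over {a >= -N}; letting N tend to
   infinity yields the bound on the integral of |F|.  The scales n < -N
   contribute O(2^-N) when y and g are indicators of intervals, whence the
   integral of F is g(y) in that case, and in general by density.  Pettis
   integrals exist because L_p is the dual of L_q. *)
From HB Require Import structures.
Require Import Defs.
From mathcomp Require Import all_boot all_order all_algebra.
From mathcomp Require Import all_classical all_reals all_analysis.
From mathcomp Require Import measurable_realfun ring lra zify.

Set Implicit Arguments.
Unset Strict Implicit.
Unset Printing Implicit Defensive.

Import Order.TTheory GRing.Theory Num.Def Num.Theory.
Import numFieldNormedType.Exports.
Local Open Scope classical_set_scope.
Local Open Scope ring_scope.

(** * The spaces L_p *)

(** The obstacle is the scales n < -N: there 2^(n+N) is a proper fraction of the period, so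
    averaging over u no longer tiles the b-axis. For |F| this costs nothing, since a nonnegative
    remainder may be dropped. For F itself the remainder must vanish in the limit, and no rate is at
    hand for general y and g. It is small when y and g live in [-L, L], because then F(a, b) sees
    psi and psi^* only within 2^a L of -b, a set that shrinks as a tends to -oo. Dense combinations
    suffice because the bound by C |y| |g| makes the integral of F a bounded bilinear form. Signed
    sums are never averaged directly: |F| + F is compared with |F|, so that Tonelli and monotone
    convergence apply, and finite integrals are subtracted only at the end. Riesz representation
    enters three times: it turns psi^* into a function of L_q, on which the adjoints act again as
    D_a T_b and so have norm-continuous orbits; it reduces g to functions for the density argument;
    and it produces the Pettis integrals. *)

Section Lp_basics.
Context d (T : measurableType d) (R : realType).
Variables (mu : {measure set T -> \bar R}) (p : R) (p1 : (1 <= p%:E)%E).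
Local Notation Lf := (LfunType mu p1).
Local Notation X := (Lp mu p1).

Lemma Lexp_gt0 : 0 < p.
Proof. by rewrite -lte_fin (lt_le_trans _ p1)// lte_fin. Qed.

Lemma Lexp_ge1 : 1 <= p.
Proof. by rewrite -lee_fin. Qed.

Lemma ler_powR_base (x y : R) : 0 <= x -> x <= y -> x `^ p <= y `^ p.
Proof.
move=> x0 xy; rewrite ge0_ler_powR// ?nnegrE ?(le_trans x0 xy)//.
by rewrite ltW// Lexp_gt0.
Qed.

Lemma powR_lt_base (x e : R) : 0 <= x -> 0 <= e -> x `^ p < e `^ p -> x < e.
Proof.
move=> x0 e0; rewrite ltNge => /negP H; rewrite ltNge; apply/negP => ex.
by apply: H; exact: ler_powR_base.
Qed.

Lemma measurable_powR_norm (f : T -> R) : measurable_fun setT f ->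
  measurable_fun setT (fun t => `|f t| `^ p).
Proof.
move=> mf; apply: (measurableT_comp (measurable_powR _)).
exact: measurableT_comp.
Qed.

Lemma integrable_powR_Lfun (f : T -> R) : measurable_fun setT f ->
  mu.-integrable setT (fun t => (`|f t| `^ p)%:E) -> f \in Lfun mu p%:E.
Proof.
move=> mf /integrableP[_ intf]; apply/andP; split; rewrite inE//=.
rewrite /finite_norm unlock /= poweR_lty//.
apply: le_lt_trans intf; apply: ge0_le_integral => //=.
- exact/measurable_EFinP/measurable_powR_norm.
- apply/measurable_EFinP; apply: measurableT_comp => //.
  exact: measurable_powR_norm.
- by move=> t _; rewrite lee_fin ler_norm.
Qed.

Lemma Lfun_dominated (f h : T -> R) : measurable_fun setT f ->
  h \in Lfun mu p%:E -> (forall t, `|f t| <= `|h t|) -> f \in Lfun mu p%:E.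
Proof.
move=> mf hL fh; apply: integrable_powR_Lfun => //.
have := Lfun_integrable Lexp_ge1 hL; apply: le_integrable => //.
  exact/measurable_EFinP/measurable_powR_norm.
by move=> t _; rewrite !lee_fin !(ger0_norm (powR_ge0 _ _)) ler_powR_base.
Qed.

Lemma Lp_norm_powR (f : Lf) :
  (`|toLp f| `^ p)%:E = (\int[mu]_t (`|f t| `^ p)%:E)%E.
Proof.
by rewrite -poweR_EFin [X in (X `^ _)%E]Lp_normE poweR_Lnorm// gt_eqF// Lexp_gt0.
Qed.

Lemma Lp_fun_norm_powR (x : X) :
  (`|x| `^ p)%:E = (\int[mu]_t (`|Lp_fun x t| `^ p)%:E)%E.
Proof. by rewrite -Lp_norm_powR Lp_funK. Qed.

(** Dominated convergence for |f_n - f|^p. The majorant is (h + |f|)^p rather than (2h)^p because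
    |f| <= h is known only almost everywhere. *)
Lemma toLp_dominated_cvg (f_ : nat -> Lf) (f h : Lf) :
  {ae mu, forall t, f_ n t @[n --> \oo] --> f t} ->
  (forall n t, `|f_ n t| <= h t) ->
  toLp (f_ n) @[n --> \oo] --> toLp f.
Proof.
move=> ff fh; pose k t := (h t + `|f t|) `^ p.
have h0 t : 0 <= h t by exact: le_trans (fh 0%N t).
have kL : (fun t => h t + `|f t|) \in Lfun mu p%:E.
  apply: (@Lfun_dominated _ (fun t => `|h t| + `|f t|)).
  - by apply: measurable_funD => //; exact: measurableT_comp.
  - rewrite [X in X \in _](_ : _ = (normr \o h) + (normr \o f))//.
    rewrite rpredD//=; (apply: (@Lfun_dominated _ _ _ (LfunP _));
        first exact: measurableT_comp) => t /=; rewrite normr_id//.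
  - by move=> t; rewrite (ger0_norm (h0 t)).
have [] := @dominated_convergence _ _ _ mu setT measurableT
  (fun n t => (`|f_ n t - f t| `^ p)%:E) (cst 0%E) (fun t => (k t)%:E).
- move=> n; apply/measurable_EFinP/measurable_powR_norm.
  exact: measurable_funB.
- exact: measurable_cst.
- apply: filterS ff => t ft _; apply: cvg_EFin; first exact: nearW.
  have fft : `|f_ n t - f t| @[n --> \oo] --> (0:R).
    apply/norm_cvg0P; rewrite -(subrr (f t)); apply: cvgB => //; exact: cvg_cst.
  apply/cvgrPdist_lt => e e0.
  move/cvgrPdist_lt : fft => /(_ (e `^ p^-1)); rewrite powR_gt0// => /(_ isT).
  apply: filterS => n /=; rewrite !sub0r !normrN normr_id (ger0_norm (powR_ge0 _ _)) => H.
  have := gt0_ltr_powR Lexp_gt0 _ _ H; rewrite !nnegrE powR_ge0 normr_ge0 => /(_ isT isT).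
  by rewrite -powRrM mulVf ?gt_eqF ?Lexp_gt0// powRr1// ltW.
- have := Lfun_integrable Lexp_ge1 kL.
  apply: eq_integrable => // t _; rewrite ger0_norm//.
  by rewrite addr_ge0.
- apply: nearW => t n _; rewrite lee_fin (ger0_norm (powR_ge0 _ _)).
  by rewrite ler_powR_base// (le_trans (ler_normB _ _))// lerD2r.
move=> _ _; rewrite integral0 => /fine_cvgP[_ /=] cv.
apply/cvgrPdist_lt => e e0.
move/cvgrPdist_lt : cv => /(_ (e `^ p)); rewrite powR_gt0// => /(_ isT).
apply: filterS => n /=.
rewrite -[X in fine X](Lp_norm_powR (f_ n - f)) /= sub0r normrN.
rewrite (ger0_norm (powR_ge0 _ _)) raddfB distrC /=.
by apply: powR_lt_base => //; exact: ltW.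
Qed.


(* The class of f, with the junk value 0 when f is not in L_p. *)
Definition mkLp (f : T -> R) : X :=
  if pselect (f \in Lfun mu p%:E) is left h then toLp (Lfun_Sub p1 h) else 0.

Lemma mkLpE (f : T -> R) (h : f \in Lfun mu p%:E) :
  mkLp f = toLp (Lfun_Sub p1 h).
Proof. by rewrite /mkLp; case: pselect => // h'; apply/toLpP; exact: ae_eq_refl. Qed.

Lemma mkLp_Lfun (f : Lf) : mkLp f = toLp f.
Proof. by rewrite (mkLpE (LfunP f)); congr toLp; apply/LfuneqP. Qed.

Lemma mkLpK (x : X) : mkLp (Lp_fun x) = x.
Proof. by rewrite mkLp_Lfun Lp_funK. Qed.

Lemma Lp_fun_mkLp (f : T -> R) : f \in Lfun mu p%:E ->
  Lp_fun (mkLp f) = f %[ae mu].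
Proof. by move=> h; rewrite mkLpE; exact: toLpK. Qed.

Lemma mkLp_ae (f g : T -> R) : f \in Lfun mu p%:E -> g \in Lfun mu p%:E ->
  f = g %[ae mu] -> mkLp f = mkLp g.
Proof. by move=> hf hg fg; rewrite !mkLpE; apply/toLpP. Qed.

Lemma LfunZD (a : R) (f g : T -> R) :
  f \in Lfun mu p%:E -> g \in Lfun mu p%:E ->
  (fun t => a * f t + g t) \in Lfun mu p%:E.
Proof.
move=> hf hg; have := LfunP (a *: Lfun_Sub p1 hf + Lfun_Sub p1 hg).
exact.
Qed.

Lemma mkLpZD (a : R) (f g : T -> R) :
  f \in Lfun mu p%:E -> g \in Lfun mu p%:E ->
  mkLp (fun t => a * f t + g t) = a *: mkLp f + mkLp g.
Proof.
move=> hf hg; rewrite !mkLpE; first exact: LfunZD.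
by move=> h; rewrite -linearP; congr toLp; apply/LfuneqP.
Qed.

Lemma mkLp0 : mkLp (fun=> 0) = 0.
Proof. by have := mkLp_Lfun 0; rewrite raddf0. Qed.

Lemma norm_mkLp_powR (f : T -> R) : f \in Lfun mu p%:E ->
  (`|mkLp f| `^ p)%:E = (\int[mu]_t (`|f t| `^ p)%:E)%E.
Proof. by move=> h; rewrite mkLpE Lp_norm_powR. Qed.

Lemma mkLp_dominated_cvg (f_ : nat -> T -> R) (f h : T -> R) :
  (forall n, measurable_fun setT (f_ n)) -> f \in Lfun mu p%:E ->
  h \in Lfun mu p%:E ->
  {ae mu, forall t, f_ n t @[n --> \oo] --> f t} ->
  (forall n t, `|f_ n t| <= h t) ->
  mkLp (f_ n) @[n --> \oo] --> mkLp f.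
Proof.
move=> mf_ fL hL ff fh.
have fL_ n : f_ n \in Lfun mu p%:E.
  by apply: Lfun_dominated hL _ => // t; rewrite (le_trans (fh _ _))// ler_norm.
rewrite (_ : (fun n => mkLp (f_ n)) = fun n => toLp (Lfun_Sub p1 (fL_ n))).
  rewrite mkLpE; exact: (@toLp_dominated_cvg _ _ (Lfun_Sub p1 hL)).
by apply/funext => n; rewrite mkLpE.
Qed.

Lemma indic_Lfun (A : set T) : measurable A -> (mu A < +oo)%E ->
  \1_A \in Lfun mu p%:E.
Proof.
move=> mA muA; apply: integrable_powR_Lfun; first exact: measurable_indic.
have iA : mu.-integrable setT (EFin \o \1_A).
  apply/integrableP; split; first exact/measurable_EFinP/measurable_indic.
  under eq_integral => t _ do rewrite /= ger0_norm//.
  by rewrite integral_indic// setIT.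
move: iA; apply: eq_integrable => // t _; rewrite /= indicE; case: (_ \in _);
    rewrite ?normr1 ?powR1// normr0 powR0//.
by rewrite gt_eqF// Lexp_gt0.
Qed.

End Lp_basics.

Arguments mkLp {d T R mu p} p1 f.

(** * Density of interval indicators in L_p *)

Section Lp_density.
Context (R : realType) (p : R) (p1 : (1 <= p%:E)%E).
Local Notation leb := (@lebesgue_measure R).
Local Notation X := (Lp leb p1).
Local Notation RB := (measurableTypeR R).
Local Notation mk := (mkLp (mu := leb) p1).

Lemma itv_indic_Lfun (a b : R) : \1_`]a, b] \in Lfun leb p%:E.
Proof.
apply: (indic_Lfun p1) => //.
rewrite [ltLHS](lebesgue_measure_itv `]a, b]) /=.
by case: ifPn => // _; rewrite -EFinB ltry.
Qed.

Variable V : set X.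
Hypotheses (cV : closed V)
  (linV : forall (a : R) x y, V x -> V y -> V (a *: x + y))
  (itvV : forall a b : R, V (mk (\1_`]a, b] : RB -> R))).

Let V0 : V 0.
Proof.
by have := @linV (-1) _ _ (@itvV 0 0) (@itvV 0 0); rewrite scaleN1r addNr.
Qed.

Let J (n : nat) : set RB := `]- n%:R, n%:R]%classic.

Let mJ n : measurable (J n).
Proof. exact: measurable_itv. Qed.

Let AJ_Lfun (A : set RB) n : measurable A -> (\1_(A `&` J n) : RB -> R) \in Lfun leb p%:E.
Proof.
move=> mA; apply: (@Lfun_dominated _ _ _ _ _ p1 _ _ _ (itv_indic_Lfun (- n%:R) n%:R)).
  by apply: measurable_indic; exact: measurableI (mJ _).
move=> t; rewrite !indicE in_setI !ger0_norm//.
by case: (_ \in A).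
Qed.

(** Dynkin's pi-lambda theorem, with the half-open intervals as pi-system. Intersecting with [J n]
    keeps every indicator in L_p, so that complements are taken inside a set of finite measure. *)
Let AJ_V (A : set RB) n : measurable A -> V (mk (\1_(A `&` J n) : RB -> R)).
Proof.
move=> mA.
apply: (@dynkin_induction _ RB (@ocitv R)
  (fun A : set RB => V (mk (\1_(A `&` J n) : RB -> R)))) => //.
- exact: ocitvI.
- by rewrite setTI; exact: itvV.
- move=> _ [[a b] _ <-] /=.
  have [[c e] _ <-] := @ocitvI R _ _ (is_ocitv a b) (is_ocitv (- n%:R) n%:R).
  exact: itvV.
- move=> S mS VS.
  rewrite (_ : \1_(~` S `&` J n) = fun t => -1 * \1_(S `&` J n) t + \1_(J n) t).
    rewrite mkLpZD; [|exact: AJ_Lfun|exact: itv_indic_Lfun].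
    by apply: linV => //; exact: itvV.
  apply/funext => t; rewrite !indicE !in_setI in_setC.
  by case: (t \in S); case: (t \in J n) => /=; lra.
- move=> F mF tF VF.
  (* A countable union is the limit of the finite ones, with the indicator of [J n] as majorant. *)
  apply: (@closed_cvg _ _ \oo _ (fun k => mk \1_((\big[setU/set0]_(i < k) F i)
      `&` J n)) V) => //.
    near=> k; elim: (k) => [|m ih].
      rewrite big_ord0 set0I indic0.
      by rewrite [X in V X](mkLp0 leb p1).
    rewrite big_ord_recr/= (_ : \1_(_ `&` _) =
      (fun t => 1 * \1_(\big[setU/set0]_(i < m) F i `&` J n) t + \1_(F m `&` J n) t)).
      rewrite mkLpZD; [exact: linV|by apply: AJ_Lfun;
          exact: bigsetU_measurable|exact: AJ_Lfun].
    apply/funext => t; rewrite mul1r !indicE !in_setI in_setU.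
    have [tJ|] := boolP (t \in J n); last by rewrite !andbF addr0.
    rewrite !andbT; have [tU|] := boolP (t \in \big[setU/set0]_(i < m) F i) => /=;
        last by rewrite add0r.
    rewrite (_ : (t \in F m) = false) ?addr0//; apply/negbTE/negP => /set_mem Fmt.
    move: tU => /set_mem; rewrite -bigcup_mkord => -[i /= im Fit].
    by have := tF i m I I; move=> /(_ (ex_intro _ t (conj Fit Fmt))) eim; move: im;
        rewrite eim ltnn.
  apply: (@mkLp_dominated_cvg _ _ _ _ _ p1 _ _ (\1_(J n))).
  + by move=> k; apply: measurable_indic; apply: measurableI (mJ _);
      exact: bigsetU_measurable.
  + by apply: AJ_Lfun; exact: bigcupT_measurable.
  + exact: itv_indic_Lfun.
  + apply: aeW => t; apply: cvg_near_cst.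
    have [[i _ Fit]|nF] := pselect ((\bigcup_k F k) t).
      near=> k; rewrite !indicE !in_setI; congr ((_ && _)%:R).
      rewrite !mem_set//; first by exists i.
      rewrite -bigcup_mkord; exists i => //=; near: k.
      exact: nbhs_infty_gt.
    near=> k; rewrite !indicE !in_setI; congr ((_ && _)%:R).
    rewrite !memNset// => H; apply: nF; move: H; rewrite -bigcup_mkord => -[i _ Fi].
    by exists i.
  + move=> k t; rewrite !indicE in_setI ger0_norm//.
    by case: (_ \in _).
Unshelve. all: by end_near. Qed.

Let sum_V n (s : seq R) (A : R -> set RB) : (forall c, measurable (A c)) ->
  (fun t => \sum_(c <- s) c * \1_(A c `&` J n) t) \in Lfun leb p%:E /\
  V (mk (fun t => \sum_(c <- s) c * \1_(A c `&` J n) t)).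
Proof.
move=> mA; elim: s => [|c s [ihL ihV]].
  under eq_fun do rewrite big_nil.
  split; first by have := LfunP (0 : LfunType leb p1).
  rewrite (_ : mk _ = 0)//.
  exact: mkLp0.
under eq_fun do rewrite big_cons.
split; first by apply: (LfunZD p1 _ _ ihL); exact: AJ_Lfun.
by rewrite mkLpZD//; [apply: linV => //; exact: AJ_V|exact: AJ_Lfun].
Qed.

Import HBNNSimple.

Let nnsfun_V n (f : {nnsfun RB >-> R}) :
  V (mk (fun t => f t * \1_(J n) t)).
Proof.
rewrite (_ : (fun t => _) = fun t => \sum_(c <- finmap.enum_fset (fset_set (range f)))
    c * (\1_((f @^-1` [set c]) `&` J n) : RB -> R) t).
  by apply: (@sum_V n _ (fun c => f @^-1` [set c]) _).2 => c; exact: measurable_sfunP.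
apply/funext => t; rewrite [in LHS]fimfunE fsbig_finite//= big_distrl/=.
by apply: eq_bigr => c _; rewrite indicI mulrA.
Qed.

Let ge0_V (f : RB -> R) : f \in Lfun leb p%:E -> (forall t, 0 <= f t) ->
  V (mk f).
Proof.
move=> fL f0.
have mf : measurable_fun [set: RB] (EFin \o f).
  by apply/measurable_EFinP; move: fL => /andP[/[!inE]].
have ef0 t : setT t -> (0 <= (EFin \o f) t)%E by move=> _; rewrite lee_fin.
pose g n := nnsfun_approx measurableT mf n.
have gf n t : g n t <= f t.
  rewrite -lee_fin /g nnsfun_approxE; exact: (le_approx n ef0).
(* The simple approximants are cut off to [J n], since [nnsfun_V] covers bounded sets only; f itself
   is the majorant. *)
apply: (@closed_cvg _ _ \oo _ (fun n => mk (fun t => g n t * \1_(J n) t)) V) => //.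
  by apply: nearW => n; exact: nnsfun_V.
apply: (@mkLp_dominated_cvg _ _ _ _ _ p1 _ _ f) => //.
- move=> n; apply: measurable_funM => //; exact: measurable_indic (mJ _).
- apply: aeW => t; rewrite -[f t]mulr1; apply: cvgM.
    have /fine_cvgP[_] := cvg_nnsfun_approx measurableT mf ef0 (x := t) I.
    exact.
  apply: cvg_near_cst; near=> n; rewrite indicE mem_set//=.
  have : `|t| < n%:R by near: n; exact: nbhs_infty_gtr.
  by rewrite ltr_norml => /andP[h1 /ltW h2]; rewrite /J /= in_itv/= h1.
- move=> n t; rewrite ger0_norm ?mulr_ge0// indicE.
  by case: (_ \in _); rewrite ?mulr1 ?mulr0.
Unshelve. all: by end_near. Qed.

(** Density in the form of an induction principle: later arguments take for V the set where the
    desired property holds. *)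
Lemma Lp_itv_dense (x : X) : V x.
Proof.
have mx : measurable_fun setT (Lp_fun x) by [].
have posL (f : LfunType leb p1) : f^\+ \in Lfun leb p%:E.
  apply: (Lfun_dominated p1 _ (LfunP f)); first exact: measurable_funrpos.
  move=> t; rewrite /funrpos ger0_norm ?le_max ?lexx ?orbT//.
  by rewrite ge_max ler_norm normr_ge0.
have negL (f : LfunType leb p1) : f^\- \in Lfun leb p%:E.
  apply: (Lfun_dominated p1 _ (LfunP f)); first exact: measurable_funrneg.
  move=> t; rewrite /funrneg ger0_norm ?le_max ?lexx ?orbT//.
  by rewrite ge_max normr_ge0 -normrN ler_norm.
rewrite -(mkLpK x) (_ : Lp_fun x = (fun t => -1 * (Lp_fun x)^\- t + (Lp_fun x)^\+ t) :>
    (RB -> R)).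
  by rewrite mkLpZD//; apply: linV; apply: ge0_V => // t; rewrite ?funrpos_ge0 ?funrneg_ge0.
apply/funext => t.
by rewrite mulN1r addrC -[in LHS](funrposBneg (Lp_fun x)).
Qed.

End Lp_density.

(** * Duality between L_p and L_q *)

Section Rintegral_extra.
Context d (T : measurableType d) (R : realType) (mu : {measure set T -> \bar R}).

Lemma Rintegral_dominated_cvg (f_ : nat -> T -> R) (f h : T -> R) :
  (forall n, measurable_fun setT (f_ n)) -> measurable_fun setT f ->
  (forall t, f_ n t @[n --> \oo] --> f t) ->
  mu.-integrable setT (EFin \o h) -> (forall n t, `|f_ n t| <= h t) ->
  \int[mu]_t f_ n t @[n --> \oo] --> \int[mu]_t f t.
Proof.
move=> mf_ mf ff ih fh.
have [] := @dominated_convergence _ _ _ mu setT measurableT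
  (fun n t => (f_ n t)%:E) (fun t => (f t)%:E) (EFin \o h).
- by move=> n; exact/measurable_EFinP.
- exact/measurable_EFinP.
- by apply: aeW => t _; apply: cvg_EFin; [exact: nearW|exact: ff].
- exact: ih.
- by apply: aeW => t n _; rewrite lee_fin.
move=> intf _ cv.
have /fineK e : (\int[mu]_t (f t)%:E \is a fin_num)%E.
  exact: integrable_fin_num.
by move: cv; rewrite /= -e => /fine_cvgP[_].
Qed.

Lemma Rintegral_linear (a : R) (f g : T -> R) :
  mu.-integrable setT (EFin \o f) -> mu.-integrable setT (EFin \o g) ->
  \int[mu]_t (a * f t + g t) = a * \int[mu]_t f t + \int[mu]_t g t.
Proof.
move=> intf intg; rewrite RintegralD ?RintegralZl//.
by have := integrableZl measurableT a intf.
Qed.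

Lemma ae_eq_Rintegral (f g : T -> R) : measurable_fun setT f ->
  measurable_fun setT g -> f = g %[ae mu] ->
  \int[mu]_t f t = \int[mu]_t g t.
Proof.
move=> mf mg fg; rewrite /Rintegral; congr fine.
apply: ae_eq_integral => //; [exact/measurable_EFinP|exact/measurable_EFinP|].
by apply: filterS fg => t /= /[apply] ->.
Qed.

Lemma EFin_Rintegral (f : T -> R) : mu.-integrable setT (EFin \o f) ->
  (\int[mu]_t f t)%:E = (\int[mu]_t (f t)%:E)%E.
Proof. by move=> h; rewrite /Rintegral fineK//; exact: integrable_fin_num. Qed.

End Rintegral_extra.

(** * The integral pairing of L_q with L_p *)

Section pairing.
Context d (T : measurableType d) (R : realType) (mu : {measure set T -> \bar R}).
Variables (p q : R) (p1 : (1 <= p%:E)%E) (q1 : (1 <= q%:E)%E).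
Hypothesis pq : p^-1 + q^-1 = 1.
Local Notation X := (Lp mu p1).
Local Notation Y := (Lp mu q1).
Local Notation mkp := (mkLp (mu := mu) p1).
Local Notation mkq := (mkLp (mu := mu) q1).

Lemma Lfun_measurable r (f : T -> R) : f \in Lfun mu r -> measurable_fun setT f.
Proof. by move=> /andP[/[!inE]]. Qed.

Lemma hoelder_abse (f g : T -> R) : f \in Lfun mu p%:E -> g \in Lfun mu q%:E ->
  (\int[mu]_t `|(g t * f t)%:E| <= (`|mkq g| * `|mkp f|)%:E)%E.
Proof.
move=> fL gL.
have := hoelder mu (Lfun_measurable gL) (Lfun_measurable fL)
  (Lexp_gt0 q1) (Lexp_gt0 p1); rewrite addrC => /(_ pq).
rewrite Lnorm1 => /le_trans; apply.
by rewrite !mkLpE EFinM [X in (_ <= X * _)%E]Lp_normE [X in (_ <= _ * X)%E]Lp_normE.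
Qed.

Lemma pairing_integrable (f g : T -> R) :
  f \in Lfun mu p%:E -> g \in Lfun mu q%:E ->
  mu.-integrable setT (EFin \o (fun t => g t * f t)).
Proof.
move=> fL gL; apply/integrableP; split.
  by apply/measurable_EFinP/measurable_funM;
      [exact: Lfun_measurable gL|exact: Lfun_measurable fL].
by rewrite (le_lt_trans (hoelder_abse fL gL))// ltry.
Qed.

Definition pairing (G : Y) (x : X) : R^o := \int[mu]_t (Lp_fun G t * Lp_fun x t).

Lemma pairing_mkLp (f g : T -> R) : f \in Lfun mu p%:E -> g \in Lfun mu q%:E ->
  pairing (mkq g) (mkp f) = \int[mu]_t (g t * f t).
Proof.
move=> fL gL; apply: ae_eq_Rintegral.
- exact: measurable_funM.
- by apply: measurable_funM; [exact: Lfun_measurable gL|exact: Lfun_measurable fL].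
- apply: filterS2 (Lp_fun_mkLp p1 fL) (Lp_fun_mkLp q1 gL) => t /= ft gt _.
  by rewrite ft// gt.
Qed.

Lemma pairing_linearr (G : Y) : linear (pairing G).
Proof.
move=> a x y; rewrite -(mkLpK x) -(mkLpK y) -(mkLpK G) -mkLpZD ?LfunP//.
rewrite !pairing_mkLp ?LfunP//; last exact: LfunZD (LfunP _) (LfunP _).
rewrite -Rintegral_linear; try exact: pairing_integrable (LfunP _) (LfunP _).
by apply: eq_Rintegral => t _; rewrite mulrDr mulrCA.
Qed.

Lemma pairing_linearl (x : X) : linear (pairing^~ x : Y -> R^o).
Proof.
move=> a G H; rewrite -(mkLpK x) -(mkLpK G) -(mkLpK H) -mkLpZD ?LfunP//.
rewrite !pairing_mkLp ?LfunP//; last exact: LfunZD (LfunP _) (LfunP _).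
rewrite -Rintegral_linear; try exact: pairing_integrable (LfunP _) (LfunP _).
by apply: eq_Rintegral => t _; rewrite mulrDl mulrA.
Qed.

Lemma pairing_le (G : Y) (x : X) : `|pairing G x| <= `|G| * `|x|.
Proof.
rewrite -(mkLpK x) -(mkLpK G) pairing_mkLp ?LfunP//.
have i := pairing_integrable (LfunP (Lp_fun x)) (LfunP (Lp_fun G)).
rewrite (le_trans (le_normr_Rintegral _ i))// -lee_fin EFin_Rintegral.
  exact: hoelder_abse (LfunP _) (LfunP _).
exact: integrable_norm.
Qed.

HB.instance Definition _ G :=
  GRing.isLinear.Build R X R^o *:%R (pairing G) (pairing_linearr G).

Lemma pairing_continuous (G : Y) : continuous (pairing G).
Proof.
apply: bounded_linear_continuous; apply/linear_boundedP.
exists `|G|; split; first exact: normr_real.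
by move=> r Gr x; rewrite (le_trans (pairing_le G x))// ler_wpM2r// ltW.
Qed.

Lemma pairing_dual_subproof (G : Y) : pairing G \in @bounded_functional R X.
Proof.
apply/asboolP; split; first exact: pairing_linearr.
exact: pairing_continuous.
Qed.

Definition pairing_dual (G : Y) : dual X := Dual (pairing_dual_subproof G).

Lemma pairing_dualE G x : pairing_dual G x = pairing G x.
Proof. by []. Qed.

Lemma pairing_dual_linear : linear pairing_dual.
Proof. by move=> a G H; apply/dualE => x; exact: pairing_linearl. Qed.

HB.instance Definition _ :=
  GRing.isLinear.Build R Y (dual X) *:%R pairing_dual pairing_dual_linear.

Lemma pairing_dual_norm (G : Y) : `|pairing_dual G| <= `|G|.
Proof.
apply: dual_norm_lub => x x1; rewrite (le_trans (pairing_le G x))//.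
by rewrite ler_piMr.
Qed.

End pairing.

Section indicators.
Context d (T : measurableType d) (R : realType).

Lemma cvg_indic_bigsetU (F : (set T)^nat) (t : T) :
  (\1_(\big[setU/set0]_(i < n) F i) t : R) @[n --> \oo] --> (\1_(\bigcup_i F i) t : R).
Proof.
apply: cvg_near_cst.
have [[i _ Fit]|nF] := pselect ((\bigcup_k F k) t).
  near=> k; rewrite !indicE; congr (_%:R).
  rewrite !mem_set//; first by exists i.
  by rewrite -bigcup_mkord; exists i => //=; near: k; exact: nbhs_infty_gt.
near=> k; rewrite !indicE; congr (_%:R).
rewrite !memNset// => H; apply: nF; move: H; rewrite -bigcup_mkord => -[i _ Fi].
by exists i.
Unshelve. all: by end_near. Qed.

End indicators.

(** * Induction on bounded measurable functions *)

Section bounded_induction.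
Context d (T : measurableType d) (R : realType).
Variable P : (T -> R) -> Prop.
Hypothesis P_indic : forall A, measurable A -> P (\1_A).
Hypothesis P_linear : forall (a : R) (f g : T -> R), measurable_fun setT f ->
  measurable_fun setT g -> bounded_fun f -> bounded_fun g ->
  P f -> P g -> P (fun t => a * f t + g t).
Hypothesis P_cvg : forall (f_ : nat -> T -> R) (f : T -> R) (K : R),
  (forall n, measurable_fun setT (f_ n)) -> measurable_fun setT f ->
  (forall n, P (f_ n)) -> (forall n t, `|f_ n t| <= K) -> (forall t, `|f t| <= K) ->
  (forall t, f_ n t @[n --> \oo] --> f t) -> P f.

Import HBNNSimple.

Let P0 : P (fun=> 0).
Proof. by have := P_indic measurable0; rewrite indic0. Qed.

Let bounded_indic (A : set T) : bounded_fun (\1_A : T -> R).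
Proof.
exists 1; split => // r r1 t _ /=; rewrite indicE.
by case: (_ \in _); rewrite ?normr1 ?normr0 ltW// (lt_trans ltr01).
Qed.

Let P_nnsfun (f : {nnsfun T >-> R}) : P f.
Proof.
have -> : (f : T -> R) =
    fun t => \sum_(c <- finmap.enum_fset (fset_set (range f))) c * \1_(f @^-1` [set c]) t.
  by apply/funext => t; rewrite [in LHS]fimfunE fsbig_finite.
suff : forall s : seq R,
  [/\ measurable_fun setT (fun t => \sum_(c <- s) c * \1_(f @^-1` [set c]) t),
      bounded_fun (fun t => \sum_(c <- s) c * \1_(f @^-1` [set c]) t) &
      P (fun t => \sum_(c <- s) c * \1_(f @^-1` [set c])
          t)] by case/(_ (finmap.enum_fset (fset_set (range f)))).
have mi c : measurable_fun setT (\1_(f @^-1` [set c]) : T -> R).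
  by apply: measurable_indic; exact: measurable_sfunP.
elim => [|c s [ihm ihb ihP]].
  under eq_fun do rewrite big_nil.
  split => //; exists 0; split => // r r0 t _; rewrite normr0; exact: ltW.
under eq_fun do rewrite big_cons.
split.
- by apply: measurable_funD => //; exact: measurable_funM.
- have [M [_ HM]] := ihb; exists (`|c| + `|M| + 1); split; first exact: num_real.
  move=> r Mr t _ /=; rewrite (le_trans (ler_normD _ _))//.
  have h1 : `|c * \1_(f @^-1` [set c]) t| <= `|c|.
    by rewrite normrM ler_piMr// indicE; case: (_ \in _); rewrite ?normr1 ?normr0.
  have h2 := HM (`|M| + 1) _ t I.
  rewrite (le_trans (lerD h1 (h2 _)))//;
      first by rewrite (le_lt_trans (ler_norm M))// ltrDl.
  by rewrite addrA ltW.
- by apply: P_linear => //; apply: P_indic; exact: measurable_sfunP.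
Qed.

Let P_ge0 (f : T -> R) : measurable_fun setT f -> (forall t, 0 <= f t) ->
  bounded_fun f -> P f.
Proof.
move=> mf' f0 [M [_ HM]].
have mf : measurable_fun setT (EFin \o f) by exact/measurable_EFinP.
have ef0 t : setT t -> (0 <= (EFin \o f) t)%E by move=> _; rewrite lee_fin.
pose g n := nnsfun_approx measurableT mf n.
have gf n t : g n t <= f t.
  rewrite -lee_fin /g nnsfun_approxE; exact: (le_approx n ef0).
apply: (@P_cvg g f (`|M| + 1)) => //.
- move=> n t; rewrite ger0_norm// (le_trans (gf _ _))// (le_trans (ler_norm _))//.
  by apply: HM => //; rewrite (le_lt_trans (ler_norm M))// ltrDl.
- by move=> t; apply: HM => //; rewrite (le_lt_trans (ler_norm M))// ltrDl.
- by move=> t; have /fine_cvgP[_] := cvg_nnsfun_approx measurableT mf ef0 (x := t) I.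
Qed.

(** A functional monotone class argument: a bounded nonnegative function is an increasing limit of
    simple functions under one common bound. P has to be stable under uniformly bounded limits only,
    which is what dominated convergence provides in [g_bounded]. *)
Lemma bounded_fun_induction (f : T -> R) : measurable_fun setT f ->
  bounded_fun f -> P f.
Proof.
move=> mf bf.
have bp : bounded_fun f^\+.
  have [M [Mr HM]] := bf; exists M; split => // r Mr' t _ /=.
  rewrite /funrpos ger0_norm ?le_max ?lexx ?orbT//.
  have := HM r Mr' t I; rewrite ge_max => h.
  by rewrite (le_trans (ler_norm _) h) (le_trans _ h).
have bn : bounded_fun f^\-.
  have [M [Mr HM]] := bf; exists M; split => // r Mr' t _ /=.
  rewrite /funrneg ger0_norm ?le_max ?lexx ?orbT//.
  have h : `|f t| <= r by exact: HM r Mr' t I.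
  by rewrite ge_max (le_trans (ler_norm _)) ?normrN// (le_trans _ h).
have mp := measurable_funrpos mf.
have mn := measurable_funrneg mf.
rewrite (_ : f = fun t => -1 * f^\- t + f^\+ t).
  by apply: P_linear => //; apply: P_ge0 => // t; rewrite ?funrpos_ge0 ?funrneg_ge0.
by apply/funext => t; rewrite mulN1r addrC -[in LHS](funrposBneg f).
Qed.

End bounded_induction.

(** * Riesz representation of the dual of L_p *)

Section riesz.
Context (R : realType) (p q : R) (p1 : (1 <= p%:E)%E) (q1 : (1 <= q%:E)%E).
Local Notation RB := (measurableTypeR R).
Local Notation leb := (@lebesgue_measure R).
Local Notation X := (Lp leb p1).
Local Notation Y := (Lp leb q1).
Local Notation mkp := (mkLp (mu := leb) p1).
Local Notation mkq := (mkLp (mu := leb) q1).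

(** A strictly positive element of L_p: its p-th power is the Gaussian density. Multiplication by it
    carries all bounded measurable functions into L_p, although Lebesgue measure is infinite. *)
Definition riesz_weight (t : RB) : R := normal_pdf 0 1 t `^ p^-1.
Local Notation w := riesz_weight.

Let w_gt0 t : 0 < w t.
Proof. by rewrite powR_gt0// normal_pdfE// mulr_gt0// ?normal_peak_gt0// expR_gt0. Qed.

Let mw : measurable_fun setT w.
Proof. by apply: (measurableT_comp (measurable_powR _)); exact: measurable_normal_pdf. Qed.

Let wL : w \in Lfun leb p%:E.
Proof.
apply: integrable_powR_Lfun => //.
have := @integrable_normal_pdf R 0 1; apply: eq_integrable => // t _.
rewrite /= ger0_norm ?powR_ge0// -powRrM mulVf ?gt_eqF ?(Lexp_gt0 p1)// powRr1//.
exact: normal_pdf_ge0.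
Qed.

Let bwL (K : R) (f : RB -> R) : measurable_fun setT f ->
  (forall t, `|f t| <= K) -> (fun t => f t * w t) \in Lfun leb p%:E.
Proof.
move=> mf fK; apply: (@Lfun_dominated _ _ _ _ _ p1 _ (fun t => K * w t + 0)).
- exact: measurable_funM.
- by have := LfunZD p1 K wL (LfunP (0 : LfunType leb p1)).
- by move=> t; rewrite addr0 !normrM ler_wpM2r// (le_trans (fK t))// ler_norm.
Qed.

Let iwL (A : set RB) : measurable A -> (fun t => \1_A t * w t) \in Lfun leb p%:E.
Proof.
move=> mA; apply: (@bwL 1); first exact: measurable_indic.
by move=> t; rewrite indicE; case: (_ \in _); rewrite ?normr1 ?normr0.
Qed.

Variable g : dual X.

(** The weight makes this a finite charge on all Borel sets, so that Radon-Nikodym applies. The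
    density divided by the weight will be the representing function. *)
Definition riesz_charge (A : set RB) : \bar R := (g (mkp (fun t => \1_A t * w t)))%:E.

Let nu0 : riesz_charge set0 = 0%E.
Proof.
rewrite /riesz_charge indic0.
have -> : (fun t : RB => cst 0 t * w t) = fun=> 0.
  by apply/funext => t; rewrite /= mul0r.
by rewrite mkLp0 linear0.
Qed.

Let nu_fin A : measurable A -> riesz_charge A \is a fin_num.
Proof. by []. Qed.

Let nuU (A B : set RB) : measurable A -> measurable B -> A `&` B = set0 ->
  riesz_charge (A `|` B) = (riesz_charge A + riesz_charge B)%E.
Proof.
move=> mA mB AB0; rewrite /riesz_charge -EFinD; congr EFin.
have -> : (fun t : RB => \1_(A `|` B) t * w t) =
    fun t => 1 * (\1_A t * w t) + \1_B t * w t.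
  apply/funext => t; rewrite mul1r -mulrDl !indicE in_setU; congr (_ * _).
  have [tA|] := boolP (t \in A); last by rewrite add0r.
  rewrite (_ : (t \in B) = false) ?addr0//; apply/negbTE/negP => /set_mem Bt.
  have : (A `&` B) t by split => //; exact: set_mem tA.
  by rewrite AB0.
by rewrite mkLpZD ?iwL// scale1r linearD.
Qed.

Let nu_sigma : semi_sigma_additive riesz_charge.
Proof.
move=> F mF tF mUF.
rewrite (_ : (fun n => _) = fun n => riesz_charge (\big[setU/set0]_(i < n) F i)).
  apply: cvg_EFin; first exact: nearW.
  apply: (continuous_cvg _ (@dual_continuous _ _ g _)).
  apply: (@mkLp_dominated_cvg _ _ _ _ _ p1 _ _ w) => //.
  - move=> n; apply: measurable_funM => //; apply: measurable_indic.
    exact: bigsetU_measurable.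
  - exact: iwL.
  - by apply: aeW => t; apply: cvgM; [exact: cvg_indic_bigsetU|exact: cvg_cst].
  - move=> n t; rewrite normrM (ger0_norm (ltW (w_gt0 t))) ler_piMl//; first exact: ltW.
    by rewrite indicE; case: (_ \in _); rewrite ?normr1 ?normr0.
apply/funext; elim => [|n ih]; first by rewrite big_geq// big_ord0 nu0.
rewrite big_nat_recr//= ih big_ord_recr/= nuU//.
  exact: bigsetU_measurable.
apply/seteqP; split => // t [+ Fn]; rewrite -bigcup_mkord => -[i /= im Fit].
have := tF i n I I; move=> /(_ (ex_intro _ t (conj Fit Fn))) eim.
by move: im; rewrite eim ltnn.
Qed.

HB.instance Definition _ := isCharge.Build _ _ _ riesz_charge nu0 nu_fin nu_sigma.

Let nu_dom : riesz_charge `<< leb.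
Proof.
apply/null_content_dominatesP => A mA A0; congr EFin.
rewrite -[RHS](linear0 g); congr (g _).
rewrite -(mkLp0 leb p1).
apply: mkLp_ae; [exact: iwL|exact: (LfunP (0 : LfunType leb p1))|].
exists A; split => // t /= H; apply: contrapT => nA; apply: H => _.
by rewrite indicE memNset// mul0r.
Qed.

Definition riesz_density (t : RB) : R :=
  fine (Radon_Nikodym riesz_charge leb t).
Local Notation h := riesz_density.

Let ih : leb.-integrable setT (EFin \o h).
Proof.
have := Radon_Nikodym_integrable nu_dom; apply: eq_integrable => // t _.
by rewrite /= fineK// Radon_Nikodym_fin_num.
Qed.

Let mh : measurable_fun setT h.
Proof. by have /integrableP[/measurable_EFinP] := ih. Qed.

Let nuE A : measurable A -> riesz_charge A = (\int[leb]_(t in A) (h t)%:E)%E.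
Proof.
move=> mA; rewrite (Radon_Nikodym_integral nu_dom mA).
by apply: eq_integral => t _; rewrite fineK// Radon_Nikodym_fin_num.
Qed.

Let bh (K : R) (f : RB -> R) : measurable_fun setT f -> (forall t, `|f t| <= K) ->
  leb.-integrable setT (EFin \o (fun t => f t * h t)).
Proof.
move=> mf fK; have := integrable_norm ih => /(integrableZl measurableT K).
apply: le_integrable => //.
  by apply/measurable_EFinP; exact: measurable_funM.
move=> t _; rewrite !lee_fin !normrM normr_id ler_wpM2r//.
by rewrite (le_trans (fK t))// ler_norm.
Qed.

Let bdd (f : RB -> R) : bounded_fun f -> exists K, forall t, `|f t| <= K.
Proof.
move=> [M [_ HM]]; exists (`|M| + 1) => t; apply: HM => //.
by rewrite (le_lt_trans (ler_norm M))// ltrDl.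
Qed.

(** Both sides are continuous under bounded pointwise convergence, and for an indicator the identity
    is the defining property of the density. *)
Let g_bounded (f : RB -> R) (K : R) : measurable_fun setT f ->
  (forall t, `|f t| <= K) ->
  g (mkp (fun t => f t * w t)) = \int[leb]_t (f t * h t).
Proof.
move=> mf fK.
apply: (@bounded_fun_induction _ RB R
  (fun f => g (mkp (fun t => f t * w t)) = \int[leb]_t (f t * h t))) => //.
- move=> A mA; apply: EFin_inj; rewrite -[LHS]/(riesz_charge A).
  rewrite nuE// EFin_Rintegral; last first.
    apply: (@bh 1); first exact: measurable_indic.
    by move=> t; rewrite indicE; case: (_ \in _); rewrite ?normr1 ?normr0.
  rewrite [LHS]integral_mkcond.
  apply: eq_integral => t _.
  by rewrite patchE indicE; case: (_ \in _); rewrite ?mul0r// mul1r.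
- move=> a f1 f2 m1 m2 /bdd[K1 b1] /bdd[K2 b2] e1 e2.
  transitivity (g (mkp (fun t => a * (f1 t * w t) + f2 t * w t))).
    by congr (g (mkp _)); apply/funext => t; rewrite mulrDl mulrA.
  rewrite mkLpZD; [|exact: bwL b1|exact: bwL b2].
  rewrite dual_linear e1 e2 -Rintegral_linear; [|exact: bh b1|exact: bh b2].
  by apply: eq_Rintegral => t _; rewrite mulrDl mulrA.
- move=> f_ f0 K0 mf_ mf0 Pf_ fK0 f0K ff.
  have c1 : g (mkp (fun t => f_ n t * w t)) @[n --> \oo] --> g (mkp (fun t => f0 t * w t)).
    apply: (continuous_cvg _ (@dual_continuous _ _ g _)).
    apply: (@mkLp_dominated_cvg _ _ _ _ _ p1 _ _ (fun t => K0 * w t + 0)) => //.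
    + by move=> n; exact: measurable_funM.
    + exact: bwL f0K.
    + by have := LfunZD p1 K0 wL (LfunP (0 : LfunType leb p1)).
    + by apply: aeW => t; apply: cvgM; [exact: ff|exact: cvg_cst].
    + move=> n t; rewrite addr0 normrM (ger0_norm (ltW (w_gt0 t))).
      by rewrite ler_wpM2r// ltW.
  have c2 : \int[leb]_t (f_ n t * h t) @[n --> \oo] --> \int[leb]_t (f0 t * h t).
    apply: (@Rintegral_dominated_cvg _ _ _ _ _ _ (fun t => K0 * `|h t|)).
    + by move=> n; exact: measurable_funM.
    + exact: measurable_funM.
    + by move=> t; apply: cvgM; [exact: ff|exact: cvg_cst].
    + by have := integrableZl measurableT K0 (integrable_norm ih).
    + by move=> n t; rewrite normrM ler_wpM2r.
  rewrite -(cvg_lim _ c1)// -(cvg_lim _ c2)//.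
  suff -> : (fun n => g (mkp (fun t => f_ n t * w t))) = fun n => \int[leb]_t (f_ n t *
      h t) by [].
  by apply/funext => n; exact: Pf_.
- exists K; split; first exact: num_real.
  by move=> r Kr t _ /=; rewrite (le_trans (fK t))// ltW.
Qed.

Hypotheses (p_gt1 : 1 < p) (pq : p^-1 + q^-1 = 1).

Let q0 : 0 < q. Proof. exact: Lexp_gt0 q1. Qed.
Let p0 : 0 < p. Proof. exact: Lexp_gt0 p1. Qed.

Let q_gt1 : 1 < q.
Proof.
have : q^-1 < 1 by rewrite -pq ltrDr invr_gt0.
by rewrite invf_lt1.
Qed.

Let q1p : (q - 1) * p = q.
Proof.
have : (p^-1 + q^-1) * (p * q) = p * q by rewrite pq mul1r.
rewrite mulrDl mulrA mulVf ?gt_eqF// mul1r mulrCA mulVf ?gt_eqF// mulr1 => e.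
by rewrite mulrBl mul1r mulrC -e addrK.
Qed.

Let G (t : RB) : R := h t / w t.

Let mG : measurable_fun setT G.
Proof.
apply: measurable_funM => //.
have -> : (fun t => (w t)^-1) = (fun t : RB => normal_pdf 0 1 t `^ (- p^-1)).
  by apply/funext => t; rewrite powRN.
by apply: (measurableT_comp (measurable_powR _)); exact: measurable_normal_pdf.
Qed.

Let powG (t : RB) : `|G t| * `|G t| `^ (q - 2) = `|G t| `^ (q - 1).
Proof.
have [->|G0] := eqVneq (G t) 0; first by rewrite normr0 mul0r powR0// subr_eq0 gt_eqF.
rewrite -{1}(powRr1 (normr_ge0 (G t))) -powRD; last by rewrite normr_eq0 G0 implybT.
by congr (_ `^ _); ring.
Qed.

(** Truncations of sgn(G) |G|^(q-1), the extremal function in Hoelder's inequality. The cut-off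
    keeps [y n] below n w, where g is already known to be integration against G; as w > 0, it is
    eventually inactive at each point. The exponent q - 2 may be negative, but the factor G makes
    the product 0 where G vanishes. *)
Let y (n : nat) (t : RB) : R :=
  if `|G t| `^ (q - 1) <= n%:R * w t then G t * `|G t| `^ (q - 2) else 0.

Let mpow r : measurable_fun setT (fun t => `|G t| `^ r).
Proof.
by apply: (measurableT_comp (measurable_powR _)); exact: measurableT_comp.
Qed.

Let my n : measurable_fun setT (y n).
Proof.
apply: measurable_fun_ifT => //; last by apply: measurable_funM.
by apply: measurable_fun_ler => //; exact: measurable_funM.
Qed.

Let y_le n t : `|y n t| <= n%:R * w t.
Proof.
rewrite /y; case: ifPn => [h|_]; last by rewrite normr0 mulr_ge0// ltW.
by rewrite normrM (ger0_norm (powR_ge0 _ _)) powG.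
Qed.

(* A function dominated by a multiple of w is a bounded function times w. *)
Let g_dominated (f : RB -> R) (K : R) : measurable_fun setT f ->
  (forall t, `|f t| <= K * w t) ->
  [/\ f \in Lfun leb p%:E, leb.-integrable setT (EFin \o (fun t => G t * f t)) &
      g (mkp f) = \int[leb]_t (G t * f t)].
Proof.
move=> mf fK.
have mfw : measurable_fun setT (fun t : RB => f t * normal_pdf 0 1 t `^ (- p^-1)).
  apply: measurable_funM => //.
  by apply: (measurableT_comp (measurable_powR _)); exact: measurable_normal_pdf.
have fwK t : `|f t * normal_pdf 0 1 t `^ (- p^-1)| <= K.
  by rewrite powRN normrM normfV (ger0_norm (ltW (w_gt0 t))) ler_pdivrMr.
have fE : f = fun t => f t * normal_pdf 0 1 t `^ (- p^-1) * w t.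
  by apply/funext => t; rewrite powRN -[RHS]/(f t / w t * w t) mulfVK// gt_eqF.
have fG t : f t * normal_pdf 0 1 t `^ (- p^-1) * h t = G t * f t.
  by rewrite powRN /G mulrAC [RHS]mulrC mulrA.
split; first by rewrite fE; exact: bwL fwK.
  have := bh mfw fwK; apply: eq_integrable => // t _.
  by rewrite /= fG.
rewrite [in LHS]fE (g_bounded mfw fwK).
by apply: eq_Rintegral => t _; rewrite fG.
Qed.

Let powy n t : `|y n t| `^ p = G t * y n t.
Proof.
rewrite /y; case: ifPn => _; last by rewrite normr0 mulr0 powR0// gt_eqF.
rewrite normrM (ger0_norm (powR_ge0 _ _)) powG -powRrM q1p.
have [->|G0] := eqVneq (G t) 0; first by rewrite normr0 !mul0r powR0// gt_eqF.
rewrite mulrA -expr2 -real_normK ?num_real// expr2 -mulrA powG.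
rewrite -{2}(powRr1 (normr_ge0 (G t))) -powRD; last by rewrite normr_eq0 G0 implybT.
by congr (_ `^ _); ring.
Qed.

(** By [powy] the p-th power of the norm of [y n] is g(y n), hence at most |g| times that norm;
    dividing by the norm leaves a bound independent of n. *)
Let norm_y n : `|mkp (y n)| `^ (p - 1) <= `|g|.
Proof.
have [yL yi gy] := g_dominated (my n) (y_le n).
have [->|N0] := eqVneq `|mkp (y n)| 0.
  by rewrite powR0// subr_eq0 gt_eqF.
have N_gt0 : 0 < `|mkp (y n)| by rewrite lt0r N0 normr_ge0.
rewrite -(ler_pM2r N_gt0).
have -> : `|mkp (y n)| `^ (p - 1) * `|mkp (y n)| = `|mkp (y n)| `^ p.
  rewrite -{2}(powRr1 (ltW N_gt0)) -powRD ?subrK//.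
  by rewrite N0 implybT.
rewrite (_ : _ `^ p = g (mkp (y n))).
  by rewrite (le_trans (ler_norm _))//; exact: dual_norm_le.
apply: EFin_inj; rewrite norm_mkLp_powR// gy EFin_Rintegral//.
by apply: eq_integral => t _; rewrite powy.
Qed.

Let intGy n : (\int[leb]_t (G t * y n t)%:E <= ((`|g| `^ (p - 1)^-1) `^ p)%:E)%E.
Proof.
have [yL yi gy] := g_dominated (my n) (y_le n).
rewrite (_ : (\int[leb]_t _)%E = (`|mkp (y n)| `^ p)%:E); last first.
  by rewrite norm_mkLp_powR//; apply: eq_integral => t _; rewrite powy.
rewrite lee_fin; apply: (ler_powR_base p1) => //.
have p10 : 0 < p - 1 by rewrite subr_gt0.
have := ge0_ler_powR (r := (p - 1)^-1) _ _ _ (norm_y n).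
rewrite !nnegrE powR_ge0 normr_ge0 invr_ge0 (ltW p10) => /(_ isT isT isT).
by rewrite -powRrM mulfV ?gt_eqF// powRr1.
Qed.

(** The products G * [y n] increase to |G|^q, and [intGy] bounds their integrals uniformly in n. *)
Let GL : G \in Lfun leb q%:E.
Proof.
apply: integrable_powR_Lfun => //; apply/integrableP; split.
  by apply/measurable_EFinP.
have yG n t : (0 <= G t * y n t)%R by rewrite -powy powR_ge0.
have lim t : (G t * y n t)%:E @[n --> \oo] --> (`|G t| `^ q)%:E.
  apply: cvg_near_cst; near=> n.
  have h : `|G t| `^ (q - 1) <= n%:R * w t.
    rewrite -ler_pdivrMr//; apply: ltW; near: n; exact: nbhs_infty_gtr.
  rewrite -powy /y h normrM (ger0_norm (powR_ge0 _ _)) powG -powRrM.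
  by rewrite q1p.
have := @cvg_monotone_convergence _ _ _ leb setT measurableT
  (fun n t => (G t * y n t)%:E).
move=> /(_ _ _ _)/wrap[].
- by move=> n; apply/measurable_EFinP; exact: measurable_funM.
- by move=> n t _; rewrite lee_fin.
- move=> t _ m n mn; rewrite lee_fin /y.
  case: ifPn => [h1|_]; last by rewrite mulr0 -/(y n t).
  rewrite (le_trans h1)// ler_wpM2r// ?ler_nat// ltW//.
move=> cv; apply: (@le_lt_trans _ _ ((`|g| `^ (p - 1)^-1) `^ p)%:E); last exact: ltry.
rewrite (_ : (\int[leb]_t _)%E = (\int[leb]_t limn (fun n => (G t * y n t)%:E))%E);
    last first.
  apply: eq_integral => t _.
  by rewrite (cvg_lim _ (lim t))// gee0_abs// lee_fin powR_ge0.
rewrite -(cvg_lim _ cv)//.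
by apply: lime_le; [exact: cvgP cv|exact: nearW].
Unshelve. all: by end_near. Qed.

Lemma dual_Lp_riesz : exists H : Y, g = pairing_dual p1 pq H.
Proof.
exists (mkq G); apply/dualE => x; rewrite pairing_dualE -(mkLpK x).
set f := Lp_fun x.
have mf : measurable_fun setT f by [].
(* The same truncation for f: [z n] lies below n w, where g is integration against G, and it tends
   to f in L_p. *)
pose z (n : nat) (t : RB) : R := if `|f t| <= n%:R * w t then f t else 0.
have mz n : measurable_fun setT (z n).
  apply: measurable_fun_ifT => //.
  by apply: measurable_fun_ler; [exact: measurableT_comp|exact: measurable_funM].
have zK n t : `|z n t| <= n%:R * w t.
  by rewrite /z; case: ifPn => // _; rewrite normr0 mulr_ge0// ltW.
have cz : mkp (z n) @[n --> \oo] --> mkp f.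
  apply: (@mkLp_dominated_cvg _ _ _ _ _ p1 _ _ (normr \o f)) => //.
  - exact: LfunP.
  - by apply: (Lfun_dominated p1 _ (LfunP f)) => [|t];
      [exact: measurableT_comp|rewrite /= normr_id].
  - apply: aeW => t; apply: cvg_near_cst; near=> n.
    rewrite /z ifT// -ler_pdivrMr//; apply: ltW; near: n; exact: nbhs_infty_gtr.
  - by move=> n t; rewrite /z; case: ifPn => //= _; rewrite normr0.
have c1 : g (mkp (z n)) @[n --> \oo] --> g (mkp f).
  exact: (continuous_cvg _ (@dual_continuous _ _ g _) cz).
have c2 : pairing (mkq G) (mkp (z n)) @[n --> \oo] --> pairing (mkq G) (mkp f).
  exact: (continuous_cvg _ (@pairing_continuous _ _ _ _ _ _ _ _ pq _ _) cz).
rewrite -(cvg_lim _ c1)// -(cvg_lim _ c2)//.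
suff -> : (fun n => g (mkp (z n))) = fun n => pairing (mkq G) (mkp (z n)) by [].
apply/funext => n; have [zL zi ->] := g_dominated (mz n) (zK n).
by rewrite pairing_mkLp.
Unshelve. all: by end_near. Qed.

End riesz.

(** * Continuity of the wavelet system *)

Section borel_plane.
Context (R : realType).
Local Notation RB := (measurableTypeR R).

(** [RB * RB] carries the product sigma-algebra, so an open set has to be written as a countable
    union of products. Rational boxes serve for this; those not contained in A are replaced by the
    empty set, so that the union runs over all rational quadruples. *)
Lemma open_measurable_plane (A : set (R * R)) : open A ->
  measurable (A : set (RB * RB)).
Proof.
move=> oA.
pose box (r : (rat * rat) * (rat * rat)) : set (RB * RB) :=
  `]ratr r.1.1, ratr r.1.2[%classic `*` `]ratr r.2.1, ratr r.2.2[%classic.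
pose F r : set (RB * RB) := if `[< box r `<=` A >] then box r else set0.
have -> : A = \bigcup_r F r.
  apply/seteqP; split => [[x y] Axy|z [r _]]; last first.
    by rewrite /F; case: ifPn => // /asboolP; exact.
  have := oA; rewrite openE => /(_ _ Axy) [[U V] /=
      [/nbhs_ballP[e e0 xU] /nbhs_ballP[f f0 yV]] UVA].
  have [a] : exists r, ratr r \in `]x - e, x[ by apply: rat_in_itvoo;
      rewrite ?ltrBlDr ltrDl.
  rewrite in_itv/= => /andP[a1 a2].
  have [b] : exists r, ratr r \in `]x, x + e[ by apply: rat_in_itvoo;
      rewrite ?ltrBlDr ltrDl.
  rewrite in_itv/= => /andP[b1 b2].
  have [c] : exists r, ratr r \in `]y - f, y[ by apply: rat_in_itvoo;
      rewrite ?ltrBlDr ltrDl.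
  rewrite in_itv/= => /andP[c1 c2].
  have [k] : exists r, ratr r \in `]y, y + f[ by apply: rat_in_itvoo;
      rewrite ?ltrBlDr ltrDl.
  rewrite in_itv/= => /andP[k1 k2].
  exists ((a, b), (c, k)) => //; rewrite /F ifT.
    by split; rewrite /= in_itv/= ?a2 ?b1 ?c2 ?k1.
  apply/asboolP => -[x' y'] [] /=; rewrite !in_itv/= => /andP[ax xb] /andP[cy yk].
  apply: UVA; split => /=.
    apply: xU; rewrite -ball_normE/= distrC ltr_distl.
    by rewrite (lt_trans a1 ax) (lt_trans xb b2).
  apply: yV; rewrite -ball_normE/= distrC ltr_distl.
  by rewrite (lt_trans c1 cy) (lt_trans yk k2).
apply: countable_bigcupT_measurable; first exact: countableP.
move=> r; rewrite /F; case: ifPn => _; last exact: measurable0.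
by apply: measurableX; exact: measurable_itv.
Qed.

Lemma continuous_measurable_plane (F : R * R -> R) : continuous F ->
  measurable_fun [set: RB * RB] F.
Proof.
move=> cF; apply: (measurability _ (RGenOInfty.measurableE R)).
move=> _ [_ [x ->] <-]; rewrite setTI.
apply: open_measurable_plane; apply: open_comp; last exact: interval_open.
by move=> z _; exact: cF.
Qed.

End borel_plane.

(** * Composition laws of dilations and translations *)

Section group_laws.
Context (R : realType) (p : R) (p1 : (1 <= p%:E)%E).
Local Notation RB := (measurableTypeR R).
Local Notation leb := (@lebesgue_measure R).
Local Notation X := (Lp leb p1).
Local Notation mk := (mkLp (mu := leb) p1).
Implicit Type x : X.

Lemma dilation_mk a (f : RB -> R) : f \in Lfun leb p%:E ->
  dilation a (mk f) = mk (fun t => 2 `^ (a / p) * f (2 `^ a * t)).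
Proof.
move=> fL; rewrite (mkLpE p1 fL) dilation_toLp -mkLp_Lfun.
by congr mkLp.
Qed.

Lemma translation_mk b (f : RB -> R) : f \in Lfun leb p%:E ->
  translation b (mk f) = mk (fun t => f (t - b)).
Proof.
move=> fL; rewrite (mkLpE p1 fL) translation_toLp -mkLp_Lfun.
by congr mkLp.
Qed.

Lemma dilationD a b x : dilation a (dilation b x) = dilation (a + b) x.
Proof.
rewrite -(Lp_funK x) !dilation_toLp; congr toLp; apply/LfuneqP => t /=.
by rewrite mulrA -powRD ?pnatr_eq0 ?implybT// mulrA -powRD ?pnatr_eq0 ?implybT//
  mulrDl [b + a]addrC.
Qed.

Lemma dilation0 x : dilation 0 x = x.
Proof.
rewrite -(Lp_funK x) dilation_toLp; congr toLp; apply/LfuneqP => t /=.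
by rewrite mul0r !powRr0 !mul1r.
Qed.

Lemma translationD a b x : translation a (translation b x) = translation (a + b) x.
Proof.
rewrite -(Lp_funK x) !translation_toLp; congr toLp; apply/LfuneqP => t /=.
by rewrite opprD addrA.
Qed.

Lemma translation0 x : translation 0 x = x.
Proof.
rewrite -(Lp_funK x) translation_toLp; congr toLp; apply/LfuneqP => t /=.
by rewrite subr0.
Qed.

(** The source of the offset 2^n c in the shifted lattice: moving T_c past D_n multiplies c by
    2^n. *)
Lemma translation_dilation a c x :
  translation c (dilation a x) = dilation a (translation (2 `^ a * c) x).
Proof.
rewrite -(Lp_funK x) !(dilation_toLp, translation_toLp); congr toLp.
by apply/LfuneqP => t /=; rewrite mulrBr.
Qed.

End group_laws.

(** * Norm continuity of the orbits *)

Section strong_continuity.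
Context (R : realType) (p : R) (p1 : (1 <= p%:E)%E).
Local Notation RB := (measurableTypeR R).
Local Notation leb := (@lebesgue_measure R).
Local Notation X := (Lp leb p1).
Local Notation mk := (mkLp (mu := leb) p1).

(** Isometries are equicontinuous, so convergence on a set passes to its closure by an e/3
    argument. *)
Lemma closed_isometry_cvg (A : nat -> {linear X -> X}) :
  (forall n x, `|A n x| = `|x|) -> closed [set x | A n x @[n --> \oo] --> x].
Proof.
move=> Ai x xcl; apply/cvgrPdist_lt => e e0.
have e3 : 0 < e / 3 by rewrite divr_gt0.
have [y [Ay]] := xcl _ (nbhsx_ballx x _ e3).
rewrite -ball_normE /= => xy.
move/cvgrPdist_lt : Ay => /(_ _ e3); apply: filterS => n yn.
have -> : x - A n x = (x - y) + (y - A n y) - A n (x - y).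
  by rewrite linearB opprB !subrKA.
rewrite (le_lt_trans (ler_normB _ _))// Ai.
rewrite (le_lt_trans (lerD (ler_normD _ _) (lexx _)))//.
have -> : e = e / 3 + e / 3 + e / 3 by field.
by rewrite ltrD// ltrD.
Qed.

Let in_ocitv (a b s : R) : (s \in `]a, b]%classic) = (a < s <= b).
Proof.
by apply/idP/idP => [/set_mem|h]; [|apply/mem_set]; rewrite /= in_itv.
Qed.

Let indic_cvg (a b t : R) (v : nat -> R) : t != a -> t != b ->
  v n @[n --> \oo] --> t ->
  (\1_`]a, b] (v n) : R) @[n --> \oo] --> (\1_`]a, b] t : R).
Proof.
move=> ta tb vt; apply: cvg_near_cst.
have ha : \forall n \near \oo, (a < v n) = (a < t).
  have [at_|ta_|e] := ltgtP a t; last by rewrite e eqxx in ta.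
  - have H : \forall n \near \oo, a < v n by apply: (cvgr_gt t).
    by apply: filterS H => n ->.
  - have H : \forall n \near \oo, v n < a by apply: (cvgr_lt t).
    apply: filterS H => n h.
    by rewrite ltNge (ltW h).
have hb : \forall n \near \oo, (v n <= b) = (t <= b).
  have [bt_|tb_|e] := ltgtP b t; last by rewrite e eqxx in tb.
  - have H : \forall n \near \oo, b < v n by apply: (cvgr_gt t).
    apply: filterS H => n h.
    by rewrite leNgt h.
  - have H : \forall n \near \oo, v n < b by apply: (cvgr_lt t).
    by apply: filterS H => n /ltW.
by near=> n; rewrite !indicE !in_ocitv (near ha n) ?(near hb n).
Unshelve. all: by end_near. Qed.

Let powR2_cvg (u : nat -> R) (c : R) : u n @[n --> \oo] --> 0 ->
  2 `^ (u n * c) @[n --> \oo] --> (1 : R).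
Proof.
move=> u0; rewrite /powR pnatr_eq0/=.
have e : expR (0 * c * ln 2) = 1 :> R by rewrite !mul0r expR0.
suff : expR (u n * c * ln 2) @[n --> \oo] --> expR (0 * c * ln 2) by rewrite e.
apply: continuous_cvg; first exact: continuous_expR.
by apply: cvgM; [apply: cvgM => //; exact: cvg_cst|exact: cvg_cst].
Qed.

Let seq_bounded (u : nat -> R) : u n @[n --> \oo] --> 0 ->
  exists2 K : R, 0 <= K & forall n, `|u n| <= K.
Proof.
move=> u0; have /cvg_seq_bounded [M [_ HM]] : cvgn u by apply/cvg_ex; exists 0.
exists (`|M| + 1); first by rewrite addr_ge0.
by move=> n; apply: (HM (`|M| + 1)) => //; rewrite (le_lt_trans (ler_norm M))// ltrDl.
Qed.

(** By density it is enough to treat the indicator of ]a, b], for which pointwise convergence can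
    fail only at the two endpoints. *)
Lemma dilation_translation_cvg (u v : nat -> R) (x : X) :
  u n @[n --> \oo] --> 0 -> v n @[n --> \oo] --> 0 ->
  dilation (u n) (translation (v n) x) @[n --> \oo] --> x.
Proof.
move=> u0 v0.
have [K K0 uK] := seq_bounded u0; have [L L0 vL] := seq_bounded v0.
have iso n y : `|dilation (u n) (translation (v n) y : X)| = `|y|.
  by rewrite norm_dilation norm_translation.
apply: (@Lp_itv_dense _ _ p1 [set x | dilation (u n) (translation (v n) x) @[n -->
    \oo] --> x]).
- exact: (@closed_isometry_cvg (fun n => dilation (u n) \o translation (v n)) iso).
- move=> a y z /= cy cz.
  under eq_fun do rewrite !linearP.
  by apply: cvgD => //; apply: cvgZr.
- move=> a b /=.
  have iL := itv_indic_Lfun p1 a b.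
  (* If 2^(u n) t - v n lies in ]a, b], then |2^(u n) t| <= |a| + |b| + L, hence |t| <= B. The left
     endpoint -B - 1 below compensates for the half-open interval. *)
  pose B := 2 `^ K * (`|a| + `|b| + L).
  pose h : RB -> R := fun t => 2 `^ (K / p) * \1_`](- B - 1), B] t.
  pose f n : RB -> R := fun t => 2 `^ (u n / p) * \1_`]a, b] (2 `^ u n * t - v n).
  rewrite (_ : (fun n => _) = fun n => mk (f n)); last first.
    apply/funext => n; rewrite translation_mk// dilation_mk//.
    have := LfunP (translation_fun (v n) (Lfun_Sub p1 iL)); exact.
  apply: (@mkLp_dominated_cvg _ _ _ _ _ p1 _ _ h) => //.
  + move=> n; apply: measurable_funM => //.
    apply: (measurableT_comp (f := (\1_`]a, b] : RB -> R))).
      by apply: measurable_indic; exact: measurable_itv.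
    by apply: measurable_funB => //; exact: measurable_funM.
  + have := LfunP (2 `^ (K / p) *: Lfun_Sub p1 (itv_indic_Lfun p1 (- B - 1) B)); exact.
  + exists [set a; b]; split.
    * by apply: measurableU; exact: measurable_set1.
    * apply: countable_lebesgue_measure0; exact/finite_set_countable/finite_set2.
    * move=> t /= nt; apply: contrapT => /not_orP[ta tb]; apply: nt.
      rewrite -[X in _ --> X]mul1r /f; apply: cvgM; first exact: powR2_cvg.
      apply: indic_cvg; [exact/eqP|exact/eqP|].
      rewrite -[X in _ --> X]subr0 -[X in _ --> X - _]mul1r.
      apply: cvgB => //; apply: cvgM; last exact: cvg_cst.
      by under eq_fun do rewrite -[u _]mulr1; exact: powR2_cvg.
  + move=> n t; rewrite /f /h normrM (ger0_norm (powR_ge0 _ _)).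
    apply: ler_pM; [exact: powR_ge0|exact: normr_ge0| |].
      rewrite ler_powR ?ler1n// ler_wpM2r// ?invr_ge0 ?(ltW (Lexp_gt0 p1))//.
      exact: le_trans (ler_norm _) (uK n).
    rewrite !indicE ger0_norm// ler_nat.
    case: (boolP (_ \in `]a, b]%classic)) => // /set_mem /=; rewrite in_itv/= =>
        /andP[h1 h2].
    rewrite mem_set//= in_itv/=.
    have s1 : `|2 `^ u n * t| <= `|a| + `|b| + L.
      have := vL n; rewrite !ler_norml => /andP[l1 l2].
      have := ler_norm a; have := ler_norm (- a); have := ler_norm b; have :=
          ler_norm (- b).
      rewrite !normrN => *; apply/andP; split; lra.
    have s2 : `|t| <= B.
      have -> : t = 2 `^ (- u n) * (2 `^ u n * t).
        by rewrite mulrA -powRD ?pnatr_eq0 ?implybT// addNr powRr0 mul1r.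
      rewrite normrM ler_pM// (ger0_norm (powR_ge0 _ _)) ler_powR ?ler1n//.
      by rewrite (le_trans (ler_norm _))// normrN.
    by move: s2; rewrite ler_norml => /andP[l1 ->];
        rewrite andbT (lt_le_trans _ l1)// ltrBlDr ltrDl.
Qed.

Lemma translation_cvg0 (x : X) : translation b x @[b --> 0] --> x.
Proof.
apply/subr_cvg0/norm_cvg0P.
(* Convergence at 0 is tested on sequences, to which dominated convergence applies. *)
apply: (@cvg_nbhsP R R^o (fun b => `|translation b x - x|) 0 0).2 => v v0.
apply/norm_cvg0P/subr_cvg0.
have c0 : (fun=> 0 : R) @ \oo --> (0 : R) by exact: cvg_cst.
have := @dilation_translation_cvg (fun=> 0) v x c0 v0.
by under eq_fun do rewrite dilation0.
Qed.

Lemma dilation_cvg0 (x : X) : dilation a x @[a --> 0] --> x.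
Proof.
apply/subr_cvg0/norm_cvg0P.
apply: (@cvg_nbhsP R R^o (fun b => `|dilation b x - x|) 0 0).2 => v v0.
apply/norm_cvg0P/subr_cvg0.
have c0 : (fun=> 0 : R) @ \oo --> (0 : R) by exact: cvg_cst.
have := @dilation_translation_cvg v (fun=> 0) x v0 c0.
by under eq_fun do rewrite translation0.
Qed.

Lemma continuous_wavelet_vector (x : X) : continuous (wavelet_vector x).
Proof.
move=> [a0 b0]; apply/subr_cvg0/norm_cvg0P.
pose z := translation b0 x.
pose B (c : R * R) := `|translation (c.2 - b0) x - x| + `|dilation (c.1 - a0) z - z|.
have c1 : translation (c.2 - b0) x @[c --> ((a0, b0) : R * R)] --> x.
  have h : c.2 - b0 @[c --> ((a0, b0) : R * R)] --> (0 : R).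
    by rewrite -(subrr b0); apply: cvgB; [exact: cvg_snd|exact: cvg_cst].
  apply/cvgrPdist_lt => e e0.
  have /cvgrPdist_lt/(_ _ e0) H := @translation_cvg0 x.
  exact: h _ H.
have c2 : dilation (c.1 - a0) z @[c --> ((a0, b0) : R * R)] --> z.
  have h : c.1 - a0 @[c --> ((a0, b0) : R * R)] --> (0 : R).
    by rewrite -(subrr a0); apply: cvgB; [exact: cvg_fst|exact: cvg_cst].
  apply/cvgrPdist_lt => e e0.
  have /cvgrPdist_lt/(_ _ e0) H := @dilation_cvg0 z.
  exact: h _ H.
apply: (@squeeze_cvgr _ _ _ _ (fun=> 0) B).
- apply: nearW => -[a b]; rewrite normr_ge0/= /B/= /wavelet_vector/=.
  (* The outer isometries drop out of the norms, so that each of the two terms depends on one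
     coordinate increment only. *)
  have -> : dilation a (translation b x) - dilation a0 (translation b0 x) =
    dilation a (translation b0 (translation (b - b0) x - x)) +
    dilation a0 (dilation (a - a0) z - z).
    have eT u v : translation b0 (u - v) = translation b0 u - translation b0 v :> X.
      exact: linearB.
    have eD r u v : dilation r (u - v) = dilation r u - dilation r v :> X.
      exact: linearB.
    rewrite eT !eD translationD [b0 + _]addrC subrK dilationD [a0 + _]addrC subrK.
    by rewrite subrKA.
  by rewrite (le_trans (ler_normD _ _))// !norm_dilation norm_translation.
- exact: cvg_cst.
- rewrite -[0]addr0; apply: cvgD; apply/norm_cvg0P/subr_cvg0; [exact: c1|exact: c2].
Qed.

End strong_continuity.

(** * Adjoints of dilations and translations under the pairing *)

Section change_of_variable.
Context (R : realType).
Local Notation RB := (measurableTypeR R).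
Local Notation leb := (@lebesgue_measure R).

Lemma integrable_affine (c b : R) (F : RB -> R) : 0 < c ->
  leb.-integrable setT (EFin \o F) ->
  leb.-integrable setT (EFin \o (fun t => F (c * t - b))).
Proof.
move=> c0 /integrableP[/measurable_EFinP mF intF]; apply/integrableP; split.
  apply/measurable_EFinP; apply: (measurableT_comp mF).
  by apply: measurable_funB => //; exact: measurable_funM.
have mN : measurable_fun [set: RB] (fun t => `|(F t)%:E|%E).
  by apply: measurableT_comp => //; exact/measurable_EFinP.
by rewrite /= (@ge0_integral_affine R c b _ c0 mN)// lte_mul_pinfty// lee_fin invr_ge0 ltW.
Qed.

Lemma Rintegral_affine (c b : R) (F : RB -> R) : 0 < c ->
  leb.-integrable setT (EFin \o F) ->
  \int[leb]_t F (c * t - b) = c^-1 * \int[leb]_t F t.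
Proof.
move=> c0 iF; have /integrableP[mF _] := iF.
apply: EFin_inj; rewrite EFinM EFin_Rintegral /Rintegral; last exact: integrable_affine.
have fn : (\int[leb]_t (F t)%:E)%E \is a fin_num by exact: integrable_fin_num.
have e : (\int[leb]_t (F (c * t - b))%:E = (c^-1)%:E * \int[leb]_t (F t)%:E)%E.
  rewrite [LHS]integralE [X in (_ * X)%E]integralE muleBr//; last first.
    have := integrable_add_def (measurableT) iF; exact.
  have mp : measurable_fun [set: RB] (EFin \o F)^\+%E by exact: measurable_funepos.
  have mn : measurable_fun [set: RB] (EFin \o F)^\-%E by exact: measurable_funeneg.
  congr (_ - _)%E.
    rewrite -[RHS](@ge0_integral_affine R c b _ c0 mp (fun t => funepos_ge0 _ t)).
    by apply: eq_integral => t _; rewrite !unlock.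
  rewrite -[RHS](@ge0_integral_affine R c b _ c0 mn (fun t => funeneg_ge0 _ t)).
    by apply: eq_integral => t _; rewrite !unlock.
by rewrite e fineK// fin_numM.
Qed.

Variables (p q : R) (p1 : (1 <= p%:E)%E) (q1 : (1 <= q%:E)%E).
Hypothesis pq : p^-1 + q^-1 = 1.
Local Notation X := (Lp leb p1).
Local Notation Y := (Lp leb q1).

Lemma pairing_translation b (G : Y) (x : X) :
  pairing G (translation (- b) x) = pairing (translation b G) x.
Proof.
rewrite -(mkLpK x) -(mkLpK G) !translation_mk ?LfunP//.
rewrite !pairing_mkLp ?LfunP//; [|exact: translation_fun_Lfun..].
pose F (t : RB) := Lp_fun G (t - b) * Lp_fun x t.
have iF : leb.-integrable setT (EFin \o F).
  apply: (pairing_integrable p1 q1 pq); first exact: LfunP.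
  exact: translation_fun_Lfun.
have := @Rintegral_affine 1 (- b) F ltr01 iF; rewrite invr1 mul1r => <-.
by apply: eq_Rintegral => t _; rewrite /F !mul1r opprK addrK.
Qed.

(** The Jacobian 2^a times the normalization 2^(-a/p) of D_(-a) on L_p is 2^(a/q), the normalization
    of D_a on L_q, because 1 - 1/p = 1/q. *)
Lemma pairing_dilation a (G : Y) (x : X) :
  pairing G (dilation (- a) x) = pairing (dilation a G) x.
Proof.
rewrite -(mkLpK x) -(mkLpK G) !dilation_mk ?LfunP//.
rewrite !pairing_mkLp ?LfunP//; [|exact: dilation_fun_Lfun..].
pose F (t : RB) := 2 `^ (a / q) * Lp_fun G (2 `^ a * t) * Lp_fun x t.
have iF : leb.-integrable setT (EFin \o F).
  apply: (pairing_integrable p1 q1 pq); first exact: LfunP.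
  exact: dilation_fun_Lfun.
have := @Rintegral_affine (2 `^ (- a)) 0 F (powR_gt0 _ (ltr0n _ 2)) iF.
rewrite -[in RHS]/(F _) => e.
have -> : \int[leb]_t F t = 2 `^ (- a) * \int[leb]_t F (2 `^ (- a) * t - 0).
  by rewrite e mulrA divff ?mul1r// gt_eqF// powR_gt0.
rewrite -RintegralZl//; last by apply: integrable_affine (powR_gt0 _ (ltr0n _ 2)) iF.
apply: eq_Rintegral => t _; rewrite /F subr0.
rewrite [2 `^ a * _]mulrA -powRD ?pnatr_eq0 ?implybT// subrr powRr0 mul1r.
rewrite !mulrA -powRD ?pnatr_eq0 ?implybT// [Lp_fun G t * _]mulrC.
congr (2 `^ _ * _ * _); rewrite -[X in X + _]mulr1 -pq.
ring.
Qed.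

End change_of_variable.

Lemma continuous_pair (T U V : topologicalType) (f : T -> U) (g : T -> V) :
  continuous f -> continuous g -> continuous (fun t => (f t, g t)).
Proof. by move=> cf cg t; apply: cvg_pair; [exact: cf|exact: cg]. Qed.

Section continuous_dual.
Context (R : realType) (X : normedModType R) (T : topologicalType).

Lemma continuous_dual_comp (W : T -> X) (g : dual X) :
  continuous W -> continuous (fun t => g (W t) : R).
Proof.
move=> cW t; apply: (continuous_comp (cW t)); exact: dual_continuous.
Qed.

Lemma continuous_dual_eval (W : T -> dual X) (y : X) :
  continuous W -> continuous (fun t => W t y : R).
Proof.
move=> cW t; apply/cvgrPdist_lt => e e0.
have d0 : 0 < e / (`|y| + 1) by rewrite divr_gt0// ltr_wpDl.
have /cvgrPdist_lt/(_ _ d0) := cW t; apply: filterS => u h.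
have -> : W t y - W u y = (W t - W u) y by [].
rewrite (le_lt_trans (dual_norm_le _ y))//.
move: h; rewrite ltr_pdivlMr ?ltr_wpDl//; apply: le_lt_trans.
by rewrite -[dual_norm _]/(`|W t - W u|) mulrDr mulr1 lerDl.
Qed.

End continuous_dual.

(** * The functionals as an orbit in L_q *)

Section wavelet_functionals.
Context (R : realType).
Local Notation RB := (measurableTypeR R).
Local Notation leb := (@lebesgue_measure R).
Variables (p q : R) (p1 : (1 <= p%:E)%E) (q1 : (1 <= q%:E)%E).
Hypothesis pq : p^-1 + q^-1 = 1.
Local Notation X := (Lp leb p1).
Local Notation Y := (Lp leb q1).
Local Notation emb := (pairing_dual (mu := leb) (q1 := q1) p1 pq).

(** Norm continuity of the functionals is thereby reduced to that of an orbit in L_q. In general,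
    the orbits of an adjoint group are only weak-star continuous. *)
Lemma wavelet_functional_pairing (G : Y) (ab : R * R) :
  wavelet_functional (emb G) ab = emb (wavelet_vector G ab).
Proof.
apply/dualE => x.
rewrite -[LHS]/(pairing G (translation (- ab.2) (dilation (- ab.1) x))).
rewrite -[RHS]/(pairing (wavelet_vector G ab) x).
rewrite (pairing_translation pq ab.2 G (dilation (- ab.1) x)).
by rewrite (pairing_dilation pq ab.1 (translation ab.2 G) x).
Qed.

Lemma continuous_pairing_dual : continuous emb.
Proof.
apply: bounded_linear_continuous; apply/linear_boundedP.
exists 1; split => // r r1 G.
by rewrite (le_trans (pairing_dual_norm p1 pq G))// ler_peMl// ltW.
Qed.

Lemma continuous_wavelet_functional (G : Y) :
  continuous (wavelet_functional (emb G)).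
Proof.
rewrite (_ : wavelet_functional _ = emb \o wavelet_vector G); last first.
  by apply/funext => ab; exact: wavelet_functional_pairing.
move=> ab; apply: continuous_comp; first exact: continuous_wavelet_vector.
exact: continuous_pairing_dual.
Qed.

Lemma borel_measurable_wavelet (psi : X) (G : Y) :
  borel_measurable (fun ab : RB * RB =>
    (wavelet_vector psi ab, wavelet_functional (emb G) ab)).
Proof.
apply: (@measurability _ _ _ (g_sigma_algebraType (@open (X * dual X)%type))
    setT _ (@open (X * dual X)%type)) => //.
move=> _ [U oU <-]; rewrite setTI.
apply: open_measurable_plane.
apply: (@open_comp _ _ (fun ab : R * R => (wavelet_vector psi ab,
    wavelet_functional (emb G) ab))) => // ab _.
apply: continuous_pair; first exact: continuous_wavelet_vector.
exact: continuous_wavelet_functional.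
Qed.

Lemma wavelet_coefficient_measurable (psi y : X) (G : Y) (g : dual X) :
  measurable_fun [set: RB * RB] (fun ab : RB * RB =>
    wavelet_functional (emb G) ab y * g (wavelet_vector psi ab)).
Proof.
apply: continuous_measurable_plane.
move=> ab; apply: cvgM.
  exact: (@continuous_dual_eval _ _ _ _ y (@continuous_wavelet_functional G)).
exact: (@continuous_dual_comp _ _ _ _ g (@continuous_wavelet_vector _ _ _ psi)).
Qed.

End wavelet_functionals.

(** * Averages of lattice sums *)

Definition int_enum (i : nat) : int :=
  if odd i then Negz i./2 else Posz i./2.

Definition int_index (n : int) : nat :=
  match n with Posz m => m.*2 | Negz m => m.*2.+1 end.

Lemma int_enumK : cancel int_enum int_index.
Proof.
move=> i; rewrite /int_enum -[in RHS](odd_double_half i).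
by case: (odd i).
Qed.

Lemma int_indexK : cancel int_index int_enum.
Proof.
by case=> m; rewrite /int_enum /= ?oddS odd_double/= ?doubleK ?uphalf_double.
Qed.

(** * Sums over Z and over Z x Z *)

Section sumZ.
Context (R : realType).
Local Open Scope ereal_scope.
Implicit Type f : int -> \bar R.

(** An [esum] involves no order of summation; [sumZ_series] passes to a series where theorems on
    series of functions are applied. *)
Definition sumZ f : \bar R := \esum_(n in [set: int]) f n.

Lemma sumZ_series f : (forall n, 0 <= f n) ->
  sumZ f = \sum_(i <oo) f (int_enum i).
Proof.
move=> f0; rewrite nneseries_esumT//; apply: reindex_esum.
have : bijective int_enum by exists int_index; [exact: int_enumK|exact: int_indexK].
by rewrite -setTT_bijective.
Qed.

Lemma eq_sumZ f1 f2 : f1 =1 f2 -> sumZ f1 = sumZ f2.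
Proof. by move=> h; apply: eq_esum => n _; exact: h. Qed.

Lemma le_sumZ f1 f2 : (forall n, f1 n <= f2 n) -> sumZ f1 <= sumZ f2.
Proof. by move=> h; apply: le_esum => n _; exact: h. Qed.

Lemma sumZ_ge0 f : (forall n, 0 <= f n) -> 0 <= sumZ f.
Proof. by move=> h; apply: esum_ge0 => n _; exact: h. Qed.

Lemma sumZD f1 f2 : (forall n, 0 <= f1 n) -> (forall n, 0 <= f2 n) ->
  sumZ (fun n => f1 n + f2 n) = sumZ f1 + sumZ f2.
Proof. by move=> h1 h2; apply: esumD => n _. Qed.

Lemma sumZZl (k : R) f : (0 <= k)%R -> (forall n, 0 <= f n) ->
  sumZ (fun n => k%:E * f n) = k%:E * sumZ f.
Proof.
move=> k0 f0; rewrite !sumZ_series//; last by move=> n; exact: mule_ge0.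
by rewrite nneseriesZl// => i _; exact: f0.
Qed.

Lemma sumZ0 f : (forall n, f n = 0) -> sumZ f = 0.
Proof. by move=> f0; apply: esum1 => n _. Qed.

Lemma sumZN f : sumZ (fun n => f (- n)%R) = sumZ f.
Proof.
by rewrite /sumZ [RHS](@reindex_esum _ _ _ setT setT (fun n => - n)%R) //.
Qed.

Lemma sumZ1 (v : \bar R) (m : int) : 0 <= v ->
  sumZ (fun n => if n == m then v else 0) = v.
Proof.
move=> v0; rewrite -[RHS](@esum_set1 _ _ m (fun=> v))// [RHS]esum_mkcond.
apply: eq_sumZ => n; have [->|/eqP nm] := eqVneq n m; first by rewrite mem_set.
by rewrite memNset.
Qed.

Section integral_sumZ.
Context d (T : measurableType d) (mu : {measure set T -> \bar R}) (D : set T).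
Hypothesis mD : measurable D.
Variable h : int -> T -> \bar R.
Hypotheses (mh : forall n, measurable_fun D (h n)) (h0 : forall n x, 0 <= h n x).

Lemma measurable_sumZ : measurable_fun D (fun x => sumZ (h ^~ x)).
Proof.
under eq_fun do rewrite sumZ_series//.
exact: ge0_emeasurable_sum.
Qed.

Lemma integral_sumZ :
  \int[mu]_(x in D) sumZ (h ^~ x) = sumZ (fun n => \int[mu]_(x in D) h n x).
Proof.
under eq_integral do rewrite sumZ_series//.
rewrite integral_nneseries// sumZ_series// => n.
exact: integral_ge0.
Qed.

End integral_sumZ.

End sumZ.

Section counting_plane.
Context (R : realType).
Local Open Scope ereal_scope.

Lemma counting_ZxZ_set1 (z : ZxZ) : counting_ZxZ R [set z] = 1.
Proof.
by rewrite /counting_ZxZ /counting asboolT ?fset_set1 ?finmap.cardfs1.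
Qed.

Lemma ge0_integral_counting_ZxZ (f : ZxZ -> \bar R) : (forall z, 0 <= f z) ->
  \int[counting_ZxZ R]_z f z = sumZ (fun n => sumZ (fun k => f (n, k))).
Proof.
move=> f0.
have mf (D : set ZxZ) : measurable_fun D f by [].
have TE : [set: ZxZ] = \bigcup_i [set z : ZxZ | z.1 = int_enum i].
  apply/seteqP; split => // -[n k] _; exists (int_index n) => //=.
  by rewrite int_indexK.
have iE i : [set z : ZxZ | z.1 = int_enum i] = \bigcup_j [set (int_enum i, int_enum j)
    : ZxZ].
  apply/seteqP; split => [[n k] /= ->|z [j _ ->]//].
  by exists (int_index k) => //=; rewrite int_indexK.
rewrite sumZ_series; last by move=> n; exact: sumZ_ge0.
rewrite TE ge0_integral_bigcup//; last first.
  move=> i j _ _ [[n k] [/= -> /(can_inj int_enumK)]]; exact.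
apply: eq_eseriesr => i _; rewrite sumZ_series// iE ge0_integral_bigcup//; last first.
  by move=> j k _ _ [z [/= -> [/(can_inj int_enumK)]]].
apply: eq_eseriesr => j _.
transitivity (\int[counting_ZxZ R]_(z in [set (int_enum i, int_enum j) : ZxZ])
    f (int_enum i, int_enum j)).
  by apply: eq_integral => z /set_mem /= ->.
rewrite integral_cst//.
by rewrite [X in _ * X = _](counting_ZxZ_set1 (int_enum i, int_enum j)) mule1.
Qed.

End counting_plane.

(** * Periodization and unfolding *)

Section unfolding.
Context (R : realType).
Local Notation RB := (measurableTypeR R).
Local Notation leb := (@lebesgue_measure R).
Local Open Scope ereal_scope.

Definition ibloc (a : int) (L : nat) : set RB := `[a%:~R, (a + L%:Z)%:~R[%classic.

Lemma measurable_ibloc a L : measurable (ibloc a L).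
Proof. exact: measurable_itv. Qed.

Lemma in_ibloc a L (x : R) : (x \in ibloc a L) = (a%:~R <= x < (a + L%:Z)%:~R)%R.
Proof.
by apply/idP/idP => [/set_mem|h]; [|apply/mem_set]; rewrite /ibloc /= in_itv.
Qed.

(** For given x, exactly L integers n bring x - n into a block of length L. The induction lengthens
    the block by one unit interval, which x - n meets for a single n. *)
Lemma sumZ_ibloc (v : \bar R) (a : int) (L : nat) (x : R) : 0 <= v ->
  sumZ (fun n => v * (\1_(ibloc a L) (x - n%:~R)%R)%:E) = L%:R%:E * v.
Proof.
move=> v0; elim: L => [|L ih].
  rewrite mul0e; apply: sumZ0 => n.
  by rewrite indicE in_ibloc addr0 leNgt andbC; case: ltP => //=; rewrite mule0.
rewrite -natr1 EFinD ge0_muleDl// mul1e -ih.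
rewrite -[X in _ + X](@sumZ1 _ _ (Num.floor x - (a + L%:Z))%R v0) -sumZD//; last 2 first.
- by move=> n; rewrite mule_ge0// lee_fin.
- by move=> n; case: ifP.
apply: eq_sumZ => n; rewrite !indicE !in_ibloc.
have -> : (n == Num.floor x - (a + L%:Z))%R = ((a + L%:Z)%:~R <= x - n%:~R < (a +
    L.+1%:Z)%:~R)%R.
  rewrite lerBrDl -intrD ltrBlDl -intrD.
  rewrite -floor_ge_int -floor_lt_int.
  by move: (Num.floor x) => z; apply/eqP/andP => [->|[]]; lia.
have aL : ((a + L.+1%:Z)%:~R = (a + L%:Z)%:~R + 1 :> R)%R.
  by rewrite -[L.+1]addn1 PoszD addrA [LHS]intrD.
rewrite aL; set w := (x - n%:~R)%R.
have aL0 : (a%:~R <= (a + L%:Z)%:~R :> R)%R by rewrite ler_int lerDl.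
case: (leP a%:~R w) => h1; case: (ltP w (a + L%:Z)%:~R) => h2 /=;
    rewrite ?mule1 ?mule0 ?add0e ?adde0//.
- by rewrite (lt_trans h2) ?ltrDl// mule1.
- by case: (w < _)%R; rewrite ?mule1 ?mule0.
- by have := le_lt_trans (le_trans aL0 h2) h1; rewrite ltxx.
Qed.

Lemma measurable_affine_comp c b (F : RB -> \bar R) : measurable_fun setT F ->
  measurable_fun [set: RB] (fun t : RB => F (c * t - b)%R).
Proof.
move=> mF; apply: (measurableT_comp mF).
by apply: measurable_funB => //; exact: measurable_funM.
Qed.

Lemma integral_indicr (A : set RB) (f : RB -> \bar R) : measurable A ->
  \int[leb]_(x in A) f x = \int[leb]_x (f x * (\1_A x)%:E).
Proof.
move=> mA; rewrite [LHS]integral_mkcond; apply: eq_integral => x _.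
by rewrite patchE indicE; case: (_ \in A); rewrite ?mule1 ?mule0.
Qed.

Lemma measurable_EFin_indic (A : set RB) : measurable A ->
  measurable_fun [set: RB] (fun x => (\1_A x)%:E : \bar R).
Proof. by move=> mA; apply/measurable_EFinP; exact: measurable_indic. Qed.

(** The translates of the block by Z cover every point L times. *)
Lemma integral_periodization (f : RB -> \bar R) (a : int) (L : nat) :
  measurable_fun setT f -> (forall x, 0 <= f x) ->
  sumZ (fun n => \int[leb]_(x in ibloc a L) f (x + n%:~R)%R) =
  L%:R%:E * \int[leb]_x f x.
Proof.
move=> mf f0.
have mbl := measurable_ibloc a L.
have mg n : measurable_fun [set: RB] (fun x => f x * (\1_(ibloc a L) (x - n%:~R)%R)%:E).
  apply: emeasurable_funM => //.
  have := @measurable_affine_comp 1 n%:~R _ (measurable_EFin_indic mbl).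
  by under eq_fun do rewrite mul1r.
have g0 n x : 0 <= f x * (\1_(ibloc a L) (x - n%:~R)%R)%:E.
  by rewrite mule_ge0// lee_fin.
transitivity (sumZ (fun n => \int[leb]_x (f x * (\1_(ibloc a L) (x - n%:~R)%R)%:E))).
  apply: eq_sumZ => n; rewrite integral_indicr//.
  have := @ge0_integral_affine R 1 (- n%:~R) _ ltr01 (mg n) (g0 n).
  rewrite invr1 mul1e => <-; apply: eq_integral => x _.
  by rewrite mul1r opprK addrK.
rewrite -integral_sumZ//.
under eq_integral do rewrite sumZ_ibloc//.
by rewrite ge0_integralZl_EFin.
Qed.

(** The substitution x = L u maps the unit window onto a block of length L, whose integer translates
    cover the line L times; the Jacobian 1/L compensates. With a factor that is not an integer the
    cover would be uneven. *)
Lemma integral_dilated_periodization (f : RB -> \bar R) (L : nat) : (0 < L)%N ->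
  measurable_fun setT f -> (forall x, 0 <= f x) ->
  \int[leb]_(u in ibloc (- 2%:Z) 1) sumZ (fun k => f (k%:~R + L%:R * u)%R) =
  \int[leb]_x f x.
Proof.
move=> L0 mf f0.
have mb := measurable_ibloc (- 2%:Z) 1.
have L0' : (0 < L%:R :> R)%R by rewrite ltr0n.
have mfk k : measurable_fun [set: RB] (fun u => f (k%:~R + L%:R * u)%R).
  have := @measurable_affine_comp L%:R (- k%:~R) _ mf.
  by under eq_fun do rewrite opprK addrC.
rewrite integral_sumZ//; last by move=> k; exact: measurable_funTS.
have -> : \int[leb]_x f x = L%:R^-1%:E * (L%:R%:E * \int[leb]_x f x).
  by rewrite muleA -EFinM mulVf ?mul1e// gt_eqF.
rewrite -(@integral_periodization f (- (2 * L)%:Z) L)// -sumZZl ?invr_ge0//; last first.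
- by move=> n; exact: integral_ge0.
have mbL := measurable_ibloc (- (2 * L)%:Z) L.
apply: eq_sumZ => k; rewrite (integral_indicr _ mb) (integral_indicr _ mbL).
have mk : measurable_fun [set: RB] (fun x => f (x + k%:~R)%R).
  have := @measurable_affine_comp 1 (- k%:~R) _ mf.
  by under eq_fun do rewrite mul1r opprK.
rewrite -(@ge0_integral_affine R L%:R 0 (fun x => f (x + k%:~R)%R * (\1_(ibloc (- (2 *
    L)%:Z) L) x)%:E))//.
- apply: eq_integral => u _; rewrite subr0 addrC; congr (_ * (_)%:E).
  rewrite !indicE !in_ibloc; congr ((_ : bool)%:R)%R.
  have -> : ((- (2 * L)%:Z + L%:Z)%:~R = L%:R * (- 2%:Z + 1%:Z)%:~R :> R)%R.
    by rewrite !intrD !rmorphN/= PoszM intrM; ring.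
  have -> : ((- (2 * L)%:Z)%:~R = L%:R * (- 2%:Z)%:~R :> R)%R.
    by rewrite !rmorphN/= PoszM intrM; ring.
  by rewrite ler_pM2l// ltr_pM2l.
- by apply: emeasurable_funM => //; exact: measurable_EFin_indic mbL.
- by move=> t; rewrite mule_ge0// lee_fin.
Qed.


Lemma measurable_itv_section (G : RB * RB -> \bar R) a L :
  measurable_fun setT G -> (forall z, 0 <= G z) ->
  measurable_fun setT (fun s => \int[leb]_(u in ibloc a L) G (s, u)).
Proof.
move=> mG G0; have mb := measurable_ibloc a L.
have mG1 : measurable_fun setT (fun z : RB * RB => G z * (\1_(ibloc a L) z.2)%:E).
  apply: emeasurable_funM => //.
  by apply: (measurableT_comp (measurable_EFin_indic mb)).
have := @measurable_fun_fubini_tonelli_F _ _ RB RB R leb _ mG1.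
rewrite /fubini_F /=; under [X in _ ->
    measurable_fun _ X]eq_fun do rewrite (integral_indicr _ mb).
by apply => z; rewrite mule_ge0// lee_fin.
Qed.

Lemma integral_unit_cst (a : int) (k : \bar R) : \int[leb]_(s in ibloc a 1) k = k.
Proof.
rewrite integral_cst; last exact: measurable_ibloc.
rewrite [X in _ * X](_ : _ = 1) ?mule1//.
rewrite /ibloc [LHS](lebesgue_measure_itv `[_, _[) /= lte_fin intrD ltrDl ltr01.
by rewrite -EFinB addrAC subrr add0r.
Qed.

Definition lattice_sum (N : nat) (F : RB * RB -> \bar R) (z : RB * RB) : \bar R :=
  sumZ (fun n => sumZ (fun k =>
    F (n%:~R + z.1, k%:~R + 2 `^ (n%:~R + N%:R) * z.2)%R)).

(* The window [-2, -1[ for u stays away from 0, which keeps the scales n < -N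
   under control in lattice_mean_tail; its length 1 makes the scales n >= -N
   tile the plane exactly, since 2^(n+N) is then a positive integer. *)
Definition lattice_mean (N : nat) (F : RB * RB -> \bar R) : \bar R :=
  \int[leb]_(s in ibloc 0 1) \int[leb]_(u in ibloc (- 2%:Z) 1)
    lattice_sum N F (s, u).

Lemma measurable_lattice_map (x c d : R) :
  measurable_fun [set: RB * RB] (fun z : RB * RB => ((x + z.1)%R : RB, (c + d *
      z.2)%R : RB)).
Proof.
apply: measurable_fun_pair.
  by apply: measurable_funD.
by apply: measurable_funD => //; apply: measurable_funM.
Qed.

Section lattice_mean.
Variable N : nat.
Implicit Type F : RB * RB -> \bar R.

Lemma lattice_sum_ge0 F z : (forall z, 0 <= F z) -> 0 <= lattice_sum N F z.
Proof. by move=> F0; apply: sumZ_ge0 => n; apply: sumZ_ge0. Qed.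

Lemma measurable_lattice_sum F : measurable_fun setT F -> (forall z, 0 <= F z) ->
  measurable_fun setT (lattice_sum N F).
Proof.
move=> mF F0; apply: measurable_sumZ => // [n|n z]; last exact: sumZ_ge0.
apply: measurable_sumZ => // k.
exact: (measurableT_comp mF (measurable_lattice_map _ _ _)).
Qed.

Lemma lattice_meanD F G : measurable_fun setT F -> measurable_fun setT G ->
  (forall z, 0 <= F z) -> (forall z, 0 <= G z) ->
  lattice_mean N (fun z => F z + G z) = lattice_mean N F + lattice_mean N G.
Proof.
move=> mF mG F0 G0; have mb a := measurable_ibloc a 1.
have mFs s : measurable_fun setT (fun u => lattice_sum N F (s, u)).
  exact: (measurableT_comp (measurable_lattice_sum mF F0) (measurable_pair1 s)).
have mGs s : measurable_fun setT (fun u => lattice_sum N G (s, u)).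
  exact: (measurableT_comp (measurable_lattice_sum mG G0) (measurable_pair1 s)).
rewrite /lattice_mean -ge0_integralD//; last 4 first.
- by move=> s _; apply: integral_ge0 => u _; exact: lattice_sum_ge0.
- apply: measurable_funTS; apply: measurable_itv_section.
    exact: measurable_lattice_sum.
  by move=> z; exact: lattice_sum_ge0.
- by move=> s _; apply: integral_ge0 => u _; exact: lattice_sum_ge0.
- apply: measurable_funTS; apply: measurable_itv_section.
    exact: measurable_lattice_sum.
  by move=> z; exact: lattice_sum_ge0.
apply: eq_integral => s _; rewrite -ge0_integralD//; last 4 first.
- by move=> u _; exact: lattice_sum_ge0.
- exact: measurable_funTS.
- by move=> u _; exact: lattice_sum_ge0.
- exact: measurable_funTS.
apply: eq_integral => u _; rewrite /lattice_sum -sumZD.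
- by apply: eq_sumZ => n; rewrite sumZD.
- by move=> n; exact: sumZ_ge0.
- by move=> n; exact: sumZ_ge0.
Qed.

Lemma lattice_mean_le F (K : \bar R) : measurable_fun setT F ->
  (forall z, 0 <= F z) -> (forall z, lattice_sum N F z <= K) ->
  lattice_mean N F <= K.
Proof.
move=> mF F0 FK; have mb a := measurable_ibloc a 1.
have K0 : 0 <= K by apply: le_trans (FK (0, 0)%R); exact: lattice_sum_ge0.
have mFs s : measurable_fun setT (fun u => lattice_sum N F (s, u)).
  exact: (measurableT_comp (measurable_lattice_sum mF F0) (measurable_pair1 s)).
rewrite -[leRHS](integral_unit_cst 0); apply: ge0_le_integral => //.
- by move=> s _; apply: integral_ge0 => u _; exact: lattice_sum_ge0.
- apply: measurable_funTS; apply: measurable_itv_section.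
    exact: measurable_lattice_sum.
  by move=> z; exact: lattice_sum_ge0.
move=> s _; rewrite -[leRHS](integral_unit_cst (- 2%:Z)); apply: ge0_le_integral => //.
- by move=> u _; exact: lattice_sum_ge0.
- exact: measurable_funTS.
Qed.

(** The integer n and s in [0, 1[ together parametrize a. For n >= -N,
    [integral_dilated_periodization] with factor 2^(n+N) recovers the integral over b; the other n
    contribute 0 on both sides. *)
Lemma lattice_mean_unfold F : measurable_fun setT F -> (forall z, 0 <= F z) ->
  (forall a b, (a < - N%:R)%R -> F (a, b) = 0) ->
  lattice_mean N F = \int[leb \x leb]_z F z.
Proof.
move=> mF F0 FN; have mb a := measurable_ibloc a 1.
have mFs a : measurable_fun setT (fun b => F (a, b)).
  exact: (measurableT_comp mF (measurable_pair1 a)).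
pose H a := \int[leb]_b F (a, b).
have mH : measurable_fun setT H by exact: measurable_fun_fubini_tonelli_F.
have H0 a : 0 <= H a by exact: integral_ge0.
rewrite (@fubini_tonelli1 _ _ RB RB R leb leb _ mF F0) -[LHS]/(lattice_mean N F).
have := @integral_periodization H 0 1 mH H0; rewrite mul1e => <-.
rewrite -integral_sumZ//; last first.
  move=> n; have := @measurable_affine_comp 1 (- n%:~R) _ mH.
  by under eq_fun do rewrite mul1r opprK; exact: measurable_funTS.
apply: eq_integral => s /set_mem; rewrite /ibloc /= in_itv /= => /andP[s0 s1].
have mlk n k : measurable_fun setT (fun u : RB => F (n%:~R + s, k%:~R + 2 `^ (n%:~R +
    N%:R) * u)%R).
  apply: (measurableT_comp (mFs (n%:~R + s)%R)).
  by apply: measurable_funD => //; apply: measurable_funM.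
rewrite /lattice_sum integral_sumZ//; last 2 first.
- by move=> n; apply: measurable_funTS; apply: measurable_sumZ.
- by move=> n u; exact: sumZ_ge0.
apply: eq_sumZ => n; rewrite /= [(s + _)%R]addrC /H.
have [nN|nN] := ltP n (- N%:Z)%R.
  (* Integrality gives n + 1 <= -N, and s < 1, so n + s is still strictly below -N. *)
  have a0 : (n%:~R + s < - N%:R :> R)%R.
    have : (n + 1 <= - N%:Z)%R by rewrite lezD1.
    by rewrite -(ler_int R) intrD rmorphN/=; lra.
  rewrite !integral0_eq// => [u _|u _]; first exact: FN.
  by apply: sumZ0 => k; exact: FN.
have [m nm] : exists m : nat, (n + N%:Z)%R = m%:Z.
  by exists (absz (n + N%:Z)%R); lia.
have e2 : (2 `^ (n%:~R + N%:R) = (2 ^ m)%:R :> R)%R.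
  by rewrite (_ : n%:~R + N%:R = m%:R)%R ?powR_mulrn// ?natrX// -[in RHS]/(m%:Z%:~R)%R -nm intrD.
have := @integral_dilated_periodization (fun b => F (n%:~R + s, b)%R) (2 ^ m).
by rewrite expn_gt0 -e2 => ->.
Qed.

End lattice_mean.

Definition indic_ball (r x : R) : \bar R := (\1_(`[- r, r]%classic : set RB) x)%:E.

Lemma indic_ballE r x : indic_ball r x = ((`|x| <= r)%R%:R)%:E.
Proof.
rewrite /indic_ball indicE; congr ((_ : bool)%:R%:E).
by rewrite ler_norml; apply/idP/idP => [/set_mem|h]; [|apply/mem_set]; rewrite /= in_itv.
Qed.

Lemma indic_ball_ge0 r x : 0 <= indic_ball r x.
Proof. by rewrite lee_fin. Qed.

Lemma le_indic_ball r r' x : (r <= r')%R -> indic_ball r x <= indic_ball r' x.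
Proof.
move=> rr'; rewrite !indic_ballE lee_fin ler_nat.
by case: (leP `|x|%R r) => // xr; rewrite (le_trans xr rr').
Qed.

Lemma measurable_indic_ball r : measurable_fun [set: RB] (indic_ball r).
Proof. exact: measurable_EFin_indic. Qed.

(** If u is in [-2, -1[ and |w + d u| <= d e <= d/2, then d/2 < w <= 5d/2; the cruder bound 4d is d
    times a power of two, which suits [dyadic_overlap]. For fixed w the admissible u lie in an
    interval of length 2e. *)
Lemma integral_window_ball (w d e : R) : (0 < d)%R -> (0 <= e)%R -> (e <= 2^-1)%R ->
  \int[leb]_(u in ibloc (- 2%:Z) 1) indic_ball (d * e) (w + d * u)%R <=
  (2 * e)%:E * ((d / 2 <= w < 4 * d)%R%:R)%:E.
Proof.
move=> d0 e0 e2; have mb := measurable_ibloc (- 2%:Z) 1.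
have [h|h] := boolP (d / 2 <= w < 4 * d)%R.
  rewrite mule1.
  have mi := measurable_indic_ball e.
  have -> : (2 * e)%:E = \int[leb]_x indic_ball e x.
    rewrite /indic_ball integral_indic// setIT.
    rewrite [RHS](lebesgue_measure_itv `[(- e)%R, e]) /= lte_fin.
    case: ltP => h1; last by congr EFin; lra.
    by rewrite -EFinB; congr EFin; lra.
  have := @ge0_integral_affine R 1 (- (w / d)) _ ltr01 mi (indic_ball_ge0 e).
  rewrite invr1 mul1e => <-.
  under eq_integral => u _.
    have -> : (w + d * u = d * (1 * u - - (w / d)))%R.
      by rewrite mul1r opprK mulrDr mulrCA mulfV ?gt_eqF// mulr1 addrC.
    have -> : indic_ball (d * e) (d * (1 * u - - (w / d)))%R = indic_ball e (1 *
        u - - (w / d))%R.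
      by rewrite !indic_ballE normrM (gtr0_norm d0) ler_pM2l.
    over.
  apply: ge0_subset_integral => //; last by move=> u _; exact: indic_ball_ge0.
  exact: measurable_affine_comp.
rewrite mule0 integral0_eq// => u; rewrite /ibloc /= in_itv /= => /andP[u2 u1].
rewrite indic_ballE; case: (leP `|_|%R) => // wde; move: h; rewrite negb_and -ltNge.
have : (d * e <= d / 2)%R by rewrite ler_pM2l.
have : (- 2 * d <= d * u)%R.
  by rewrite mulrC ler_pM2l// (le_trans _ u2)// rmorphN.
have : (d * u < - d)%R.
  rewrite -mulrN1 ltr_pM2l// (lt_le_trans u1)//.
move: wde; rewrite ler_norml => /andP[w1 w2] du1 du2 de hh; exfalso.
by move: hh; rewrite -leNgt => /orP[]; lra.
Qed.

(** Here n + M <= -1, so that 4 * 2^(n+M) <= 2. *)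
Lemma dyadic_support (M n : int) (w : R) : (n < - M)%R ->
  (2 `^ (n + M)%:~R / 2 <= w < 4 * 2 `^ (n + M)%:~R)%R -> (0 < w < 2)%R.
Proof.
move=> nM /andP[h1 h2]; apply/andP; split.
  by rewrite (lt_le_trans _ h1)// divr_gt0// powR_gt0.
have e2 : (4 * 2 `^ (- 1%:Z)%:~R = 2 :> R)%R.
  by rewrite rmorphN/= powRN powRr1//; field.
rewrite (lt_le_trans h2)// -[X in (_ <= X)%R]e2.
by rewrite ler_pM2l// ler_powR ?ler1n// ler_int; lia.
Qed.

(** With m = n + M the interval is [2^(m-1), 2^(m+2)[, so it contains w exactly for m = e - 1, e, e
    + 1, where e is the floor of log_2 w. *)
Lemma dyadic_overlap (M : int) (w : R) :
  sumZ (fun n => if (n < - M)%R then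
      ((2 `^ (n + M)%:~R / 2 <= w < 4 * 2 `^ (n + M)%:~R)%R%:R)%:E else 0) <=
  3%:E * (\1_(ibloc 0 2) w)%:E :> \bar R.
Proof.
have two : (2 = 2 `^ 1 :> R)%R by rewrite powRr1.
have [/andP[w0 w2]|w02] := boolP (0 < w < 2)%R; last first.
  rewrite sumZ0 ?mule_ge0 ?lee_fin// => n; case: ifP => // nM.
  by have [/(dyadic_support nM)|//] := boolP (_ <= w < _)%R; rewrite (negbTE w02).
rewrite indicE in_ibloc (ltW w0) w2 mule1.
pose e := Num.floor (ln w / ln 2 : R).
have ln2 : (0 < ln 2 :> R)%R by rewrite ln_gt0// ltr1n.
have le_log (x : R) : (2 `^ x <= w)%R = (x <= ln w / ln 2)%R.
  by rewrite -[LHS]ler_ln ?posrE ?powR_gt0// ln_powR ler_pdivlMr.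
apply: (@le_trans _ _ (sumZ (fun n => ((if n == (e - M - 1)%R then 1 else 0) +
   (if n == (e - M)%R then 1 else 0)) + (if n == (e - M + 1)%R then 1 else 0)
       : \bar R))); last first.
  have d0 m : forall n : int, 0 <= (if n == m then 1 else 0) :> \bar R by move=> n;
      case: ifP.
  rewrite sumZD => [|n|//]; last by rewrite adde_ge0.
  by rewrite sumZD// !sumZ1// -!EFinD lee_fin; lra.
apply: le_sumZ => n.
have d0 (m m' : int) : 0 <= (if m == m' then 1 else 0) :> \bar R by case: ifP.
have r0 : 0 <= ((if n == (e - M - 1)%R then 1 else 0) +
   (if n == (e - M)%R then 1 else 0)) + (if n == (e - M + 1)%R then 1 else 0) :> \bar R.
  by rewrite !adde_ge0.
case: ifP => // _.
have -> : (2 `^ (n + M)%:~R / 2 = 2 `^ (n + M - 1)%:~R :> R)%R.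
  by rewrite [in RHS]intrD powRD ?pnatr_eq0 ?implybT// rmorphN/= powRN powRr1.
have -> : (4 * 2 `^ (n + M)%:~R = 2 `^ (n + M + 2)%:~R :> R)%R.
  rewrite [in RHS]intrD powRD ?pnatr_eq0 ?implybT// mulrC; congr (_ * _)%R.
  by rewrite -[2%:~R]/(2%:R)%R powR_mulrn//; ring.
rewrite ltNge !le_log -!floor_ge_int -/e.
case: (boolP (_ && _)) => // /andP[h1 h2].
have : [|| n == e - M - 1, n == e - M | n == e - M + 1]%R by lia.
case/or3P => /eqP nE; rewrite {1 2 3}nE eqxx -[leLHS]/(1%E).
- by rewrite -addeA leeDl// adde_ge0.
- by rewrite -addeA addeCA leeDl// adde_ge0.
- by rewrite leeDr// adde_ge0.
Qed.

(** * The contribution of the scales below -N *)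

Section lattice_tail.
Variables (N : nat) (F : RB * RB -> \bar R) (theta : RB -> \bar R) (K L : R).
Hypotheses (mF : measurable_fun setT F) (F0 : forall z, 0 <= F z).
Hypotheses (mtheta : measurable_fun setT theta) (theta0 : forall v, 0 <= theta v).
Hypotheses (K0 : (0 <= K)%R) (L0 : (0 <= L)%R).
Hypothesis F_le : forall a b, F (a, b) <= if (a < - N%:R)%R then
  K%:E * \int[leb]_v (theta v * indic_ball (2 `^ a * L) (v + b)%R) else 0.

(** For a = n + s with s < 1, the radius 2^a L is at most 2^(n+1) L = 2^(n+N) e. *)
Let e : R := (2 * L / 2 ^+ N)%R.
Hypothesis e2 : (e <= 2^-1)%R.
Let eta (w : RB) : \bar R := sumZ (fun k => theta (w - k%:~R)%R).

Let e0 : (0 <= e)%R.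
Proof. by rewrite !mulr_ge0// invr_ge0 exprn_ge0. Qed.

Let eta0 w : 0 <= eta w.
Proof. exact: sumZ_ge0. Qed.

Let mtk k : measurable_fun [set: RB] (fun w : RB => theta (w - k%:~R)%R).
Proof.
have := @measurable_affine_comp 1 k%:~R _ mtheta.
by under eq_fun do rewrite mul1r.
Qed.

Let meta : measurable_fun setT eta.
Proof. exact: measurable_sumZ. Qed.

Let mball d u r : measurable_fun [set: RB] (fun w : RB => indic_ball r (w + d * u)%R).
Proof.
have := @measurable_affine_comp 1 (- (d * u)) _ (measurable_indic_ball r).
by under eq_fun do rewrite mul1r opprK.
Qed.

(** The substitution v = w - k moves the integer shift from the ball to theta; summing over k then
    turns theta into its periodization. *)
Let translate_sum (s u : R) (n : int) : (0 <= s < 1)%R -> (n < - N%:Z)%R ->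
  sumZ (fun k => F (n%:~R + s, k%:~R + 2 `^ (n%:~R + N%:R) * u)%R) <=
  K%:E * \int[leb]_w (eta w *
    indic_ball (2 `^ (n + N%:Z)%:~R * e) (w + 2 `^ (n + N%:Z)%:~R * u)%R).
Proof.
move=> /andP[s0 s1] nN; set d := (2 `^ (n + N%:Z)%:~R : R)%R.
have dE : (2 `^ (n%:~R + N%:R) = d :> R)%R by rewrite /d intrD.
rewrite dE; have d0 : (0 < d)%R by rewrite powR_gt0.
have a0 : (n%:~R + s < - N%:R :> R)%R.
  have : (n + 1 <= - N%:Z)%R by rewrite lezD1.
  by rewrite -(ler_int R) intrD rmorphN/=; lra.
have rE : (2 `^ (n%:~R + s) * L <= d * e)%R.
  rewrite (@le_trans _ _ (2 `^ (n%:~R + 1) * L)%R)// ?ler_wpM2r// ?ler_powR ?ler1n//;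
      first lra.
  rewrite /d /e intrD !powRD ?pnatr_eq0 ?implybT// powRr1// powR_mulrn//.
  rewrite le_eqVlt; apply/orP; left; apply/eqP; field.
  by rewrite expf_neq0// pnatr_eq0.
apply: (@le_trans _ _ (sumZ (fun k => K%:E * \int[leb]_w (theta (w - k%:~R)%R *
    indic_ball (d * e) (w + d * u)%R)))).
  apply: le_sumZ => k; apply: (le_trans (F_le _ _)); rewrite a0.
  apply: lee_wpmul2l; first by rewrite lee_fin.
  have mg : measurable_fun setT (fun v => theta v * indic_ball (d * e) (v + (k%:~R +
      d * u))%R).
    by apply: emeasurable_funM => //; have := @mball 1 (k%:~R + d * u)%R (d * e)%R;
        under eq_fun do rewrite mul1r.
  have g0 v : 0 <= theta v * indic_ball (d * e) (v + (k%:~R + d * u))%R.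
    by rewrite mule_ge0// indic_ball_ge0.
  apply: (@le_trans _ _ (\int[leb]_v (theta v * indic_ball (d * e) (v + (k%:~R + d *
      u))%R))).
    apply: ge0_le_integral => //.
    - by move=> v _; rewrite mule_ge0// indic_ball_ge0.
    - by apply: emeasurable_funM => //; have := @mball 1 (k%:~R + d *
        u)%R (2 `^ (n%:~R + s) * L)%R; under eq_fun do rewrite mul1r.
    - by move=> v _; apply: lee_wpmul2l => //; exact: le_indic_ball.
  have := @ge0_integral_affine R 1 k%:~R _ ltr01 mg g0.
  rewrite invr1 mul1e => <-; rewrite le_eqVlt; apply/orP; left; apply/eqP.
  by apply: eq_integral => w _; rewrite mul1r addrA subrK.
rewrite sumZZl//; last by move=> k; apply: integral_ge0 => w _;
    rewrite mule_ge0// indic_ball_ge0.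
apply: lee_wpmul2l; first by rewrite lee_fin.
rewrite -integral_sumZ//; last 2 first.
- by move=> k; apply: emeasurable_funM.
- by move=> k w; rewrite mule_ge0// indic_ball_ge0.
rewrite le_eqVlt; apply/orP; left; apply/eqP; apply: eq_integral => w _.
rewrite /eta /indic_ball muleC -sumZZl//.
by apply: eq_sumZ => k; rewrite muleC.
Qed.

Let mwindow d : measurable_fun [set: RB] (fun u : RB =>
  \int[leb]_w (eta w * indic_ball (d * e) (w + d * u)%R)).
Proof.
have mk2 : measurable_fun setT (fun z : RB * RB => eta z.2 * indic_ball (d * e) (z.2 +
    d * z.1)%R).
  apply: emeasurable_funM; first exact: (measurableT_comp meta).
  apply: (measurableT_comp (measurable_indic_ball _)).
  by apply: measurable_funD => //; apply: measurable_funM.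
have := @measurable_fun_fubini_tonelli_F _ _ RB RB R leb _ mk2; apply => z.
by rewrite mule_ge0// indic_ball_ge0.
Qed.

(** Tonelli exchanges u and w, and the inner integral over u is the one of
    [integral_window_ball]. *)
Let window_mean (d : R) : (0 < d)%R ->
  \int[leb]_(u in ibloc (- 2%:Z) 1) \int[leb]_w (eta w * indic_ball (d * e) (w + d *
      u)%R) <=
  (2 * e)%:E * \int[leb]_w (eta w * ((d / 2 <= w < 4 * d)%R%:R)%:E).
Proof.
move=> d0; have mb := measurable_ibloc (- 2%:Z) 1.
have mk2 : measurable_fun setT (fun z : RB * RB => eta z.2 * indic_ball (d * e) (z.2 +
    d * z.1)%R * (\1_(ibloc (- 2%:Z) 1) z.1)%:E).
  apply: emeasurable_funM; last exact: (measurableT_comp (measurable_EFin_indic mb)).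
  apply: emeasurable_funM; first exact: (measurableT_comp meta).
  apply: (measurableT_comp (measurable_indic_ball _)).
  by apply: measurable_funD => //; apply: measurable_funM.
have k20 (z : RB * RB) : 0 <= eta z.2 * indic_ball (d * e) (z.2 + d * z.1)%R *
    (\1_(ibloc (- 2%:Z) 1) z.1)%:E.
  by rewrite !mule_ge0// ?indic_ball_ge0// lee_fin.
have mballu w : measurable_fun [set: RB] (fun u : RB => indic_ball (d * e) (w + d * u)%R).
  apply: (measurableT_comp (measurable_indic_ball _)).
  by apply: measurable_funD => //; apply: measurable_funM.
have mchi : measurable_fun setT (fun w : RB => ((d / 2 <= w < 4 * d)%R%:R)%:E : \bar R).
  have := measurable_EFin_indic (measurable_itv `[(d / 2)%R, (4 * d)%R[).
  apply: eq_measurable_fun => w _; rewrite indicE; congr ((_ : bool)%:R%:E).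
  by apply/idP/idP => [/set_mem|h]; [|apply/mem_set]; rewrite /= in_itv.
have -> : \int[leb]_(u in ibloc (- 2%:Z) 1) \int[leb]_w (eta w * indic_ball (d * e)
    (w + d * u)%R) =
    \int[leb]_u \int[leb]_w (eta w * indic_ball (d * e) (w + d * u)%R *
        (\1_(ibloc (- 2%:Z) 1) u)%:E).
  rewrite (integral_indicr _ mb); apply: eq_integral => u _.
  rewrite muleC -ge0_integralZl//.
  - by apply: eq_integral => w _; rewrite muleC.
  - by apply: emeasurable_funM.
  - by move=> w _; rewrite mule_ge0// indic_ball_ge0.
rewrite [leLHS](@fubini_tonelli _ _ RB RB R leb leb _ mk2 k20).
rewrite -ge0_integralZl//; last 3 first.
- by apply: emeasurable_funM.
- by move=> w _; rewrite mule_ge0// lee_fin.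
- by rewrite lee_fin mulr_ge0.
apply: ge0_le_integral => //.
- by move=> w _; apply: integral_ge0 => u _.
- have := @measurable_fun_fubini_tonelli_G _ _ RB RB R leb _ mk2; exact.
- apply: emeasurable_funM => //; exact: emeasurable_funM.
move=> w _ /=; rewrite muleCA.
apply: le_trans (lee_wpmul2l (eta0 w) (integral_window_ball w d0 e0 e2)).
rewrite (integral_indicr _ mb) -ge0_integralZl//.
- rewrite le_eqVlt; apply/orP; left; apply/eqP.
  by apply: eq_integral => u _; rewrite muleA.
- by apply: emeasurable_funM => //; exact: measurable_EFin_indic.
- by move=> u _; rewrite mule_ge0 ?indic_ball_ge0// lee_fin.
Qed.

(* For n < -N put d = 2^(n+N).  After summing over k, the bound for F involves
   theta only through its periodization eta, and averaging over u gives
   2 e times the integral of eta over [d/2, 4d[; these intervals lie in [0, 2[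
   and overlap at most three times. *)
Lemma lattice_mean_tail :
  lattice_mean N F <= (12 * K * e)%:E * \int[leb]_v theta v.
Proof.
have mb := measurable_ibloc (- 2%:Z) 1.
have mb2 := measurable_ibloc 0 2.
set I := \int[leb]_v theta v.
have I0 : 0 <= I by exact: integral_ge0.
pose d (n : int) : R := (2 `^ (n + N%:Z)%:~R)%R.
have d0 n : (0 < d n)%R by rewrite powR_gt0.
pose chi (n : int) (w : R) : \bar R := if (n < - N%:Z)%R then ((d n / 2 <= w < 4 *
    d n)%R%:R)%:E else 0.
have chi0 n w : 0 <= chi n w by rewrite /chi; case: ifP => //; rewrite lee_fin.
have mchi n : measurable_fun [set: RB] (chi n).
  rewrite /chi; have [nN|nN] := boolP (n < - N%:Z)%R; last exact: measurable_cst.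
  have := measurable_EFin_indic (measurable_itv `[(d n / 2)%R, (4 * d n)%R[).
  apply: eq_measurable_fun => w _; rewrite indicE; congr ((_ : bool)%:R%:E).
  by apply/idP/idP => [/set_mem|h]; [|apply/mem_set]; rewrite /= in_itv.
have etaI : \int[leb]_w (eta w * (\1_(ibloc 0 2) w)%:E) = 2%:E * I.
  rewrite -integral_indicr// /eta integral_sumZ//; last first.
    by move=> k; exact: measurable_funTS.
  rewrite -(@integral_periodization theta 0 2)// -sumZN.
  apply: eq_sumZ => k; apply: eq_integral => w _.
  by rewrite rmorphN opprK.
have slice s : (0 <= s < 1)%R ->
    \int[leb]_(u in ibloc (- 2%:Z) 1) lattice_sum N F (s, u) <= (12 * K * e)%:E * I.
  move=> s01; rewrite /lattice_sum.
  have ms n k : measurable_fun (ibloc (- 2%:Z) 1) (fun u : RB => F (n%:~R + s, k%:~R +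
      2 `^ (n%:~R + N%:R) * u)%R).
    apply: measurable_funTS.
    exact: (measurableT_comp mF (measurableT_comp (measurable_lattice_map _ _ _)
        (measurable_pair1 s))).
  have mss n : measurable_fun (ibloc (- 2%:Z) 1) (fun u : RB => sumZ (fun k =>
      F (n%:~R + s, k%:~R + 2 `^ (n%:~R + N%:R) * u)%R)).
    exact: measurable_sumZ.
  rewrite integral_sumZ//; last by move=> n u; exact: sumZ_ge0.
  apply: (@le_trans _ _ (sumZ (fun n => (K * (2 * e))%:E * \int[leb]_w (eta w * chi n w)))).
    apply: le_sumZ => n; rewrite /chi; have [nN|nN] := boolP (n < - N%:Z)%R; last first.
      rewrite integral0_eq; last first.
        move=> u _; apply: sumZ0 => k; apply/eqP; rewrite eq_le F0 andbT.
        rewrite (le_trans (F_le _ _))// ifF//; apply/negbTE; rewrite -leNgt/=.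
        move: nN; rewrite -leNgt -(ler_int R) rmorphN/= => nN.
        by rewrite (le_trans nN)// lerDl; case/andP: s01.
      rewrite mule_ge0//; first by rewrite lee_fin !mulr_ge0.
      by apply: integral_ge0 => w _; rewrite mule0.
    apply: (@le_trans _ _ (\int[leb]_(u in ibloc (- 2%:Z) 1) (K%:E * \int[leb]_w (eta w *
       indic_ball (d n * e) (w + d n * u)%R)))).
      apply: ge0_le_integral => //.
      - by move=> u _; exact: sumZ_ge0.
      - by apply: measurable_funTS; exact: emeasurable_funM.
      - by move=> u _; exact: translate_sum.
    rewrite ge0_integralZl//; last 2 first.
    - exact: measurable_funTS.
    - by move=> u _; apply: integral_ge0 => w _; rewrite mule_ge0// indic_ball_ge0.
    rewrite EFinM -muleA; apply: lee_wpmul2l; first by rewrite lee_fin.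
    exact: window_mean.
  rewrite sumZZl ?mulr_ge0//; last by move=> n; apply: integral_ge0 => w _;
      rewrite mule_ge0.
  rewrite -integral_sumZ//; last 2 first.
  - by move=> n; exact: emeasurable_funM.
  - by move=> n w; rewrite mule_ge0.
  (* 12 = 2 * 3 * 2: the length 2e of the admissible u, the overlap 3, and the two periods of eta in
     [0, 2[. *)
  have -> : (12 * K * e)%:E * I = (K * (2 * e))%:E * (3%:E * (2%:E * I)).
    by rewrite !muleA -!EFinM; congr (_%:E * _); ring.
  apply: lee_wpmul2l; first by rewrite lee_fin !mulr_ge0.
  rewrite -etaI -ge0_integralZl//; last 2 first.
  - by apply: emeasurable_funM => //; exact: measurable_EFin_indic.
  - by move=> w _; rewrite mule_ge0// lee_fin.
  apply: ge0_le_integral => //.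
  - by move=> w _; apply: sumZ_ge0 => n; rewrite mule_ge0.
  - by apply: measurable_sumZ => // [n|n w]; [exact: emeasurable_funM|rewrite mule_ge0].
  - apply: emeasurable_funM => //; apply: emeasurable_funM => //.
    exact: measurable_EFin_indic.
  (* eta may be infinite at some points: there the bound is trivial on [0, 2[, and outside [0, 2[
     every [chi n] vanishes. *)
  move=> w _; have [->|ew] := eqVneq (eta w) +oo.
    have [w02|/negbTE w02] := boolP (w \in ibloc 0 2).
      by rewrite indicE w02 mule1 mulry gtr0_sg// mul1e leey.
    rewrite sumZ0 => [|n]; first by rewrite mule_ge0// mule_ge0// lee_fin.
    rewrite /chi; case: ifP => [nN|_]; last by rewrite mule0.
    have [/(dyadic_support nN)/andP[w0 w2]|_] := boolP (_ <= w < _)%R;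
        last by rewrite mule0.
    by move: w02; rewrite in_ibloc (ltW w0) w2.
  have /fineK <- : eta w \is a fin_num by rewrite ge0_fin_numE// ltey.
  rewrite sumZZl ?fine_ge0//.
  rewrite muleCA; apply: lee_wpmul2l; first by rewrite lee_fin fine_ge0.
  exact: dyadic_overlap.
rewrite -[leRHS](integral_unit_cst 0); apply: ge0_le_integral => //.
- exact: measurable_ibloc.
- by move=> s _; apply: integral_ge0 => u _; exact: lattice_sum_ge0.
- apply: measurable_funTS; apply: measurable_itv_section.
    exact: measurable_lattice_sum.
  by move=> z; exact: lattice_sum_ge0.
Qed.

End lattice_tail.

End unfolding.

(** * Lattice sums of wavelet coefficients *)

Section basis_expansion.
Context (R : realType) (X : normedModType R).

(** Applying f (s i) to the partial sums identifies the coefficients: by biorthogonality the values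
    are constant, equal to the i-th coefficient, as soon as n > i. *)
Lemma schauder_basis_expansion (I : eqType) (e : I -> X) (f : I -> dual X)
    (s : nat -> I) (y : X) : injective s -> schauder_basis (e \o s) ->
  biorthogonal e f -> series (fun j => f (s j) y *: e (s j)) @ \oo --> y.
Proof.
move=> sI /(_ y)[a [ay _]] ef.
suff fa i : f (s i) y = a i by under eq_fun do rewrite fa.
have fy : f (s i) (series (fun j => a j *: (e \o s) j) n) @[n --> \oo] --> f (s i) y.
  exact: (cvg_comp _ _ ay (@dual_continuous _ _ (f (s i)) y)).
apply: (cvg_unique _ fy) => //.
apply: cvg_near_cst; exists i.+1 => // n /= ni.
rewrite /series /= linear_sum /=.
rewrite (bigD1_seq i) ?mem_index_iota ?iota_uniq//=.
rewrite linearZ /= ef eqxx [X in X + _]mulr1 big1 ?addr0// => j ji.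
by rewrite linearZ/= ef (inj_eq sI) eq_sym (negbTE ji) [LHS]mulr0.
Qed.

Lemma dual_expansion (I : eqType) (e : I -> X) (f : I -> dual X)
    (s : nat -> I) (y : X) (g : dual X) : injective s -> schauder_basis (e \o s) ->
  biorthogonal e f ->
  \sum_(0 <= j < n) f (s j) y * g (e (s j)) @[n --> \oo] --> g y.
Proof.
move=> sI se ef; have ey := schauder_basis_expansion (y := y) sI se ef.
have := cvg_comp _ _ ey (@dual_continuous _ _ g y).
apply: cvg_trans; rewrite (_ : (fun n => _) = g \o series (fun j => f (s j)
    y *: e (s j)))//.
apply/funext => n /=; rewrite /series /= linear_sum; apply: eq_bigr => j _.
by rewrite linearZ.
Qed.

End basis_expansion.

Section discrete_sums.
Context (R : realType).
Local Open Scope ereal_scope.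

(** Nonnegative terms may be summed in any order. This links the double sum to the enumeration along
    which the basis expansion converges. *)
Lemma sumZZ_enum (f : ZxZ -> \bar R) (s : nat -> ZxZ) : bijective s ->
  (forall z, 0 <= f z) ->
  sumZ (fun n => sumZ (fun k => f (n, k))) = \sum_(i <oo) f (s i).
Proof.
move=> sB f0; rewrite nneseries_esumT// /sumZ esum_esum//.
rewrite (@reindex_esum _ _ _ setT (setT `*`` fun=> setT) s (fun x => f (x.1, x.2)))//.
  by apply: eq_esum => i _; case: (s i).
have [sI sS] : set_inj setT s /\ set_surj setT setT s.
  by move: sB; rewrite -setTT_bijective => -[].
split => //.
by move=> z _; have [i _ <-] := sS z I; exists i.
Qed.

(* Stated with |F| + F instead of F so that all sums have nonnegative terms. *)
Lemma sumZZ_balance (F : ZxZ -> R) (s : nat -> ZxZ) (l : R) : bijective s ->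
  sumZ (fun n => sumZ (fun k => `|F (n, k)|%:E)) < +oo ->
  (\sum_(0 <= j < n) F (s j))%R @[n --> \oo] --> l ->
  sumZ (fun n => sumZ (fun k => (`|F (n, k)| + F (n, k))%:E)) + `|l|%:E =
  sumZ (fun n => sumZ (fun k => `|F (n, k)|%:E)) + (l + `|l|)%:E.
Proof.
move=> sB; have F0 z : (0 <= `|F z| + F z)%R by have := ler_norm (- F z)%R;
    rewrite normrN; lra.
rewrite (sumZZ_enum (f := fun z => `|F z|%:E) sB)// => Foo Fl.
rewrite (sumZZ_enum (f := fun z => (`|F z| + F z)%:E) sB)//.
set A := \sum_(i <oo) _ in Foo *; set B := \sum_(i <oo) _.
have cA : (\sum_(0 <= i < n) `|F (s i)|)%:E @[n --> \oo] --> A.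
  under eq_fun do rewrite -sumEFin; exact: is_cvg_nneseries.
have cB : (\sum_(0 <= i < n) (`|F (s i)| + F (s i)))%:E @[n --> \oo] --> B.
  under eq_fun do rewrite -sumEFin; apply: is_cvg_nneseries => n _ _.
  by rewrite lee_fin.
have Afin : A \is a fin_num by rewrite ge0_fin_numE// nneseries_ge0.
move: cA; rewrite -(fineK Afin) => /fine_cvgP[_ cA].
have cB' : (\sum_(0 <= i < n) (`|F (s i)| + F (s i)))%:E @[n --> \oo] --> (fine A + l)%:E.
  apply: cvg_EFin; first exact: nearW.
  rewrite (_ : _ \o _ = fun n => (\sum_(0 <= i < n) `|F (s i)| + \sum_(0 <= i < n)
      F (s i))%R).
    exact: cvgD.
  by apply/funext => n /=; rewrite big_split.
rewrite (cvg_unique _ cB cB')// -!EFinD; congr EFin; ring.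
Qed.

End discrete_sums.

(** * Shifted lattices seen through the isometries D_s T_c *)

Section covariance.
Context (R : realType).
Variables (p : R) (p1 : (1 <= p%:E)%E).
Local Notation RB := (measurableTypeR R).
Local Notation leb := (@lebesgue_measure R).
Local Notation X := (Lp leb p1).
Variables (psi : X) (psis : dual X).

Definition wavelet_coefficient (y : X) (g : dual X) (ab : R * R) : R :=
  wavelet_functional psis ab y * g (wavelet_vector psi ab).

(** The vector is moved by the inverse of D_s T_c and the functional by the adjoint of D_s T_c, so
    that g y is unchanged. *)
Definition moved_vector (s c : R) (y : X) : X := translation (- c) (dilation (- s) y).

Definition moved_functional (s c : R) (g : dual X) : dual X :=
  adjoint (@translation_continuous R p p1 c)
    (adjoint (@dilation_continuous R p p1 s) g).

Lemma norm_moved_vector s c y : `|moved_vector s c y| = `|y|.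
Proof. by rewrite norm_translation norm_dilation. Qed.

Lemma norm_moved_functional s c g : `|moved_functional s c g| <= `|g|.
Proof.
apply: dual_norm_lub => x x1; apply: (@dual_norm_ub R X g (dilation s (translation c x))).
by rewrite norm_dilation norm_translation.
Qed.

Lemma moved_pairing s c g y : moved_functional s c g (moved_vector s c y) = g y.
Proof.
rewrite /moved_functional /moved_vector /=.
by rewrite translationD subrr translation0 dilationD subrr dilation0.
Qed.

(* The shifted lattice (n + s, k + 2^n c) is the lattice Z x Z seen through the
   isometry D_s T_c. *)
Lemma wavelet_coefficient_moved (s c : R) (n k : int) y g :
  wavelet_coefficient y g (n%:~R + s, k%:~R + 2 `^ n%:~R * c) =
  wavelet_coefficient (moved_vector s c y) (moved_functional s c g) (ZxZ_to_R2 R (n, k)).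
Proof.
rewrite /wavelet_coefficient /wavelet_functional /wavelet_vector /moved_functional /moved_vector /=.
congr (psis _ * g _).
- rewrite !translation_dilation !dilationD translationD.
  have -> : - n%:~R - s = - (n%:~R + s) :> R by ring.
  congr (dilation _ (translation _ _)).
  have -> : 2 `^ (- s) = 2 `^ (- (n%:~R + s)) * 2 `^ n%:~R :> R.
    by rewrite -powRD ?pnatr_eq0 ?implybT//; congr (_ `^ _); ring.
  have e : 2 `^ n%:~R * 2 `^ (- n%:~R) = 1 :> R.
    by rewrite -powRD ?pnatr_eq0 ?implybT// subrr powRr0.
  rewrite -[_ * _ * (_ * _)]mulrA [X in _ = _ * X + _]mulrA e; ring.
- rewrite [in RHS]translation_dilation !dilationD translationD.
  congr (dilation _ (translation _ _)); ring.
Qed.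


Section lattice_identities.
Variable C : R.
Hypothesis uncond :
  unconditional_with (counting_ZxZ R) (discrete_vector psi) (discrete_functional psis) C.
Local Open Scope ereal_scope.
Notation F := wavelet_coefficient.

(** h is arbitrary so that |F| and |F| + F are treated at once; the isometry has parameter c = 2^N
    u. *)
Lemma lattice_sum_coefficient (h : R -> \bar R) (N : nat) (s u : R) y g :
  lattice_sum N (fun z : RB * RB => h (F y g z)) (s, u) =
  sumZ (fun n => sumZ (fun k => h (F (moved_vector s (2 ^+ N * u) y)
    (moved_functional s (2 ^+ N * u) g) (ZxZ_to_R2 R (n, k))))).
Proof.
apply: eq_sumZ => n; apply: eq_sumZ => k; congr h.
rewrite -wavelet_coefficient_moved; congr (F y g (_, _ + _)%R).
by rewrite mulrA powRD ?pnatr_eq0 ?implybT// powR_mulrn.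
Qed.

Hypothesis C0 : (0 <= C)%R.

Lemma discrete_abs_sum y g :
  sumZ (fun n => sumZ (fun k => `|F y g (ZxZ_to_R2 R (n, k))|%:E)) <= (C * `|y| * `|g|)%:E.
Proof.
by have := uncond y g; rewrite ge0_integral_counting_ZxZ.
Qed.

Lemma lattice_sum_abs_le (N : nat) (z : RB * RB) y g :
  lattice_sum N (fun z : RB * RB => `|F y g z|%:E) z <= (C * `|y| * `|g|)%:E.
Proof.
case: z => s u; rewrite (@lattice_sum_coefficient (fun r => `|r|%:E)).
apply: (le_trans (discrete_abs_sum _ _)).
rewrite lee_fin norm_moved_vector ler_wpM2l ?mulr_ge0//.
exact: norm_moved_functional.
Qed.

Hypothesis basis : unconditional_schauder_basis (discrete_vector psi).
Hypothesis biorth : biorthogonal_generator psi psis.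

(** The moved pair still has pairing g y, whatever s and u, so the basis expansion yields the same
    constant on every shifted lattice. Both added constants are nonnegative and can be averaged
    along with the sums. *)
Lemma lattice_sum_balance (N : nat) (z : RB * RB) y g :
  lattice_sum N (fun z : RB * RB => (`|F y g z| + F y g z)%:E) z + `|g y|%:E =
  lattice_sum N (fun z : RB * RB => `|F y g z|%:E) z + (g y + `|g y|)%:E.
Proof.
case: z => s u; rewrite (@lattice_sum_coefficient (fun r => `|r|%:E)).
rewrite (@lattice_sum_coefficient (fun r => (`|r| + r)%:E)).
set y' := moved_vector _ _ _; set g' := moved_functional _ _ _.
have [e eB [sb _]] := basis.
rewrite -(moved_pairing s (2 ^+ N * u) g y) -/y' -/g'.
apply: (@sumZZ_balance R (fun z => F y' g' (ZxZ_to_R2 R z)) e) => //.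
  exact: le_lt_trans (discrete_abs_sum _ _) (ltry _).
exact: (dual_expansion (bij_inj eB) sb biorth).
Qed.

End lattice_identities.

End covariance.

(** * Limits of the averages as N grows *)

Section lattice_limits.
Context (R : realType).
Local Notation RB := (measurableTypeR R).
Local Notation leb := (@lebesgue_measure R).
Local Open Scope ereal_scope.
Variable F : RB * RB -> \bar R.
Hypotheses (mF : measurable_fun setT F) (F0 : forall z, 0 <= F z).

Let high_scales (N : nat) (z : RB * RB) : \bar R := if (- N%:R <= z.1)%R then F z else 0.
Let low_scales (N : nat) (z : RB * RB) : \bar R := if (- N%:R <= z.1)%R then 0 else F z.

Let high0 N z : 0 <= high_scales N z.
Proof. by rewrite /high_scales; case: (_ <= _)%R. Qed.

Let low0 N z : 0 <= low_scales N z.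
Proof. by rewrite /low_scales; case: (_ <= _)%R. Qed.

Let mfst N : measurable_fun [set: RB * RB] (fun z : RB * RB => (- N%:R <= z.1)%R : bool).
Proof. by apply: measurable_fun_ler. Qed.

Let mhigh N : measurable_fun setT (high_scales N).
Proof. by apply: measurable_fun_ifT. Qed.

Let mlow N : measurable_fun setT (low_scales N).
Proof. by apply: measurable_fun_ifT. Qed.

Lemma lattice_mean_addr (N : nat) (k : \bar R) : 0 <= k ->
  \int[leb]_(s in ibloc 0 1) \int[leb]_(u in ibloc (- 2%:Z) 1)
    (lattice_sum N F (s, u) + k) = lattice_mean N F + k.
Proof.
move=> k0; have mb a := measurable_ibloc (R := R) a 1.
have mFs s : measurable_fun setT (fun u => lattice_sum N F (s, u)).
  exact: (measurableT_comp (measurable_lattice_sum N mF F0) (measurable_pair1 s)).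
transitivity (\int[leb]_(s in ibloc 0 1)
    (\int[leb]_(u in ibloc (- 2%:Z) 1) lattice_sum N F (s, u) + k)).
  apply: eq_integral => s _; rewrite ge0_integralD//.
  - by rewrite integral_unit_cst.
  - by move=> u _; exact: lattice_sum_ge0.
  - exact: measurable_funTS.
rewrite ge0_integralD//.
- by rewrite integral_unit_cst.
- by move=> s _; apply: integral_ge0 => u _; exact: lattice_sum_ge0.
- apply: measurable_funTS; apply: measurable_itv_section.
    exact: measurable_lattice_sum.
  by move=> z; exact: lattice_sum_ge0.
Qed.

Let lattice_mean_split N :
  lattice_mean N F = \int[leb \x leb]_z high_scales N z + lattice_mean N (low_scales N).
Proof.
rewrite -(@lattice_mean_unfold R N (high_scales N))//; last first.
  by move=> a b aN; rewrite /high_scales leNgt aN.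
rewrite -(lattice_meanD N (mhigh N) (mlow N) (high0 N) (low0 N)).
apply: (f_equal (lattice_mean N)); apply/funext => z.
by rewrite /high_scales /low_scales; case: (_ <= _)%R; rewrite ?adde0 ?add0e.
Qed.

Let cvg_high : \int[leb \x leb]_z high_scales N z @[N --> \oo] --> \int[leb \x leb]_z F z.
Proof.
have -> : \int[leb \x leb]_z F z = \int[leb \x leb]_z limn (high_scales ^~ z).
  apply: eq_integral => z _; apply/esym/cvg_lim => //.
  apply: cvg_near_cst; near=> N; rewrite /high_scales ifT//.
  rewrite lerNl; near: N; exact: nbhs_infty_ger.
apply: cvg_monotone_convergence => //.
move=> z _ n m nm; rewrite /high_scales; case: ifPn => [h|_]; last by case: (_ <= _)%R.
by rewrite ifT// (le_trans _ h)// lerN2 ler_nat.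
Unshelve. all: by end_near. Qed.

(** On a >= -N the mean is exactly the integral; the nonnegative rest is dropped, and monotone
    convergence in N reaches the whole plane. *)
Lemma integral_le_lattice_mean (K : \bar R) :
  (forall N, lattice_mean N F <= K) -> \int[leb \x leb]_z F z <= K.
Proof.
move=> FK; apply: cvge_le cvg_high; apply: nearW => N.
apply: le_trans (FK N); rewrite lattice_mean_split leeDl//.
apply: integral_ge0 => s _; apply: integral_ge0 => u _; exact: lattice_sum_ge0.
Qed.

(** For large N the mean exceeds the integral over a >= -N by at most a constant times 2^-N, by
    [lattice_mean_tail]. *)
Lemma lattice_mean_cvg (theta : RB -> \bar R) (K L : R) :
  measurable_fun setT theta -> (forall v, 0 <= theta v) ->
  \int[leb]_v theta v < +oo -> (0 <= K)%R -> (0 <= L)%R ->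
  (forall a b, F (a, b) <=
     K%:E * \int[leb]_v (theta v * indic_ball (2 `^ a * L) (v + b)%R)) ->
  lattice_mean N F @[N --> \oo] --> \int[leb \x leb]_z F z.
Proof.
move=> mth th0 thoo K0 L0 Fle.
have thfin : \int[leb]_v theta v \is a fin_num by rewrite ge0_fin_numE// integral_ge0.
have cvg_pow : ((2 * L / 2 ^+ N)%R : R) @[N --> \oo] --> (0 : R)%R.
  rewrite -[X in _ --> X](mulr0 (2 * L)%R); apply: cvgMr.
  under eq_fun do rewrite -exprVn; apply: cvg_expr.
  by rewrite normfV invf_lt1 ?normr_gt0// ger0_norm// ltr1n.
have tail : lattice_mean N (low_scales N) @[N --> \oo] --> 0.
  apply: (@squeeze_cvge _ _ _ _ (fun=> 0) _ (fun N : nat => (12 * K * (2 * L / 2 ^+ N)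
      * fine (\int[leb]_v theta v))%:E)).
  - near=> N; apply/andP; split.
      by apply: integral_ge0 => s _; apply: integral_ge0 => u _; exact: lattice_sum_ge0.
    rewrite EFinM fineK//; apply: lattice_mean_tail => //.
      by move=> a b; rewrite /low_scales /=; case: leP => // _; exact: Fle.
    (* [lattice_mean_tail] asks for 2L / 2^N <= 1/2, which holds for large N. *)
    rewrite ltW//; near: N; apply: (cvgr_lt 0%R cvg_pow).
    by rewrite invr_gt0.
  - exact: cvg_cst.
  - apply: cvg_EFin; first exact: nearW.
    rewrite -[X in _ --> X](mul0r (fine (\int[leb]_v theta v))).
    apply: cvgMl; rewrite -[X in _ --> X](mulr0 (12 * K)%R); exact: cvgMr.
rewrite (funext lattice_mean_split).
rewrite -[X in _ --> X]adde0; apply: cvgeD => //.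
by rewrite fin_num_adde_defl.
Unshelve. all: by end_near. Qed.

End lattice_limits.

(** The windows for s and u have measure one, so constants survive the averaging; the balance passes
    to the means and then to their limits. *)
Lemma integral_lattice_balance (R : realType)
    (F G : measurableTypeR R * measurableTypeR R -> \bar R) (k l : R) :
  measurable_fun setT F -> (forall z, 0 <= F z)%E ->
  measurable_fun setT G -> (forall z, 0 <= G z)%E -> 0 <= k -> 0 <= l ->
  (forall N z, lattice_sum N F z + k%:E = lattice_sum N G z + l%:E)%E ->
  lattice_mean N F @[N --> \oo] -->
    (\int[(@lebesgue_measure R \x @lebesgue_measure R)%E]_z F z)%E ->
  lattice_mean N G @[N --> \oo] -->
    (\int[(@lebesgue_measure R \x @lebesgue_measure R)%E]_z G z)%E ->
  (\int[(@lebesgue_measure R \x @lebesgue_measure R)%E]_z F z + k%:E =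
   \int[(@lebesgue_measure R \x @lebesgue_measure R)%E]_z G z + l%:E)%E.
Proof.
move=> mF F0 mG G0; rewrite -!lee_fin => k0 l0 bal cF cG.
have balN N : (lattice_mean N F + k%:E = lattice_mean N G + l%:E)%E.
  apply: etrans (etrans (esym (lattice_mean_addr mF F0 N k0)) _)
      (lattice_mean_addr mG G0 N l0).
  by apply: eq_integral => s _; apply: eq_integral => u _; exact: bal.
have d1 : (lattice_mean N F + k%:E)%E @[N --> \oo] -->
    (\int[(@lebesgue_measure R \x @lebesgue_measure R)%E]_z F z + k%:E)%E.
  by apply: cvgeD => //; [rewrite fin_num_adde_defl|exact: cvg_cst].
have d2 : (lattice_mean N G + l%:E)%E @[N --> \oo] -->
    (\int[(@lebesgue_measure R \x @lebesgue_measure R)%E]_z G z + l%:E)%E.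
  by apply: cvgeD => //; [rewrite fin_num_adde_defl|exact: cvg_cst].
by move: d1; rewrite (funext balN) => d1; exact: (cvg_unique _ d1 d2).
Qed.

(** * Reconstruction *)

Lemma closed_linear_kernel (R : realType) (X : normedModType R) (h : X -> R) (K : R) :
  (forall a x y, h (a *: x + y) = a * h x + h y) -> (forall x, `|h x| <= K * `|x|) ->
  closed [set x | h x = 0].
Proof.
move=> h_lin hK x clx /=; apply/eqP; rewrite -normr_le0; apply/ler_addgt0Pl => e e0.
rewrite addr0.
have K0 : 0 < `|K| + 1 by rewrite ltr_wpDl.
have [y [/= hy]] := clx _ (nbhsx_ballx x (e / (`|K| + 1)) (divr_gt0 e0 K0)).
rewrite -ball_normE /= => xy.
have -> : h x = h (x - y) by rewrite -scaleN1r addrC h_lin hy mulr0 add0r.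
rewrite (le_trans (hK _))// (@le_trans _ _ ((`|K| + 1) * `|x - y|))//.
  by rewrite ler_wpM2r// (le_trans (ler_norm _))// lerDl.
by rewrite mulrC -ler_pdivlMr// ltW.
Qed.

Lemma Lp_linear_itv_eq0 (R : realType) (p : R) (p1 : (1 <= p%:E)%E)
    (h : Lp (@lebesgue_measure R) p1 -> R) (K : R) :
  (forall a x y, h (a *: x + y) = a * h x + h y) -> (forall x, `|h x| <= K * `|x|) ->
  (forall a b, h (mkLp (mu := @lebesgue_measure R) p1 \1_`]a, b]) = 0) ->
  forall x, h x = 0.
Proof.
move=> h_lin hK h0; apply: (Lp_itv_dense (V := fun x => h x = 0)) => //.
  exact: closed_linear_kernel h_lin hK.
by move=> a x y hx hy; rewrite h_lin hx hy mulr0 addr0.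
Qed.

(** * Wavelets restricted to a bounded interval *)

Section local_norm.
Context (R : realType).
Local Notation RB := (measurableTypeR R).
Local Notation leb := (@lebesgue_measure R).
Variables (p : R) (p1 : (1 <= p%:E)%E).
Local Notation X := (Lp leb p1).
Local Notation mk := (mkLp (mu := leb) p1).
Variables (x : X) (a b : R).

Definition wavelet_fun (t : RB) : R := 2 `^ (a / p) * Lp_fun x (2 `^ a * t - b).

Lemma wavelet_fun_Lfun : wavelet_fun \in Lfun leb p%:E.
Proof. exact: (LfunP (dilation_fun a (translation_fun b (Lp_fun x)))). Qed.

Lemma wavelet_vector_mk : wavelet_vector x (a, b) = mk wavelet_fun.
Proof.
rewrite /wavelet_vector /= -[in LHS](mkLpK x) translation_mk ?LfunP// dilation_mk//.
exact: (LfunP (translation_fun b (Lp_fun x))).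
Qed.

Lemma indic_ball_real (L t : R) : indic_ball L t = (\1_(`[- L, L] : set RB) t)%:E.
Proof. by []. Qed.

Lemma local_Lfun (L : R) :
  (fun t => wavelet_fun t * (\1_(`[- L, L] : set RB) t)) \in Lfun leb p%:E.
Proof.
apply: (Lfun_dominated p1 _ wavelet_fun_Lfun).
  apply: measurable_funM; first exact: Lfun_measurable wavelet_fun_Lfun.
  by apply: measurable_indic; exact: measurable_itv.
move=> t; rewrite normrM indicE.
by case: (_ \in _); rewrite ?normr1 ?normr0 ?mulr1 ?mulr0.
Qed.

Lemma measurable_local (r : R) : measurable_fun [set: RB] (fun v : RB =>
  ((`|Lp_fun x v| `^ p)%:E * indic_ball r (v + b)%R)%E).
Proof.
have mf : measurable_fun setT (Lp_fun x) by [].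
apply: emeasurable_funM; first by apply/measurable_EFinP; exact: measurable_powR_norm.
have := @measurable_affine_comp R 1 (- b) _ (measurable_indic_ball r).
by under eq_fun do rewrite mul1r opprK.
Qed.

Lemma local_ge0 (r v : R) : (0 <= (`|Lp_fun x v| `^ p)%:E * indic_ball r (v + b)%R)%E.
Proof. by rewrite mule_ge0// ?lee_fin ?powR_ge0// indic_ball_ge0. Qed.

(** By the substitution v = 2^a t - b, the function D_a T_b x on [-L, L] sees x only within 2^a L of
    -b. The decay at very negative a comes from here. *)
Lemma norm_local_wavelet_fun (L : R) :
  ((`|mk (fun t => wavelet_fun t * \1_(`[- L, L] : set RB) t)| `^ p)%:E =
  \int[leb]_v ((`|Lp_fun x v| `^ p)%:E * indic_ball (2 `^ a * L) (v + b)%R))%E.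
Proof.
have p0 := Lexp_gt0 p1.
have a0 : 0 < 2 `^ a :> R by rewrite powR_gt0.
have mF := measurable_local (2 `^ a * L).
have F0 := local_ge0 (2 `^ a * L).
rewrite norm_mkLp_powR ?local_Lfun//.
have ga := @ge0_integral_affine R (2 `^ a) b _ a0 mF F0.
have -> : (\int[leb]_v ((`|Lp_fun x v| `^ p)%:E * indic_ball (2 `^ a * L) (v + b)%R) =
   (2 `^ a)%:E * ((2 `^ a)^-1%:E * \int[leb]_v ((`|Lp_fun x v| `^ p)%:E *
       indic_ball (2 `^ a * L) (v + b)%R)))%E.
  by rewrite muleA -EFinM mulfV ?mul1e// gt_eqF.
rewrite -ga -ge0_integralZl//; last exact: (measurable_affine_comp (2 `^ a) b mF).
apply: eq_integral => t _; rewrite subrK muleA.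
have -> : indic_ball (2 `^ a * L) (2 `^ a * t) = indic_ball L t.
  by rewrite !indic_ballE normrM (gtr0_norm a0) ler_pM2l.
rewrite indic_ball_real -!EFinM; congr EFin; rewrite /wavelet_fun indicE.
case: (_ \in _); last by rewrite !mulr0 normr0 powR0// gt_eqF.
rewrite !mulr1 normrM powRM// (ger0_norm (powR_ge0 _ _)) -powRrM.
by rewrite divfK// gt_eqF.
Qed.

End local_norm.

(** * Reconstruction for pairs of interval indicators *)

Section reconstruction.
Context (R : realType).
Local Notation RB := (measurableTypeR R).
Local Notation leb := (@lebesgue_measure R).
Variables (p q : R) (p1 : (1 <= p%:E)%E) (q1 : (1 <= q%:E)%E).
Hypothesis pq : p^-1 + q^-1 = 1.
Local Notation X := (Lp leb p1).
Local Notation Y := (Lp leb q1).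
Local Notation mkp := (mkLp (mu := leb) p1).
Local Notation mkq := (mkLp (mu := leb) q1).
Local Notation emb := (pairing_dual (mu := leb) (q1 := q1) p1 pq).
Variables (psi : X) (Psi : Y).
Local Notation F := (wavelet_coefficient psi (emb Psi)).

Let theta (v : RB) : \bar R :=
  ((`|Lp_fun Psi v| `^ q)%:E + (`|Lp_fun psi v| `^ p)%:E)%E.

(** Both pairings see only restrictions to [-L, L]. Hoelder's and then Young's inequality bound the
    product by a q-th plus a p-th power of local norms, and [norm_local_wavelet_fun] turns these
    into an integral of theta, an integrable function independent of a and b. *)
Lemma coefficient_itv_le (A B : set RB) (L : R) (a b : R) :
  \1_A \in Lfun leb p%:E -> \1_B \in Lfun leb q%:E ->
  A `<=` `[- L, L]%classic -> B `<=` `[- L, L]%classic ->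
  (`|F (mkp \1_A) (emb (mkq \1_B)) (a, b)|%:E <=
    (`|mkp \1_A| * `|mkq \1_B|)%:E *
      \int[leb]_v (theta v * indic_ball (2 `^ a * L) (v + b)%R))%E.
Proof.
move=> AL BL AK BK.
have p0 := Lexp_gt0 p1; have q0 := Lexp_gt0 q1.
have indM (D : set RB) t : D `<=` `[- L, L]%classic ->
    \1_(`[- L, L] : set RB) t * \1_D t = \1_D t :> R.
  move=> DK; rewrite !indicE; have [tD|] := boolP (t \in D); last by rewrite mulr0.
  by rewrite mem_set ?mulr1//; apply: DK; exact: set_mem.
set zG := mkq (fun t => wavelet_fun Psi a b t * \1_(`[- L, L] : set RB) t).
set zp := mkp (fun t => wavelet_fun psi a b t * \1_(`[- L, L] : set RB) t).
have e1 : wavelet_functional (emb Psi) (a, b) (mkp \1_A) = pairing zG (mkp \1_A).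
  rewrite wavelet_functional_pairing pairing_dualE wavelet_vector_mk.
  rewrite !pairing_mkLp ?local_Lfun ?wavelet_fun_Lfun//.
  by apply: eq_Rintegral => t _; rewrite -mulrA indM.
have e2 : emb (mkq \1_B) (wavelet_vector psi (a, b)) = pairing (mkq \1_B) zp.
  rewrite pairing_dualE wavelet_vector_mk.
  rewrite !pairing_mkLp ?local_Lfun ?wavelet_fun_Lfun//.
  by apply: eq_Rintegral => t _; rewrite -{1}(indM B t BK); ring.
rewrite /wavelet_coefficient e1 e2 normrM.
have -> : (\int[leb]_v (theta v * indic_ball (2 `^ a * L) (v + b)%R) =
  (`|zG| `^ q + `|zp| `^ p)%:E)%E.
  rewrite EFinD !norm_local_wavelet_fun -ge0_integralD//; last 4 first.
  - by move=> v _; exact: local_ge0.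
  - exact: measurable_local.
  - by move=> v _; exact: local_ge0.
  - exact: measurable_local.
  by apply: eq_integral => v _; rewrite /theta ge0_muleDl ?lee_fin ?powR_ge0.
rewrite -EFinM lee_fin.
apply: (@le_trans _ _ ((`|zG| * `|mkp \1_A|) * (`|mkq \1_B| * `|zp|))).
  by apply: ler_pM => //; exact: pairing_le.
rewrite [leLHS](_ : _ = (`|mkp \1_A| * `|mkq \1_B|) * (`|zG| * `|zp|)); last by ring.
apply: ler_wpM2l; first by rewrite mulr_ge0.
have qp : q^-1 + p^-1 = 1 by rewrite addrC.
apply: (le_trans (conjugate_powR (normr_ge0 zG) (normr_ge0 zp) q0 p0 qp)).
by rewrite lerD// ler_pdivrMr// ler_peMr ?powR_ge0// Lexp_ge1.
Qed.


Let mtheta : measurable_fun setT theta.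
Proof.
have mG : measurable_fun setT (Lp_fun Psi) by [].
have mf : measurable_fun setT (Lp_fun psi) by [].
by apply: emeasurable_funD; apply/measurable_EFinP; exact: measurable_powR_norm.
Qed.

Let theta0 v : (0 <= theta v)%E.
Proof. by rewrite adde_ge0// lee_fin powR_ge0. Qed.

Let theta_fin : (\int[leb]_v theta v < +oo)%E.
Proof.
have mG : measurable_fun setT (Lp_fun Psi) by [].
have mf : measurable_fun setT (Lp_fun psi) by [].
rewrite /theta ge0_integralD; last 5 first.
- exact: measurableT.
- by move=> v _; rewrite lee_fin powR_ge0.
- by apply/measurable_EFinP; exact: measurable_powR_norm.
- by move=> v _; rewrite lee_fin powR_ge0.
- by apply/measurable_EFinP; exact: measurable_powR_norm.
by rewrite -!Lp_fun_norm_powR -EFinD ltry.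
Qed.

Variable C : R.
Hypothesis uncond : unconditional_with (counting_ZxZ R)
  (discrete_vector psi) (discrete_functional (emb Psi)) C.
Hypothesis C0 : 0 <= C.
Hypothesis basis : unconditional_schauder_basis (discrete_vector psi).
Hypothesis biorth : biorthogonal_generator psi (emb Psi).

Let mF y g : measurable_fun [set: RB * RB] (F y g).
Proof. exact: wavelet_coefficient_measurable. Qed.

Let mabsF y g : measurable_fun [set: RB * RB] (fun z => `|F y g z|%:E).
Proof. by apply/measurable_EFinP; apply: measurableT_comp. Qed.

Let absF0 y g (z : RB * RB) : (0 <= `|F y g z|%:E)%E.
Proof. by rewrite lee_fin. Qed.

Lemma integral_abs_coefficient_le y g :
  (\int[leb \x leb]_z `|F y g z|%:E <= (C * `|y| * `|g|)%:E)%E.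
Proof.
apply: integral_le_lattice_mean => // N; apply: lattice_mean_le => // z.
exact: lattice_sum_abs_le.
Qed.

Lemma coefficient_integrable y g :
  (leb \x leb)%E.-integrable [set: RB * RB] (EFin \o F y g).
Proof.
apply/integrableP; split; first exact/measurable_EFinP.
exact: le_lt_trans (integral_abs_coefficient_le y g) (ltry _).
Qed.

Lemma reconstruction_itv (al be ga de : R) :
  \int[(leb \x leb)%E]_z F (mkp \1_`]al, be]) (emb (mkq \1_`]ga, de])) z =
  emb (mkq \1_`]ga, de]) (mkp \1_`]al, be]).
Proof.
set y := mkp _; set g := emb (mkq _); set l : R := g y.
(* A radius for which [-L, L] contains both intervals. *)
pose L := `|al| + `|be| + `|ga| + `|de|.
have L0 : 0 <= L by rewrite !addr_ge0.
have sub a b : `|a| + `|b| <= L -> `]a, b]%classic `<=` `[- L, L]%classic.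
  move=> abL t; rewrite /= !in_itv/= => /andP[at_ tb]; move: abL.
  have := ler_norm b; have := ler_norm (- a); rewrite normrN.
  have := normr_ge0 a; have := normr_ge0 b => ? ? ? ? ?; apply/andP; split; lra.
have F_le a b : (`|F y g (a, b)|%:E <= (`|y| * `|mkq \1_`]ga, de]|)%:E *
    \int[leb]_v (theta v * indic_ball (2 `^ a * L) (v + b)%R))%E.
  apply: (coefficient_itv_le a b (itv_indic_Lfun p1 al be) (itv_indic_Lfun q1 ga de));
      apply: sub.
    by rewrite /L -addrA lerDl addr_ge0.
  by rewrite /L -[leRHS]addrA lerDr addr_ge0.
set K := `|y| * _ in F_le.
have K0 : 0 <= K by rewrite mulr_ge0.
have F20 (z : RB * RB) : (0 <= (`|F y g z| + F y g z)%:E)%E.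
  by rewrite lee_fin; have := ler_norm (- F y g z); rewrite normrN; lra.
have mF2 : measurable_fun [set: RB * RB] (fun z => (`|F y g z| + F y g z)%:E).
  by apply/measurable_EFinP; apply: measurable_funD => //; apply: measurableT_comp.
have c1 := lattice_mean_cvg (mabsF y g) (absF0 y g) mtheta theta0 theta_fin K0 L0 F_le.
have c2 : lattice_mean N (fun z => (`|F y g z| + F y g z)%:E) @[N --> \oo] -->
    (\int[leb \x leb]_z (`|F y g z| + F y g z)%:E)%E.
  apply: (lattice_mean_cvg mF2 F20 mtheta theta0 theta_fin (K := 2 * K) _ L0).
    by rewrite mulr_ge0.
  move=> a b; rewrite EFinM -muleA.
  apply: (@le_trans _ _ (2%:E * `|F y g (a, b)|%:E)%E); last by rewrite lee_wpmul2l.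
  by rewrite -EFinM lee_fin; have := ler_norm (F y g (a, b)); lra.
have iF := coefficient_integrable y g.
have iabs : (leb \x leb)%E.-integrable [set: RB * RB] (EFin \o (fun z => `|F y g z|)).
  exact: integrable_abse iF.
have k1 : 0 <= `|l| by [].
have k2 : 0 <= l + `|l| by have := ler_norm (- l); rewrite normrN; lra.
have lim := integral_lattice_balance mF2 F20 (mabsF y g) (absF0 y g) k1 k2
  (fun N z => lattice_sum_balance uncond basis biorth N z y g) c2 c1.
have e : (\int[leb \x leb]_z (`|F y g z| + F y g z)%:E =
    \int[leb \x leb]_z `|F y g z|%:E + \int[leb \x leb]_z (F y g z)%:E)%E.
  exact: (integralD_EFin measurableT iabs iF).
(* All integrals are finite, so the equation can be read in R, where the integral of |F| cancels. *)
move: lim; rewrite e -(EFin_Rintegral iF) -(EFin_Rintegral iabs) -!EFinD => -[] => h.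
by lra.
Qed.

End reconstruction.

(** * Pettis integrability and the constant *)

Section pettis.
Context (R : realType).
Local Notation RB := (measurableTypeR R).
Local Notation leb := (@lebesgue_measure R).
Local Notation leb2 := (leb \x leb)%E.
Variables (p q : R) (p1 : (1 <= p%:E)%E) (q1 : (1 <= q%:E)%E).
Hypotheses (p_gt1 : 1 < p) (q_gt1 : 1 < q).
Hypotheses (pq : p^-1 + q^-1 = 1) (qp : q^-1 + p^-1 = 1).
Local Notation X := (Lp leb p1).
Local Notation Y := (Lp leb q1).
Local Notation emb := (pairing_dual (mu := leb) (q1 := q1) p1 pq).
Variables (psi : X) (Psi : Y) (C : R).
Local Notation F := (wavelet_coefficient psi (emb Psi)).
Hypothesis uncond : unconditional_with (counting_ZxZ R)
  (discrete_vector psi) (discrete_functional (emb Psi)) C.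
Hypothesis C0 : 0 <= C.

Let iF E y g : measurable E -> leb2.-integrable E (EFin \o F y g).
Proof.
move=> mE; apply: (integrableS measurableT mE) => //.
exact: (coefficient_integrable uncond C0).
Qed.

Section subset.
Variable E : set (RB * RB).
Hypothesis mE : measurable E.

Definition coefficient_integral (y : X) (g : dual X) : R := \int[leb2]_(z in E) F y g z.

Lemma coefficient_integral_linearl g (a : R) (x y : X) :
  coefficient_integral (a *: x + y) g =
  a * coefficient_integral x g + coefficient_integral y g.
Proof.
rewrite /coefficient_integral -RintegralZl//; last exact: iF.
rewrite -RintegralD//; [|exact: integrableZl (iF x g mE)|exact: iF].
apply: eq_Rintegral => z _; rewrite /wavelet_coefficient.
rewrite (dual_linear (wavelet_functional (emb Psi) z)) mulrDl; congr (_ + _).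
by rewrite mulrA.
Qed.

Lemma coefficient_integral_linearr y (a : R) (g h : dual X) :
  coefficient_integral y (a *: g + h) =
  a * coefficient_integral y g + coefficient_integral y h.
Proof.
rewrite /coefficient_integral -RintegralZl//; last exact: iF.
rewrite -RintegralD//; [|exact: integrableZl (iF y g mE)|exact: iF].
apply: eq_Rintegral => z _; rewrite /wavelet_coefficient.
rewrite [(a *: g + h) _](_ : _ = a * g (wavelet_vector psi z) + h (wavelet_vector psi z))//.
by rewrite mulrDr mulrCA.
Qed.

Lemma coefficient_integral_le y g : `|coefficient_integral y g| <= C * `|y| * `|g|.
Proof.
have i := iF y g mE.
apply: (le_trans (le_normr_Rintegral mE i)).
have i' : leb2.-integrable E (EFin \o (fun z => `|F y g z|)) by exact: integrable_abse i.
rewrite -lee_fin /Rintegral fineK; last exact: integrable_fin_num i'.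
apply: le_trans (integral_abs_coefficient_le uncond C0 y g).
apply: ge0_subset_integral => //.
apply/measurable_EFinP; apply: measurableT_comp => //.
exact: wavelet_coefficient_measurable.
Qed.

End subset.

Section reconstruction.
Hypothesis basis : unconditional_schauder_basis (discrete_vector psi).
Hypothesis biorth : biorthogonal_generator psi (emb Psi).

Let defect (y : X) (g : dual X) : R := coefficient_integral setT y g - (g y : R).

Let defect_linearl g (a : R) (x y : X) :
  defect (a *: x + y) g = a * defect x g + defect y g.
Proof.
rewrite /defect coefficient_integral_linearl// dual_linear.
by rewrite mulrBr opprD addrACA.
Qed.

Let defect_linearr y (a : R) (G H : Y) :
  defect y (emb (a *: G + H)) = a * defect y (emb G) + defect y (emb H).
Proof.
rewrite /defect (pairing_dual_linear p1 pq a G H) coefficient_integral_linearr//.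
by rewrite mulrBr [in LHS]opprD addrACA.
Qed.

Let defect_le y g : `|defect y g| <= (C + 1) * `|y| * `|g|.
Proof.
rewrite (le_trans (ler_normB _ _))// mulrDl mulrDl lerD//.
  exact: coefficient_integral_le.
by rewrite mul1r mulrC; exact: dual_norm_le.
Qed.

(** Riesz representation makes g a function G. The defect is a bounded bilinear form that vanishes
    on pairs of interval indicators, so density applies first in G with y fixed, then in y. *)
Lemma coefficient_reconstruction (y : X) (g : dual X) :
  coefficient_integral setT y g = g y.
Proof.
have [G ->] := dual_Lp_riesz q1 g p_gt1 pq.
suff : defect y (emb G) = 0 by move/eqP; rewrite subr_eq0 => /eqP.
move: G; apply: (@Lp_linear_itv_eq0 _ _ _ (fun G => defect y (emb G)) ((C + 1) * `|y|)).
- exact: defect_linearr.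
- move=> G; apply: (le_trans (defect_le _ _)).
  by rewrite ler_wpM2l ?mulr_ge0 ?addr_ge0// pairing_dual_norm.
move=> ga de; move: y; set g' := emb _.
apply: (@Lp_linear_itv_eq0 _ _ _ (defect ^~ g') ((C + 1) * `|g'|)).
- by move=> a x y; exact: defect_linearl.
- by move=> y; rewrite mulrAC; exact: defect_le.
move=> al be; apply/eqP; rewrite subr_eq0; apply/eqP.
exact: (reconstruction_itv uncond C0 basis biorth).
Qed.

Lemma wavelet_is_pettis_integral (y : X) :
  is_pettis_integral (@lebesgue_measure2 R) setT
    (fun z => wavelet_functional (emb Psi) z y *: wavelet_vector psi z) y.
Proof.
move=> g.
have e : (fun z : RB * RB => (g (wavelet_functional (emb Psi)
    z y *: wavelet_vector psi z))%:E) =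
    EFin \o F y g.
  by apply/funext => z; rewrite /= linearZ.
rewrite e; have i := iF y g measurableT; split; first exact: i.
rewrite -[in RHS](coefficient_reconstruction y g) /coefficient_integral EFin_Rintegral//.
Qed.

End reconstruction.

(** The integral over E against [emb G] is a bounded functional of G in L_q. Riesz representation on
    L_q provides the candidate in L_p, and Riesz representation on L_p shows that the functionals
    [emb G] are all there are. *)
Lemma wavelet_pettis_integrable (y : X) :
  pettis_integrable (@lebesgue_measure2 R)
    (fun z => wavelet_functional (emb Psi) z y *: wavelet_vector psi z).
Proof.
move=> E mE.
pose h (G : Y) : R^o := coefficient_integral E y (emb G).
have h_lin : linear h.
  by move=> a G H; rewrite /h linearP coefficient_integral_linearr.
have h_bd : h \in @bounded_functional R Y.
  apply/asboolP; split => //.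
  pose hl : {linear Y -> R^o} := HB.pack h (GRing.isLinear.Build R Y R^o *:%R h h_lin).
  rewrite -[h]/(hl : Y -> R^o).
  apply: bounded_linear_continuous; apply/linear_boundedP.
  exists (C * `|y|); split; first exact: num_real.
  move=> r r1 G; rewrite (le_trans (coefficient_integral_le mE y (emb G)))//.
  apply: ler_pM; rewrite ?mulr_ge0//; first exact: ltW.
  exact: pairing_dual_norm.
have [H hH] := dual_Lp_riesz p1 (Dual h_bd) q_gt1 qp.
exists H => g.
have e : (fun z : RB * RB => (g (wavelet_functional (emb Psi)
    z y *: wavelet_vector psi z))%:E) =
    EFin \o F y g.
  by apply/funext => z; rewrite /= linearZ.
rewrite e; have i := iF y g mE; split; first exact: i.
have [G gG] := dual_Lp_riesz q1 g p_gt1 pq.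
have hHG : h G = pairing H G by rewrite -[LHS]/(Dual h_bd G) hH.
rewrite {2}gG pairing_dualE [pairing G H](_ : _ = pairing H G); last first.
  by apply: eq_Rintegral => t _; rewrite mulrC.
rewrite -hHG /h -gG /coefficient_integral /Rintegral fineK//.
exact: integrable_fin_num i.
Qed.

End pettis.

(** * Existence of the least constant *)

Section unconditionality.
Context d (M : measurableType d) (R : realType).
Variables (mu : {sigma_finite_measure set M -> \bar R}) (X : normedModType R).
Variables (x : M -> X) (f : M -> dual X).

Lemma unconditional_with_ge0 (B : R) (y : X) (g : dual X) :
  y != 0 -> g != 0 -> unconditional_with mu x f B -> 0 <= B.
Proof.
move=> y0 g0 /(_ y g) h.
have n0 : 0 < `|y| * `|g| by rewrite mulr_gt0// normr_gt0.
have : (0 <= (B * `|y| * `|g|)%:E)%E.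
  by apply: le_trans h; apply: integral_ge0 => z _; rewrite lee_fin.
by rewrite lee_fin -mulrA pmulr_lge0.
Qed.

(** The infimum of the admissible constants is itself admissible: when |y| |g| > 0 the inequality
    says that the constant is at least a fixed ratio, and otherwise the integral is 0. The nonzero
    pair y0, g0 bounds the admissible constants below by 0. *)
Lemma ex_unconditionality_constant (B : R) (y0 : X) (g0 : dual X) :
  y0 != 0 -> g0 != 0 -> unconditional_with mu x f B ->
  exists2 B', is_unconditionality_constant mu x f B' & B' <= B.
Proof.
move=> y00 g00 hB; pose U := [set B | unconditional_with mu x f B].
have lbU : lbound U 0 by move=> B' /= /(unconditional_with_ge0 y00 g00).
have hU : has_inf U by split; [exists B|exists 0].
have Ule B' : U B' -> inf U <= B' by move=> hB'; apply: inf_lbound => //; exists 0.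
exists (inf U); last exact: Ule.
split => // y g.
have I0 : (0 <= \int[mu]_t `|f t y * g (x t)|%:E)%E.
  by apply: integral_ge0 => t _; rewrite lee_fin.
have : (\int[mu]_t `|f t y * g (x t)|%:E \is a fin_num)%E.
  by rewrite ge0_fin_numE//; exact: le_lt_trans (hB y g) (ltry _).
move=> /fineK e; rewrite -e lee_fin.
have [n0|n0] := eqVneq (`|y| * `|g|) 0.
  by have := hB y g; rewrite -e lee_fin -!mulrA n0 !mulr0.
have npos : 0 < `|y| * `|g| by rewrite lt_neqAle eq_sym n0 mulr_ge0.
rewrite -mulrA -ler_pdivrMr//; apply: lb_le_inf; first by exists B.
move=> B' /(_ y g); rewrite -e lee_fin -mulrA.
by rewrite ler_pdivrMr.
Qed.

End unconditionality.

(** The constant C' of the continuous frame is the infimum of its admissible bounds, of which C is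
    one; this is the inequality C' <= C. The reverse inequality is not part of the conclusion. *)
Theorem theorem4p2 (R : realType) (p : R) (p_gt1 : 1 < p)
    (psi : Lp (@lebesgue_measure R) (EFin_ge1 p_gt1))
    (psis : dual (Lp (@lebesgue_measure R) (EFin_ge1 p_gt1))) (C : R) :
  wavelet psi ->
  biorthogonal_generator psi psis ->
  wavelet_unconditionality_constant psi psis C ->
  continuous_wavelet psi psis /\
  exists2 C' : R,
    continuous_wavelet_unconditionality_constant psi psis C' & C' <= C.
Proof.
move=> [psi1 basis] biorth [uncond _].
have psi0 : psi != 0 by rewrite -normr_eq0 psi1 oner_eq0.
have psis0 : psis != 0.
  apply/eqP => e; have := biorth (0, 0) (0, 0); rewrite e eqxx => /eqP.
  by rewrite eq_sym oner_eq0.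
have C0 := unconditional_with_ge0 psi0 psis0 uncond.
pose q := p / (p - 1).
have pm1 : 0 < p - 1 by rewrite subr_gt0.
have p0 : 0 < p by rewrite (lt_trans ltr01).
have q_gt1 : 1 < q by rewrite ltr_pdivlMr// mul1r gtrDl oppr_lt0.
have pq : p^-1 + q^-1 = 1 by rewrite /q; field; rewrite !gt_eqF.
have qp : q^-1 + p^-1 = 1 by rewrite addrC.
have [Psi psisE] := dual_Lp_riesz (EFin_ge1 q_gt1) psis p_gt1 pq.
subst psis; split.
  split; first exact: borel_measurable_wavelet.
  - move=> y; exact: (wavelet_pettis_integrable p_gt1 q_gt1 qp uncond C0).
  - move=> y; exact: (wavelet_is_pettis_integral p_gt1 uncond C0 basis biorth).
apply: (ex_unconditionality_constant psi0 psis0) => y g.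
exact: (integral_abs_coefficient_le uncond C0).
Qed.
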